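(* Let $\zeta_1,\dots,\zeta_L>0$ with $\sum_k\zeta_k=1$ be fixed. Assume the distribution of the attenuation coefficients $d_{k,l,m}$ does not depend on $N$ or $m$ (only on $(k,l)$), and let $N\to\infty$ with $K/N=\beta$ fixed. Then $$\lim_{N\to\infty,\;K/N=\beta} r^{(N)}_{\rm TD}(\{\zeta_k\})=\frac{\tau_d}{\tau_c}\cdot\frac{1}{L\beta}\sum_{k=1}^{L}\zeta_k\,\Psi\big(A^{\rm TD}_k,\beta\big).$$
   Context: System model (uplink multi-cell MIMO). Fix integers $L\ge 1$ (cells), $N$ (antennas per base station, BS) and $K$ (single-antenna user terminals, UTs, per cell); $\mathcal L=\{1,\dots,L\}$, $\mathcal K=\{1,\dots,K\}$. For $k,l\in\mathcal L$, $D_{k,l}$ is a random $K\times K$ diagonal matrix with strictly positive diagonal entries $d_{k,l,1},\dots,d_{k,l,K}$ (attenuation between the UTs of cell $l$ and BS $k$); all $d_{k,l,m}$ are mutually independent and, for fixed $(k,l)$, $d_{k,l,1},\dots,d_{k,l,K}$ are identically distributed. Block fading with coherence $\tau_c$ symbols, $\tau_p\ge K$ pilot and $\tau_d=\tau_c-\tau_p$ data symbols; noise variance $\sigma_w^2>0$. Logarithms are base 2, $|\cdot|$ is the determinant. Definitions: $b_{k,l,m}=\dfrac{\tau_p d_{k,l,m}^2}{\sigma_w^2+\tau_p\sum_{l'=1}^{L}d_{k,l',m}^2}$; $B_{k,l}=\mathrm{diag}(b_{k,l,1},\dots,b_{k,l,K})$; $M$ is an $N\times K$ matrix with i.i.d.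 zero-mean unit-variance proper complex Gaussian entries independent of all $D_{k,l}$; $\Phi^{\rm TD}_k(\zeta_k)=\dfrac{1}{\mathrm{Tr}((I_K-B_{k,k})D_{k,k}^2)+\zeta_k\sigma_w^2}B_{k,k}D_{k,k}^2$; and $r^{(N)}_{\rm TD}(\{\zeta_k\})=\frac{\tau_d}{\tau_c}\frac{1}{LK}\sum_{k=1}^{L}\zeta_k\mathbb E\{\log|I_N+M\Phi^{\rm TD}_k(\zeta_k)M^H|\}$ (the achievable average ergodic rate when the data phase is time-divided between cells, cell $k$ using a fraction $\zeta_k$ with transmit power $1/\zeta_k$). Random variable: $A^{\rm TD}_k=\dfrac{b_{k,k,1}d_{k,k,1}^2}{\beta\,\mathbb E\{(1-b_{k,k,1})d_{k,k,1}^2\}}$. For a nonnegative real random variable $A$ and $\beta>0$, $\Psi(A,\beta)=\beta\,\mathbb E\{\log(1+\eta A)\}-\log\eta+(\eta-1)\log e$, where $\eta\in(0,1]$ is the solution of $\beta=\dfrac{1-\eta}{1-\mathbb E\{1/(1+\eta A)\}}$. *)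

(* Defs.v *)
From HB Require Import structures.
From mathcomp Require Import all_boot all_order all_algebra.
From mathcomp Require Import all_classical all_reals all_analysis.
From mathcomp Require Import complex.

Set Implicit Arguments.
Unset Strict Implicit.
Unset Printing Implicit Defensive.
Import Order.TTheory GRing.Theory Num.Theory.
Local Open Scope classical_set_scope.
Local Open Scope ring_scope.

Section Defs.
Context {R : realType}.

Definition log2 (x : R) : R := ln x / ln 2.

(** Mutual independence of a finite family of real random variables:
    each is measurable and, for all Borel sets B_i,
    P (/\_i {X_i \in B_i}) = prod_i P {X_i \in B_i}.
    (For a finite index set this is equivalent to the product rule over
    every subfamily: take B_j = setT for the omitted indices.) *)
Definition mutually_independent d (T : measurableType d) (P : probability T R)
    (I : finType) (X : I -> T -> R) : Prop :=
  (forall i, measurable_fun setT (X i)) /\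
  forall B : I -> set R, (forall i, measurable (B i)) ->
    P (\bigcap_(i in [set: I]) (X i @^-1` B i)) =
    \big[*%E/1%E]_(i : I) P (X i @^-1` B i).

Definition pilot_b (tau_p sigma2 : R) (L : nat) (dkm : 'I_L -> R) (l : 'I_L) : R :=
  tau_p * dkm l ^+ 2 / (sigma2 + tau_p * \sum_(l' < L) dkm l' ^+ 2).

Definition Phi_TD (tau_p sigma2 : R) (L K : nat) (dk : 'I_L -> 'I_K -> R)
    (k : 'I_L) (zetak : R) : 'M[R[i]]_K :=
  let b m := pilot_b tau_p sigma2 (fun l => dk l m) k in
  let tr := \sum_(m < K) (1 - b m) * dk k m ^+ 2 in
  diag_mx (\row_(m < K) ((b m * dk k m ^+ 2 / (tr + zetak * sigma2))%:C)%C).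

Definition chanM (N K : nat) (T : Type) (X Y : 'I_N -> 'I_K -> T -> R) (w : T)
  : 'M[R[i]]_(N, K) := \matrix_(a < N, j < K) (X a j w +i* Y a j w)%C.

(** log2 |I_N + M Phi M^H| (the determinant is real and positive; we take
    its real part). *)
Definition logdet (N K : nat) (M : 'M[R[i]]_(N, K)) (Phi : 'M[R[i]]_K) : R :=
  log2 (complex.Re (\det (1%:M + M *m Phi *m (map_mx (@conjc R) M)^T))).

Definition rTD (tau_c tau_p : nat) (sigma2 : R) (L N K : nat) (zeta : 'I_L -> R)
    d (T : measurableType d) (P : probability T R)
    (dd : 'I_L -> 'I_L -> 'I_K -> T -> R) (X Y : 'I_N -> 'I_K -> T -> R) : \bar R :=
  (((tau_c%:R - tau_p%:R) / tau_c%:R) / (L * K)%:R)%:E *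
  \sum_(k < L) ((zeta k)%:E *
     'E_P[fun w => logdet (chanM X Y w)
                     (Phi_TD tau_p%:R sigma2 (fun l m => dd k l m w) k (zeta k))])%E.

Definition model_family (L N K : nat) (T : Type)
    (dd : 'I_L -> 'I_L -> 'I_K -> T -> R) (X Y : 'I_N -> 'I_K -> T -> R)
    (i : ('I_L * 'I_L * 'I_K + 'I_N * 'I_K * bool)%type) : T -> R :=
  match i with
  | inl klm => dd klm.1.1 klm.1.2 klm.2
  | inr ajb => if ajb.2 then Y ajb.1.1 ajb.1.2 else X ajb.1.1 ajb.1.2
  end.

(** E{(1 - b_{k,k,1}) d_{k,k,1}^2}, computed with a copy e_{k,l} of
    (d_{k,l,1})_l *)
Definition interf_mean (tau_p : nat) (sigma2 : R) (L : nat)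
    d (T0 : measurableType d) (P0 : probability T0 R)
    (e : 'I_L -> 'I_L -> T0 -> R) (k : 'I_L) : \bar R :=
  'E_P0[fun w => (1 - pilot_b tau_p%:R sigma2 (fun l => e k l w) k) * e k k w ^+ 2].

Definition A_TD (tau_p : nat) (sigma2 beta : R) (L : nat)
    d (T0 : measurableType d) (P0 : probability T0 R)
    (e : 'I_L -> 'I_L -> T0 -> R) (k : 'I_L) : T0 -> R :=
  fun w => pilot_b tau_p%:R sigma2 (fun l => e k l w) k * e k k w ^+ 2
           / (beta * fine (interf_mean tau_p sigma2 P0 e k)).

Definition eta_sol d (T0 : measurableType d) (P0 : probability T0 R)
    (A : T0 -> R) (beta : R) : R :=
  xget 1 [set eta : R | 0 < eta <= 1 /\
     beta = (1 - eta) / (1 - fine 'E_P0[fun w => (1 + eta * A w)^-1])].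

Definition Psi d (T0 : measurableType d) (P0 : probability T0 R)
    (A : T0 -> R) (beta : R) : \bar R :=
  let eta := eta_sol P0 A beta in
  (beta%:E * 'E_P0[fun w => log2 (1 + eta * A w)] +
   (- log2 eta + (eta - 1) * log2 (expR 1))%:E)%E.

End Defs.

(* Main.v *)
(* With [D = det (I + sum_j phi_j m_j m_j^H)] for fixed [phi], Jensen's inequality sandwiches
   [E ln D] between [- ln E (1 / D)] and [ln E D], and for a Gaussian matrix both means are
   accessible: [E D] satisfies a recursion giving [E D <= N! e^al / al^N prod_j (1 + phi_j al)],
   and [E (1 / D)] is the Gamma integral of [prod_j (1 + phi_j r)^-1].  Both bounds equal
   [N min_x (x - 1 - ln x + N^-1 sum_j ln (1 + N phi_j x))] up to [O(ln N)].  The random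
   [phi] is then handled by decoupling it from the channel; its empirical means concentrate
   by second moments of bounded functions (the signal power may have infinite mean, so the
   interference is truncated), and the minimum is attained at the fixed point [eta]. *)
Require Import Defs.
From HB Require Import structures.
From mathcomp Require Import all_boot all_order all_algebra.
From mathcomp Require Import all_classical all_reals all_analysis.
From mathcomp Require Import measurable_realfun complex.
From mathcomp Require Import ring lra.
Set Implicit Arguments.
Unset Strict Implicit.
Unset Printing Implicit Defensive.
Import Order.TTheory GRing.Theory Num.Theory.
Import numFieldNormedType.Exports.
Local Open Scope classical_set_scope.
Local Open Scope ring_scope.

(** * Joint laws of independent families *)

(** The rate may diverge: neither [A] nor [ln (1 + A eta)] is assumed to have a finite mean. So
    estimates are inequalities between integrals of nonnegative functions, a constant being added to
    both sides where a sign would be missing, and limits are taken in the extended reals. Bad events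
    are never conditioned upon: each is charged to a nonnegative quantity that is at least [1] on it
    and has a small mean. For the lower bound the charge has to cover the whole main term, so the
    logarithms are first capped at a constant [C], which is fixed before [N] grows. The upper bound
    only needs the free energy at the point [eta]. The lower bound needs its infimum over all [x]
    for random coefficients; convexity in [ln x] reduces this to one empirical mean taken at [eta],
    with an error quadratic in its deviation. In [E (1 / D)] the squared norm of a Gaussian vector
    is exchanged for a Gamma variable by comparing Laplace transforms on exactly the functions that
    occur, so that its distribution never has to be identified. *)

Section joint_law.
Context {R : realType} {I : finType}.
Implicit Type x : I -> R.

Definition tuple_fun (t : #|I|.-tuple R) (i : I) : R := tnth t (enum_rank i).

Definition fun_tuple x : #|I|.-tuple R := [tuple x (enum_val j) | j < #|I|].

Lemma fun_tupleK : cancel fun_tuple tuple_fun.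
Proof. by move=> x; apply/funext => i; rewrite /tuple_fun tnth_mktuple enum_rankK. Qed.

Lemma measurable_fun_tuple d (T : measurableType d) (Z : T -> I -> R) :
  (forall i, measurable_fun setT (Z ^~ i)) ->
  measurable_fun setT (fun w => fun_tuple (Z w)).
Proof.
move=> mZ; apply/measurable_fun_tnthP => j.
rewrite [X in measurable_fun _ X](_ : _ = Z ^~ (enum_val j)) //.
by apply/funext => w /=; rewrite tnth_mktuple.
Qed.

Lemma measurable_tuple_fun (i : I) : measurable_fun setT (tuple_fun ^~ i).
Proof. exact: measurable_tnth. Qed.

(** Families are read as tuples because tuples carry the product sigma-algebra, for which
    measurability is checked coordinate by coordinate. *)
Definition measurable_family d (U : measurableType d) (F : (I -> R) -> U) : Prop :=
  measurable_fun [set: #|I|.-tuple R] (fun t => F (tuple_fun t)).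

Definition box (B : I -> set R) : set (#|I|.-tuple R) :=
  [set t | forall i, B i (tuple_fun t i)].

Definition boxes : set (set (#|I|.-tuple R)) :=
  [set A | exists2 B : I -> set R, (forall i, measurable (B i)) & A = box B].

Lemma boxE (B : I -> set R) :
  box B = \bigcap_(i in [set: I]) ((tuple_fun ^~ i) @^-1` B i).
Proof. by apply/seteqP; split => t /= tB i; [move=> _|]; apply: tB. Qed.

(** A coordinate cylinder is a box with [setT] in the other slots, and a box is a finite
    intersection of cylinders. Boxes are the right generators: they are closed under intersection
    and independence prescribes their probabilities. *)
Lemma boxes_generate : measurable = <<s boxes >>.
Proof.
apply/seteqP; split.
  apply: smallest_sub; first exact: smallest_sigma_algebra.
  rewrite -bigcup_seq; apply: bigcup_sub => j _ A [B mB <-].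
  apply: sub_sigma_algebra; exists (fun i => if enum_rank i == j then B else setT).
    by move=> i; case: ifP => // _; exact: measurableT.
  apply/seteqP; split => t /=.
    by move=> [_ Bt] i; case: eqP => // <- in Bt *.
  by move=> /(_ (enum_val j)); rewrite enum_valK eqxx /tuple_fun enum_valK.
apply: smallest_sub; first exact: sigma_algebra_measurable.
move=> A [B mB ->]; rewrite boxE; apply: fin_bigcap_measurable => // i _.
by rewrite -[_ @^-1` _]setTI; exact: measurable_tuple_fun.
Qed.

(** By independence and equal marginals the two joint laws agree on boxes, hence on the whole
    sigma-algebra. The probability spaces are unrelated, so this serves both to pass to a product
    space and to move to the reference attenuations. *)
Lemma indep_integral_eq d d' (T : measurableType d) (T' : measurableType d')
    (P : probability T R) (P' : probability T' R)
    (X : I -> T -> R) (Y : I -> T' -> R) (F : (I -> R) -> \bar R) :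
  mutually_independent P X -> mutually_independent P' Y ->
  (forall i B, measurable B -> P (X i @^-1` B) = P' (Y i @^-1` B)) ->
  measurable_family F -> (forall x, 0 <= F x)%E ->
  (\int[P]_w F (X ^~ w) = \int[P']_w F (Y ^~ w))%E.
Proof.
move=> [mX iX] [mY iY] XY mF F0.
pose x w := fun_tuple (X ^~ w); pose y w := fun_tuple (Y ^~ w).
have mx : measurable_fun setT x by exact: measurable_fun_tuple.
have my : measurable_fun setT y by exact: measurable_fun_tuple.
have EX : (\int[P]_w F (X ^~ w) = \int[pushforward P x]_t F (tuple_fun t))%E.
  rewrite ge0_integral_pushforward //.
  by rewrite preimage_setT; apply: eq_integral => w _ /=; rewrite fun_tupleK.
have EY : (\int[P']_w F (Y ^~ w) = \int[pushforward P' y]_t F (tuple_fun t))%E.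
  rewrite ge0_integral_pushforward //.
  by rewrite preimage_setT; apply: eq_integral => w _ /=; rewrite fun_tupleK.
pose xm := HB.pack_for {mfun T >-> #|I|.-tuple R} x (isMeasurableFun.Build _ _ _ _ _ mx).
pose ym := HB.pack_for {mfun T' >-> #|I|.-tuple R} y (isMeasurableFun.Build _ _ _ _ _ my).
rewrite EX EY; apply: (@eq_measure_integral _ _ _ _ (distribution P' ym) (distribution P xm)) => A mA _.
apply: (measure_unique boxes (fun=> setT)) => //.
- exact: boxes_generate.
- move=> _ _ [B mB ->] [C mC ->]; exists (fun i => B i `&` C i).
    by move=> i; exact: measurableI.
  apply/seteqP; split => t /=; first by move=> [tB tC] i; split.
  by move=> tBC; split => i; have [] := tBC i.
- move=> _; exists (fun=> setT) => //.
  by apply/seteqP; split.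
- by rewrite bigcup_const.
- move=> _ [B mB ->]; change (P (x @^-1` box B) = P' (y @^-1` box B)).
  have -> : x @^-1` box B = \bigcap_(i in [set: I]) (X i @^-1` B i).
    apply/seteqP; split => w /= H i; last by rewrite fun_tupleK; exact: H.
    by move=> _; have := H i; rewrite fun_tupleK.
  have -> : y @^-1` box B = \bigcap_(i in [set: I]) (Y i @^-1` B i).
    apply/seteqP; split => w /= H i; last by rewrite fun_tupleK; exact: H.
    by move=> _; have := H i; rewrite fun_tupleK.
  by rewrite iX // iY //; apply: eq_bigr => i _; rewrite XY.
- by move=> _; apply: fin_num_fun_lty => ?; exact: fin_num_measure.
Qed.

Lemma measurable_comp_family d d' (T : measurableType d) (U : measurableType d')
    (F : (I -> R) -> U) (Z : T -> I -> R) :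
  measurable_family F -> (forall i, measurable_fun setT (Z ^~ i)) ->
  measurable_fun setT (fun w => F (Z w)).
Proof.
move=> mF mZ.
rewrite [X in measurable_fun _ X](_ : _ = (F \o tuple_fun) \o (fun w => fun_tuple (Z w))).
  by apply: measurableT_comp => //; exact: measurable_fun_tuple.
by apply/funext => w /=; rewrite fun_tupleK.
Qed.

End joint_law.

(** * Replacing part of an independent family by an independent copy *)

Section decoupling.
Context {R : realType} {I : finType}.

(** A box pulls back to a rectangle: slots in [S] constrain the first copy, the others the second,
    and [setT] fills the gaps. *)
Lemma mutually_independent_split d (T : measurableType d) (P : probability T R)
    (X : I -> T -> R) (S : pred I) :
  mutually_independent P X ->
  mutually_independent (P \x P)%E (fun i z => if S i then X i z.1 else X i z.2).
Proof.
move=> [mX iX]; split=> [i|B mB].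
  by case: (S i); apply: measurableT_comp.
pose B1 i := if S i then B i else setT; pose B2 i := if S i then setT else B i.
have mB1 i : measurable (B1 i) by rewrite /B1; case: ifP.
have mB2 i : measurable (B2 i) by rewrite /B2; case: ifP.
have mXB i C : measurable C -> measurable (X i @^-1` C).
  by move=> mC; rewrite -[_ @^-1` _]setTI; exact: mX.
have mI C : (forall i, measurable (C i)) ->
    measurable (\bigcap_(i in [set: I]) (X i @^-1` C i)).
  by move=> mC; apply: fin_bigcap_measurable => // i _; exact: mXB.
have -> : \bigcap_(i in [set: I])
      ((fun z => if S i then X i z.1 else X i z.2) @^-1` B i) =
    (\bigcap_(i in [set: I]) (X i @^-1` B1 i)) `*`
    (\bigcap_(i in [set: I]) (X i @^-1` B2 i)).
  apply/seteqP; split => -[w w'] /=.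
    by move=> H; split=> i _; have /= := H i Logic.I; rewrite /B1 /B2; case: (S i).
  by move=> [H1 H2] i _; have /= := H1 i Logic.I; have /= := H2 i Logic.I;
    rewrite /B1 /B2 /=; case: (S i).
have PP A C : measurable A -> measurable C -> (P \x P)%E (A `*` C) = (P A * P C)%E.
  by move=> mA mC; exact: product_measure1E.
rewrite [LHS](PP _ _ (mI _ mB1) (mI _ mB2)) !iX //.
rewrite -big_split /=; apply: eq_bigr => i _; rewrite /B1 /B2; case: (S i).
  rewrite preimage_setT probability_setT mule1.
  rewrite (_ : _ @^-1` _ = (X i @^-1` B i) `*` setT).
    by rewrite [RHS]PP ?probability_setT ?mule1 //; exact: mXB.
  by apply/seteqP; split => -[? ?] /= => [|[]].
rewrite preimage_setT probability_setT mul1e.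
rewrite (_ : _ @^-1` _ = setT `*` (X i @^-1` B i)).
  by rewrite [RHS]PP ?probability_setT ?mul1e //; exact: mXB.
by apply/seteqP; split => -[? ?] /= => [|[]].
Qed.

(** The mixed family on the product space has the joint law of [X], and Tonelli separates the two
    copies. This plays the part of conditioning: the coordinates in [S] are frozen outside while the
    others are averaged inside. *)
Lemma indep_decouple d (T : measurableType d) (P : probability T R)
    (X : I -> T -> R) (S : pred I) (F : (I -> R) -> \bar R) :
  mutually_independent P X ->
  measurable_family F -> (forall x, 0 <= F x)%E ->
  (\int[P]_w F (X ^~ w) =
   \int[P]_w \int[P]_w' F (fun i => if S i then X i w else X i w'))%E.
Proof.
move=> iX mF F0; have iXS := mutually_independent_split S iX.
rewrite (indep_integral_eq (F := F) iX iXS) //.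
  rewrite fubini_tonelli1 //; apply: measurable_comp_family => // i.
  exact: (iXS.1 i).
move=> i B mB; have mXB : measurable (X i @^-1` B).
  by rewrite -[_ @^-1` _]setTI; exact: iX.1.
case: (S i).
  apply: (@eq_trans _ _ ((P \x P)%E ((X i @^-1` B) `*` setT))).
    by rewrite product_measure1E // [X in (_ * X)%E]probability_setT mule1.
  by congr (_ _); apply/seteqP; split => -[? ?] /= => [[]|].
apply: (@eq_trans _ _ ((P \x P)%E (setT `*` (X i @^-1` B)))).
  by rewrite product_measure1E // [X in (X * _)%E]probability_setT mul1e.
by congr (_ _); apply/seteqP; split => -[? ?] /= => [[]|].
Qed.

(** Slots outside the image of [f] receive [setT] and contribute factors [1]; injectivity lets
    [pick] recover [j] from [f j]. *)
Lemma mutually_independent_inj (J : finType) d (T : measurableType d)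
    (P : probability T R) (X : I -> T -> R) (f : J -> I) :
  injective f -> mutually_independent P X ->
  mutually_independent P (fun j => X (f j)).
Proof.
move=> finj [mX iX]; split=> [j|B mB]; first exact: mX.
pose C i := if [pick j | f j == i] is Some j then B j else setT.
have Cf j : C (f j) = B j.
  rewrite /C; case: pickP => [j' /eqP /finj -> //|/(_ j)].
  by rewrite eqxx.
have mC i : measurable (C i) by rewrite /C; case: pickP.
have -> : \bigcap_(j in [set: J]) (X (f j) @^-1` B j) =
          \bigcap_(i in [set: I]) (X i @^-1` C i).
  apply/seteqP; split => w /= H i _; last by rewrite /= -Cf; exact: H.
  by rewrite /C; case: pickP => // j /eqP <-; exact: H.
rewrite iX // (bigID (mem (codom f))) /= [X in (_ * X)%E]big1 ?mule1; last first.
  move=> i fi; rewrite /C; case: pickP => [j /eqP fj|_].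
    by rewrite -fj codom_f in fi.
  by rewrite preimage_setT probability_setT.
rewrite -big_uniq /=; last by rewrite map_inj_uniq ?enum_uniq.
by rewrite big_image; apply: eq_bigr => j _; rewrite Cf.
Qed.

End decoupling.

(** * Gaussian integrals *)

Section gaussian.
Context {R : realType}.

(** The Radon-Nikodym derivative of the normal law agrees almost everywhere with [normal_pdf], both
    having the same integral over every measurable set. *)
Lemma ge0_integral_normal (m s : R) (f : R -> \bar R) : measurable_fun setT f ->
  (forall x, 0 <= f x)%E ->
  (\int[normal_prob m s]_x f x =
   \int[lebesgue_measure]_x (f x * (normal_pdf m s x)%:E))%E.
Proof.
move=> mf f0; have dom := normal_prob_dominates m s.
rewrite -(Radon_Nikodym_SigmaFinite.change_of_variables dom) //.
have mpdf : measurable_fun setT (fun x => (normal_pdf m s x)%:E).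
  by apply/measurable_EFinP; exact: measurable_normal_pdf.
have irn := Radon_Nikodym_SigmaFinite.f_integrable dom.
apply: ae_eq_integral => //.
- by apply: emeasurable_funM => //; exact: measurable_int irn.
- exact: emeasurable_funM.
apply: ae_eqe_mul2l; apply: integral_ae_eq => // E _ mE.
by rewrite -(Radon_Nikodym_SigmaFinite.f_integral dom).
Qed.

Local Notation std := (normal_prob 0 (Num.sqrt 2^-1 : R)).

(** Completing the square. The variance [1/2], for which real and imaginary parts add up to unit
    variance, makes the Gaussian exponent [- x^2]; the new mean is [- q / (1 + c)] and the new
    variance [1 / (2 (1 + c))]. *)
Lemma gauss_square (x c q : R) : 0 < 1 + c ->
  - (c * x ^+ 2 + 2 * q * x) + - (x - 0) ^+ 2 / (2^-1 *+ 2) =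
  q ^+ 2 / (1 + c) + - (x - - q / (1 + c)) ^+ 2 / ((1 + c)^-1 / 2 *+ 2).
Proof.
move=> c0; have c0' : 1 + c != 0 by rewrite gt_eqF.
rewrite -[2^-1 *+ 2]mulr_natr -[_ / 2 *+ 2]mulr_natr; field.
by rewrite c0'.
Qed.

Lemma integral_std_expR (c q : R) : -1 < c ->
  (\int[std]_y (expR (- (c * y ^+ 2 + 2 * q * y)))%:E =
   ((Num.sqrt (1 + c))^-1 * expR (q ^+ 2 / (1 + c)))%:E)%E.
Proof.
move=> c1; have c0 : 0 < 1 + c by lra.
rewrite ge0_integral_normal; last 2 first.
- apply/measurable_EFinP; apply: measurableT_comp => //.
  apply: measurable_funN; apply: measurable_funD; apply: measurable_funM => //.
- by move=> x; rewrite lee_fin expR_ge0.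
pose s := Num.sqrt ((2 * (1 + c))^-1); pose m := - q / (1 + c).
have s2 : s ^+ 2 = (2 * (1 + c))^-1.
  by rewrite sqr_sqrtr // invr_ge0; lra.
have t2 : (Num.sqrt 2^-1 : R) ^+ 2 = 2^-1 by rewrite sqr_sqrtr.
have s0 : s != 0 by rewrite sqrtr_eq0 -ltNge invr_gt0; lra.
have t0 : (Num.sqrt 2^-1 : R) != 0 by rewrite sqrtr_eq0 -ltNge invr_gt0.
under eq_integral => x _.
  rewrite (_ : _ * _ = ((Num.sqrt (1 + c))^-1 * expR (q ^+ 2 / (1 + c)))%:E *
    (normal_pdf m s x)%:E)%E; last first.
    rewrite -!EFinM !normal_pdfE //; congr EFin.
    rewrite /normal_peak /normal_fun t2 s2.
    have -> : (2 * (1 + c))^-1 * pi *+ 2 = (1 + c)^-1 * (pi : R).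
      by rewrite -mulr_natr; field; lra.
    have -> : (2^-1 : R) * pi *+ 2 = pi by rewrite -mulr_natr; field.
    rewrite sqrtrM; last by rewrite invr_ge0; lra.
    rewrite sqrtrV ?invrM ?invrK ?unitfE ?invr_eq0 ?sqrtr_eq0 -?ltNge ?pi_gt0 //; last by lra.
      have sp0 : Num.sqrt pi != 0 :> R by rewrite sqrtr_eq0 -ltNge pi_gt0.
      have sc0 : Num.sqrt (1 + c) != 0 :> R by rewrite sqrtr_eq0 -ltNge.
      rewrite mulrCA -expRD (gauss_square x q c0) expRD -/m.
      move: (expR (q ^+ 2 / _)) (expR (- (x - m) ^+ 2 / _)) => E1 E2.
      move: (Num.sqrt pi) sp0 (Num.sqrt (1 + c)) sc0 => p p0 r r0.
      by field; rewrite p0.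
    by lra.
  over.
rewrite ge0_integralZl //.
- by rewrite integral_normal_pdf mule1.
- by apply/measurable_EFinP; exact: measurable_normal_pdf.
- by move=> x _; rewrite lee_fin normal_pdf_ge0.
Qed.

Definition gaussian_family (I : finType) d (T : measurableType d)
    (P : probability T R) (X : I -> T -> R) : Prop :=
  mutually_independent P X /\
  forall i B, measurable B -> P (X i @^-1` B) = std B.

Lemma gaussian_family_inj (I J : finType) d (T : measurableType d)
    (P : probability T R) (X : I -> T -> R) (f : J -> I) :
  injective f -> gaussian_family P X -> gaussian_family P (fun j => X (f j)).
Proof.
by move=> finj [iX XN]; split; [exact: mutually_independent_inj|move=> i; exact: XN].
Qed.

Lemma integral_law d (T : measurableType d) (P : probability T R) (X : T -> R)
    (nu : {measure set (measurableTypeR R) -> \bar R}) (g : R -> \bar R) :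
  measurable_fun setT X -> (forall B, measurable B -> P (X @^-1` B) = nu B) ->
  measurable_fun setT g -> (forall x, 0 <= g x)%E ->
  (\int[P]_w g (X w) = \int[nu]_x g x)%E.
Proof.
move=> mX Xnu mg g0.
have mX' : measurable_fun setT (X : T -> measurableTypeR R).
  by move=> mT Y mY; exact: mX.
pose Xm := HB.pack_for {mfun T >-> measurableTypeR R} (X : T -> measurableTypeR R)
  (isMeasurableFun.Build _ _ _ _ _ mX').
rewrite [RHS](@eq_measure_integral _ _ _ _ (distribution P Xm)); last first.
  by move=> A mA _; rewrite -Xnu.
by rewrite ge0_integral_distribution.
Qed.

(** Decoupling the single coordinate [i0] leaves it alone in the inner integral, where its law can
    be inserted. *)
Lemma gaussian_elim (I : finType) d (T : measurableType d) (P : probability T R)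
    (X : I -> T -> R) (i0 : I) (F : (I -> R) -> \bar R) :
  gaussian_family P X -> measurable_family F -> (forall x, 0 <= F x)%E ->
  (\int[P]_w F (X ^~ w) =
   \int[P]_w \int[std]_y F (fun i => if i == i0 then y else X i w))%E.
Proof.
move=> [iX XN] mF F0; rewrite (indep_decouple (predC1 i0) iX mF F0).
apply: eq_integral => w _.
pose g y := F (fun i => if i == i0 then y else X i w).
rewrite -[RHS](@integral_law _ _ P (X i0) std g).
- by apply: eq_integral => w' _; congr F; apply/funext => i /=; case: eqP => [->|].
- exact: iX.1.
- by move=> B mB; exact: XN.
- apply: measurable_comp_family => // i; case: (i == i0) => //.
- by move=> x; exact: F0.
Qed.

End gaussian.

(** * Positive definite Hermitian matrices *)

Section hermitian.
Context {R : realType}.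
Local Notation C := R[i].

Definition adjmx m n (A : 'M[C]_(m, n)) : 'M[C]_(n, m) := (map_mx (@conjc R) A)^T.

Lemma adjmxM m n p (A : 'M[C]_(m, n)) (B : 'M[C]_(n, p)) :
  adjmx (A *m B) = adjmx B *m adjmx A.
Proof. by rewrite /adjmx map_mxM trmx_mul. Qed.

Lemma adjmxD m n (A B : 'M[C]_(m, n)) : adjmx (A + B) = adjmx A + adjmx B.
Proof. by rewrite /adjmx map_mxD linearD. Qed.

Lemma adjmxB m n (A B : 'M[C]_(m, n)) : adjmx (A - B) = adjmx A - adjmx B.
Proof. by rewrite /adjmx map_mxB linearB. Qed.

Lemma adjmxZ m n a (A : 'M[C]_(m, n)) : adjmx (a *: A) = conjc a *: adjmx A.
Proof. by rewrite /adjmx map_mxZ linearZ. Qed.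

Lemma adjmxK m n (A : 'M[C]_(m, n)) : adjmx (adjmx A) = A.
Proof. by apply/matrixP => i j; rewrite !mxE conjcK. Qed.

Lemma adjmx_scalar n a : adjmx (a%:M : 'M[C]_n) = (conjc a)%:M.
Proof. by rewrite /adjmx map_scalar_mx tr_scalar_mx. Qed.

Lemma adjmx_col m1 m2 n (A : 'M[C]_(m1, n)) (B : 'M[C]_(m2, n)) :
  adjmx (col_mx A B) = row_mx (adjmx A) (adjmx B).
Proof. by rewrite /adjmx map_col_mx tr_col_mx. Qed.

Lemma adjmx_adjugate n (A : 'M[C]_n) : adjmx (\adj A) = \adj (adjmx A).
Proof. by rewrite /adjmx map_mx_adj trmx_adj. Qed.

Definition qf n (Q : 'M[C]_n) (x : 'cV[C]_n) : C := (adjmx x *m Q *m x) 0 0.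

Lemma qfD n (A B : 'M[C]_n) x : qf (A + B) x = qf A x + qf B x.
Proof. by rewrite /qf mulmxDr mulmxDl mxE. Qed.

Lemma qfB n (A B : 'M[C]_n) x : qf (A - B) x = qf A x - qf B x.
Proof. by rewrite /qf mulmxBr mulmxBl mxE [X in _ + X]mxE. Qed.

Lemma qfZ n a (A : 'M[C]_n) x : qf (a *: A) x = a * qf A x.
Proof. by rewrite /qf -scalemxAr -scalemxAl mxE. Qed.

Lemma qf_sum n (J : Type) (r : seq J) (A : J -> 'M[C]_n) x :
  qf (\sum_(j <- r) A j) x = \sum_(j <- r) qf (A j) x.
Proof.
elim: r => [|j r IH]; last by rewrite !big_cons qfD IH.
by rewrite !big_nil /qf mulmx0 mul0mx mxE.
Qed.

Lemma qf1 n (x : 'cV[C]_n) : qf 1%:M x = \sum_i `|x i 0| ^+ 2.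
Proof.
rewrite /qf mulmx1 mxE; apply: eq_bigr => i _.
by rewrite !mxE mulrC -sqr_normc.
Qed.

Lemma qf1_ge0 n (x : 'cV[C]_n) : 0 <= qf 1%:M x.
Proof. by rewrite qf1 sumr_ge0 // => i _; rewrite exprn_ge0. Qed.

Lemma qf1_gt0 n (x : 'cV[C]_n) : x != 0 -> 0 < qf 1%:M x.
Proof.
move=> x0; rewrite lt_neqAle qf1_ge0 andbT; apply: contra x0 => /eqP/esym/eqP.
rewrite qf1 psumr_eq0 => [/allP x0|i _]; last by rewrite exprn_ge0.
apply/eqP/matrixP => i j; rewrite (ord1 j) mxE; apply/eqP.
by have := x0 i; rewrite mem_index_enum expf_eq0 /= normr_eq0; apply.
Qed.

Lemma qf_rank1 n (v x : 'cV[C]_n) : qf (v *m adjmx v) x = `|(adjmx v *m x) 0 0| ^+ 2.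
Proof.
have e : adjmx x *m v = adjmx (adjmx v *m x) by rewrite adjmxM adjmxK.
rewrite /qf mulmxA -mulmxA e mxE big_ord1 sqr_normc mulrC; congr (_ * _).
by rewrite !mxE.
Qed.

Definition pos_def n (Q : 'M[C]_n) : Prop :=
  adjmx Q = Q /\ forall x, x != 0 -> 0 < qf Q x.

Lemma pos_def1D_sum n (J : Type) (r : seq J) (phi : J -> R) (v : J -> 'cV[C]_n) :
  (forall j, 0 <= phi j) ->
  pos_def (1%:M + \sum_(j <- r) (phi j)%:C%C *: (v j *m adjmx (v j))).
Proof.
move=> phi0; split.
  rewrite adjmxD adjmx_scalar conjc1; congr (_ + _).
  rewrite (big_morph (@adjmx n n) (@adjmxD n n) (_ : adjmx 0 = 0)); last first.
    by rewrite /adjmx map_mx0 trmx0.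
  by apply: eq_bigr => j _; rewrite adjmxZ adjmxM adjmxK conjc_real.
move=> x x0; rewrite qfD qf_sum; apply: ltr_wpDr; last exact: qf1_gt0.
by apply: sumr_ge0 => j _; rewrite qfZ qf_rank1 mulr_ge0 ?ler0c ?exprn_ge0.
Qed.

Section block.
Variables (n : nat) (Q : 'M[C]_(1 + n)).
Hypothesis hQ : adjmx Q = Q.

Let q := Q 0 0.
Let r := ursubmx Q.
Let Q' := drsubmx Q.

Lemma hermitian_block : Q = block_mx q%:M r (adjmx r) Q'.
Proof.
rewrite -[LHS]submxK; congr block_mx.
  by rewrite [ulsubmx Q]mx11_scalar !mxE lshift0.
apply/matrixP => i j; have /matrixP/(_ (rshift 1 i) (lshift n j)) := hQ.
by rewrite /r !mxE => ->.
Qed.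

Lemma hermitian_drsub : adjmx Q' = Q'.
Proof.
apply/matrixP => i j; have /matrixP/(_ (rshift 1 i) (rshift 1 j)) := hQ.
by rewrite /Q' !mxE.
Qed.

Lemma hermitian_diag : conjc q = q.
Proof. by have /matrixP/(_ 0 0) := hQ; rewrite !mxE. Qed.

Lemma qf_col (z0 : C) (z : 'cV[C]_n) :
  qf Q (col_mx z0%:M z) = q * (conjc z0 * z0) + conjc z0 * (r *m z) 0 0 +
    conjc ((r *m z) 0 0) * z0 + qf Q' z.
Proof.
rewrite /qf {1}hermitian_block adjmx_col adjmx_scalar.
rewrite mul_row_block mul_row_col -!scalar_mxM mulmxDl mulmxDl.
rewrite -(mulmxA (conjc z0)%:M) -scalar_mxM.
have -> : adjmx z *m adjmx r *m z0%:M = adjmx (r *m z) *m z0%:M by rewrite adjmxM.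
rewrite !mul_mx_scalar mul_scalar_mx !mxE /=.
ring.
Qed.

(** The Schur complement of the corner entry: what remains of [Q] once the first coordinate is
    eliminated, in the determinant as well as in a Gaussian integral. *)
Definition schur : 'M[C]_n := Q' - q^-1 *: (adjmx r *m r).

Lemma det_schur : q != 0 -> \det Q = q * \det schur.
Proof.
move=> q0; have -> : Q = block_mx 1%:M 0 (q^-1 *: adjmx r) 1%:M *m
    block_mx q%:M r 0 schur.
  rewrite [LHS]hermitian_block mulmx_block !mul1mx !mul0mx !addr0.
  rewrite mul_mx_scalar scalerA mulfV // scale1r; congr block_mx.
  by rewrite -scalemxAl addrC subrK.
by rewrite det_mulmx (@det_lblock _ 1 n) (@det_ublock _ 1 n) !det1 !mul1r det_scalar1.
Qed.

Lemma qf_schur (z : 'cV[C]_n) :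
  qf schur z = qf Q' z - q^-1 * (conjc ((r *m z) 0 0) * (r *m z) 0 0).
Proof.
rewrite /schur qfB qfZ; congr (_ - _ * _).
by rewrite -{2}[r]adjmxK qf_rank1 adjmxK sqr_normc mulrC.
Qed.

(** For fixed [z], the first coordinate [- q^-1 (r z)] minimises [qf Q], and the minimal value is
    [qf schur z]; positivity therefore passes to the complement. *)
Lemma pos_def_schur : pos_def Q -> 0 < q /\ pos_def schur.
Proof.
move=> [_ pQ]; have q0 : 0 < q.
  have := pQ (col_mx 1%:M 0); rewrite qf_col mulmx0 !mxE conjc0 conjc1.
  rewrite mul0r mulr0 !addr0 mulr1 mulr1 /qf mulmx0 mxE addr0; apply.
  apply/eqP => /matrixP /(_ (lshift n 0) 0); rewrite col_mxEu !mxE => /eqP.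
  by rewrite oner_eq0.
split => //; split.
  rewrite /schur adjmxB hermitian_drsub adjmxZ adjmxM adjmxK.
  by rewrite conjc_inv hermitian_diag.
move=> z z0; have qn0 : q != 0 by rewrite gt_eqF.
have := pQ (col_mx (- (q^-1 * (r *m z) 0 0))%:M z).
have -> : qf Q (col_mx (- (q^-1 * (r *m z) 0 0))%:M z) = qf schur z.
  rewrite qf_col qf_schur rmorphN rmorphM /= conjc_inv hermitian_diag.
  by field.
apply; apply: contra z0 => /eqP e; apply/eqP/matrixP => i j.
by have /matrixP /(_ (rshift 1 i) j) := e; rewrite col_mxEd !mxE.
Qed.

End block.

Lemma pos_def_det n (Q : 'M[C]_n) : pos_def Q -> 0 < \det Q.
Proof.
elim: n Q => [|n IH] Q pQ; first by rewrite det_mx00.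
have [q0 pS] := pos_def_schur pQ.1 pQ.
by rewrite (det_schur pQ.1) ?gt_eqF // mulr_gt0 // IH.
Qed.

(** The bordered matrix with blocks [1], [- w], [u], [1] has two block triangular factorizations,
    one for each corner eliminated; their determinants are the two sides. *)
Lemma det_1D_rank1 n (u : 'cV[C]_n) (w : 'rV[C]_n) :
  \det (1%:M + u *m w) = 1 + (w *m u) 0 0.
Proof.
have e1 : block_mx 1%:M (- w) u 1%:M =
    block_mx 1%:M 0 u 1%:M *m block_mx 1%:M (- w) 0 (1%:M + u *m w) :> 'M[C]_(1 + n).
  rewrite mulmx_block !mul1mx !mul0mx !mulmx1 ?addr0; congr block_mx.
  by rewrite mulmxN addrC addrK.
have e2 : block_mx 1%:M (- w) u 1%:M =
    block_mx (1%:M + w *m u) (- w) 0 1%:M *m block_mx 1%:M 0 u 1%:M :> 'M[C]_(1 + n).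
  rewrite mulmx_block ?mul1mx !mul0mx !mulmx0 !mulmx1 !add0r; congr block_mx.
  by rewrite mulNmx addrK.
have := congr1 determinant e2; rewrite {1}e1 !det_mulmx !det_lblock !det_ublock.
by rewrite !det1 !mul1r !mulr1 det_mx11 !mxE /= => ->.
Qed.

(** With the adjugate in place of the inverse, the increment is a quadratic form in [v] whose trace
    is a sum of principal minors of [A], apart from the factor [a]. *)
Lemma det_D_rank1 n (A : 'M[C]_n) (a : C) (v : 'cV[C]_n) : \det A != 0 ->
  \det (A + a *: (v *m adjmx v)) = \det A + a * qf (\adj A) v.
Proof.
move=> dA; have uA : A \in unitmx by rewrite unitmxE unitfE.
have -> : A + a *: (v *m adjmx v) = A *m (1%:M + (a *: (invmx A *m v)) *m adjmx v).
  by rewrite mulmxDr mulmx1 -scalemxAl -scalemxAr -mulmxA mulKVmx.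
rewrite det_mulmx det_1D_rank1 mulrDr mulr1; congr (_ + _).
rewrite -scalemxAr mxE /invmx uA -scalemxAl -scalemxAr mxE /qf mulmxA.
by rewrite mulrCA mulVKf.
Qed.

Lemma trace_adjugate n (A : 'M[C]_n.+1) :
  \tr (\adj A) = \sum_(i < n.+1) \det (row' i (col' i A)).
Proof.
rewrite /mxtrace; apply: eq_bigr => i _.
by rewrite mxE /cofactor -signr_odd oddD addbb expr0 mul1r.
Qed.

End hermitian.

(** * Measurability of complex matrix expressions *)

Section complex_measurable.
Context {R : realType} {d : measure_display} {T : measurableType d}.
Local Notation C := R[i].

Definition cmeasurable (f : T -> C) : Prop :=
  measurable_fun setT (fun w => complex.Re (f w)) /\
  measurable_fun setT (fun w => complex.Im (f w)).

Lemma cmeasurable_cst c : cmeasurable (fun=> c).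
Proof. by split; exact: measurable_cst. Qed.

Lemma cmeasurableD f g : cmeasurable f -> cmeasurable g ->
  cmeasurable (fun w => f w + g w).
Proof.
move=> [mf1 mf2] [mg1 mg2]; split.
  rewrite (_ : (fun w => _) = fun w => complex.Re (f w) + complex.Re (g w)).
    exact: measurable_funD.
  by apply/funext => w; case: (f w) => ? ?; case: (g w).
rewrite (_ : (fun w => _) = fun w => complex.Im (f w) + complex.Im (g w)).
  exact: measurable_funD.
by apply/funext => w; case: (f w) => ? ?; case: (g w).
Qed.

Lemma cmeasurableM f g : cmeasurable f -> cmeasurable g ->
  cmeasurable (fun w => f w * g w).
Proof.
move=> [mf1 mf2] [mg1 mg2]; split.
  rewrite (_ : (fun w => _) = fun w => complex.Re (f w) * complex.Re (g w) -
      complex.Im (f w) * complex.Im (g w)).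
    by apply: measurable_funB; exact: measurable_funM.
  by apply/funext => w; case: (f w) => ? ?; case: (g w).
rewrite (_ : (fun w => _) = fun w => complex.Re (f w) * complex.Im (g w) +
    complex.Im (f w) * complex.Re (g w)).
  by apply: measurable_funD; exact: measurable_funM.
by apply/funext => w; case: (f w) => ? ?; case: (g w).
Qed.

Lemma cmeasurable_conj f : cmeasurable f -> cmeasurable (fun w => conjc (f w)).
Proof.
move=> [mf1 mf2]; split.
  rewrite (_ : (fun w => _) = fun w => complex.Re (f w)) //.
  by apply/funext => w; case: (f w).
rewrite (_ : (fun w => _) = fun w => - complex.Im (f w)).
  exact: measurable_funN.
by apply/funext => w; case: (f w).
Qed.

Lemma cmeasurable_real (f : T -> R) : measurable_fun setT f ->
  cmeasurable (fun w => (f w)%:C%C).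
Proof. by move=> mf; split. Qed.

Lemma cmeasurable_sum (J : Type) (r : seq J) (f : J -> T -> C) :
  (forall j, cmeasurable (f j)) -> cmeasurable (fun w => \sum_(j <- r) f j w).
Proof.
move=> mf; elim: r => [|j r IH].
  under eq_fun do rewrite big_nil; exact: cmeasurable_cst.
under eq_fun do rewrite big_cons; exact: cmeasurableD.
Qed.

Lemma cmeasurable_prod (J : Type) (r : seq J) (f : J -> T -> C) :
  (forall j, cmeasurable (f j)) -> cmeasurable (fun w => \prod_(j <- r) f j w).
Proof.
move=> mf; elim: r => [|j r IH].
  under eq_fun do rewrite big_nil; exact: cmeasurable_cst.
under eq_fun do rewrite big_cons; exact: cmeasurableM.
Qed.

Definition mxmeasurable m n (A : T -> 'M[C]_(m, n)) : Prop :=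
  forall i j, cmeasurable (fun w => A w i j).

Lemma mxmeasurable_cst m n (A : 'M[C]_(m, n)) : mxmeasurable (fun=> A).
Proof. by move=> i j; exact: cmeasurable_cst. Qed.

Lemma mxmeasurableD m n (A B : T -> 'M[C]_(m, n)) :
  mxmeasurable A -> mxmeasurable B -> mxmeasurable (fun w => A w + B w).
Proof.
by move=> mA mB i j; under eq_fun do rewrite mxE; exact: cmeasurableD.
Qed.

Lemma mxmeasurableM m n p (A : T -> 'M[C]_(m, n)) (B : T -> 'M[C]_(n, p)) :
  mxmeasurable A -> mxmeasurable B -> mxmeasurable (fun w => A w *m B w).
Proof.
move=> mA mB i j; under eq_fun do rewrite mxE.
by apply: cmeasurable_sum => k; exact: cmeasurableM.
Qed.

Lemma mxmeasurableZ m n (f : T -> C) (A : T -> 'M[C]_(m, n)) :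
  cmeasurable f -> mxmeasurable A -> mxmeasurable (fun w => f w *: A w).
Proof.
by move=> mf mA i j; under eq_fun do rewrite mxE; exact: cmeasurableM.
Qed.

Lemma mxmeasurable_sum m n (J : Type) (r : seq J) (A : J -> T -> 'M[C]_(m, n)) :
  (forall j, mxmeasurable (A j)) -> mxmeasurable (fun w => \sum_(j <- r) A j w).
Proof.
move=> mA i j; under eq_fun do rewrite summxE.
by apply: cmeasurable_sum => k; exact: mA.
Qed.

Lemma mxmeasurable_adj m n (A : T -> 'M[C]_(m, n)) :
  mxmeasurable A -> mxmeasurable (fun w => adjmx (A w)).
Proof.
by move=> mA i j; under eq_fun do rewrite !mxE; exact: cmeasurable_conj.
Qed.

Lemma cmeasurable_det n (A : T -> 'M[C]_n) :
  mxmeasurable A -> cmeasurable (fun w => \det (A w)).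
Proof.
move=> mA; apply: cmeasurable_sum => s; apply: cmeasurableM.
  exact: cmeasurable_cst.
by apply: cmeasurable_prod => i; exact: mA.
Qed.

Lemma cmeasurable_qf n (Q : T -> 'M[C]_n) (x : T -> 'cV[C]_n) :
  mxmeasurable Q -> mxmeasurable x -> cmeasurable (fun w => qf (Q w) (x w)).
Proof.
move=> mQ mx; apply: (mxmeasurableM (mxmeasurableM (mxmeasurable_adj mx) mQ) mx).
Qed.

End complex_measurable.

(** * Gaussian vectors in complex coordinates *)

Section gaussian_vectors.
Context {R : realType}.
Local Notation C := R[i].
Local Notation std := (normal_prob 0 (Num.sqrt 2^-1 : R)).

Definition cvec n (u : 'I_n * bool -> R) : 'cV[C]_n :=
  \col_i (u (i, false) +i* u (i, true))%C.

Lemma mxmeasurable_cvec n d (T : measurableType d) (Z : T -> 'I_n * bool -> R) :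
  (forall i, measurable_fun setT (Z ^~ i)) -> mxmeasurable (fun w => cvec (Z w)).
Proof.
by move=> mZ i j; under eq_fun do rewrite mxE; split => /=; exact: mZ.
Qed.

(** Inductions on the dimension remove a whole complex coordinate, that is, both of its real
    components at once. *)
Definition behead_family n (i : 'I_n * bool) : 'I_(1 + n) * bool :=
  (rshift 1 i.1, i.2).

Lemma behead_family_inj n : injective (@behead_family n).
Proof.
move=> [i b] [j c] e; congr pair; last exact: (congr1 snd e).
by apply: (@rshift_inj 1 n); exact: (congr1 fst e).
Qed.

Definition head_index n (b : bool) : 'I_(1 + n) * bool := (0, b).

Lemma cvec_col n (u : 'I_(1 + n) * bool -> R) :
  cvec u = col_mx ((u (head_index n false) +i* u (head_index n true))%C)%:M
                  (cvec (fun i => u (behead_family i))).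
Proof.
rewrite -[LHS]vsubmxK; congr col_mx.
  by rewrite [LHS]mx11_scalar !mxE lshift0.
by apply/matrixP => i j; rewrite !mxE.
Qed.

Lemma Re_qf_cvec n (Q : 'M[C]_(1 + n)) (u : 'I_(1 + n) * bool -> R) :
  adjmx Q = Q ->
  let z := cvec (fun i => u (behead_family i)) in
  let p := (ursubmx Q *m z) 0 0 in
  complex.Re (qf Q (cvec u)) =
    complex.Re (Q 0 0) * (u (head_index n false) ^+ 2 + u (head_index n true) ^+ 2) +
    2 * (u (head_index n false) * complex.Re p + u (head_index n true) * complex.Im p) +
    complex.Re (qf (drsubmx Q) z).
Proof.
move=> hQ z p; rewrite cvec_col qf_col // -/z -/p.
have /= := hermitian_diag hQ; case: (Q 0 0) => a b /= [] b0.
have -> : b = 0 by lra.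
case: p => p1 p2; case: (qf _ z) => c1 c2 /=.
ring.
Qed.

Lemma gaussian_elim_head n d (T : measurableType d) (P : probability T R)
    (X : 'I_(1 + n) * bool -> T -> R) (F : R -> R -> ('I_n * bool -> R) -> \bar R) :
  gaussian_family P X ->
  measurable_family (fun u : 'I_(1 + n) * bool -> R =>
    F (u (head_index n false)) (u (head_index n true)) (fun i => u (behead_family i))) ->
  (forall x y u, 0 <= F x y u)%E ->
  (\int[P]_w F (X (head_index n false) w) (X (head_index n true) w) (fun i => X (behead_family i) w) =
   \int[P]_w \int[std]_x \int[std]_y F x y (fun i => X (behead_family i) w))%E.
Proof.
move=> GX mF F0; have [iX _] := GX.
pose G (u : 'I_(1 + n) * bool -> R) :=
  F (u (head_index n false)) (u (head_index n true)) (fun i => u (behead_family i)).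
pose G1 (u : 'I_(1 + n) * bool -> R) :=
  (\int[std]_y F (u (head_index n false)) y (fun i => u (behead_family i)))%E.
transitivity (\int[P]_w G1 (X ^~ w))%E.
  rewrite (@gaussian_elim _ _ _ _ P X (head_index n true) G) //.
  by move=> u; exact: F0.
rewrite (@gaussian_elim _ _ _ _ P X (head_index n false) G1) //.
- pose H (z : #|{: 'I_(1 + n) * bool}|.-tuple R * measurableTypeR R) : \bar R :=
    F (tuple_fun z.1 (head_index n false)) z.2 (fun i => tuple_fun z.1 (behead_family i)).
  apply: (@measurable_fun_fubini_tonelli_F _ _ _ _ _ std H) => //.
  rewrite (_ : H = fun z => G (fun i => if i == head_index n true then z.2 else tuple_fun z.1 i)).
    apply: measurable_comp_family => // i; case: (i == _).
      exact: measurable_snd.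
    by apply: (measurableT_comp (measurable_tuple_fun i)).
  by apply/funext => z.
  by move=> z; exact: F0.
- by move=> u; apply: integral_ge0 => y _; exact: F0.
Qed.

End gaussian_vectors.

(** * Gaussian integral of the exponential of a Hermitian form *)

Section gaussian_quadratic.
Context {R : realType}.
Local Notation C := R[i].
Local Notation std := (normal_prob 0 (Num.sqrt 2^-1 : R)).

Lemma measurable_Re_qf_cvec n (Q : 'M[C]_n) d (T : measurableType d)
    (Z : T -> 'I_n * bool -> R) :
  (forall i, measurable_fun setT (Z ^~ i)) ->
  measurable_fun setT (fun w => complex.Re (qf Q (cvec (Z w)))).
Proof.
move=> mZ; apply: (cmeasurable_qf (mxmeasurable_cst Q) _).1.
exact: mxmeasurable_cvec.
Qed.

Lemma Re_mul_conj (z : C) : complex.Re (conjc z * z) = complex.Re z ^+ 2 + complex.Im z ^+ 2.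
Proof. by case: z => a b /=; ring. Qed.

(** Integrating out the first coordinate yields the factor [1 / Q 0 0] and leaves the form of the
    Schur complement, so the pivots of [Q] multiply up to its determinant. The [- 1%:M] compensates
    for the exponent of the density. *)
Lemma gaussian_integral_exp_qf n (Q : 'M[C]_n) d (T : measurableType d)
    (P : probability T R) (X : 'I_n * bool -> T -> R) :
  gaussian_family P X -> pos_def Q ->
  (\int[P]_w (expR (- complex.Re (qf (Q - 1%:M) (cvec (X ^~ w)))))%:E =
   ((complex.Re (\det Q))^-1)%:E)%E.
Proof.
elim: n Q X => [|n IH]; last rewrite -[n.+1]/(1 + n)%N; move=> Q X GX pQ.
  under eq_integral => w _.
    by rewrite /qf mxE big_ord0 oppr0 expR0; over.
  rewrite det_mx00 /= invr1 integral_cst // mul1e; exact: probability_setT.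
have hQ := pQ.1; have [q0 pS] := pos_def_schur hQ pQ.
pose a := complex.Re (Q 0 0); pose A : 'M[C]_(1 + n) := Q - 1%:M.
have hA : adjmx A = A by rewrite adjmxB hQ adjmx_scalar conjc1.
have qa : Q 0 0 = a%:C%C by rewrite /a RRe_real // gtr0_real.
have a0 : 0 < a by move: q0; rewrite qa -[0]/(0%:C%C) ltcR.
have rA : ursubmx A = ursubmx Q.
  by apply/matrixP => i j; rewrite !mxE eq_lrshift subr0.
have dA : drsubmx A = drsubmx Q - 1%:M.
  by apply/matrixP => i j; rewrite !mxE (inj_eq (@rshift_inj 1 n)).
have A00 : A 0 0 = (a - 1)%:C%C by rewrite !mxE eqxx qa rmorphB.
pose p (u : 'I_n * bool -> R) := (ursubmx Q *m cvec u) 0 0.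
pose h (u : 'I_n * bool -> R) := complex.Re (qf (drsubmx A) (cvec u)).
pose F (x y : R) (u : 'I_n * bool -> R) : \bar R :=
  (expR (- ((a - 1) * (x ^+ 2 + y ^+ 2) +
            2 * (x * complex.Re (p u) + y * complex.Im (p u)) + h u)))%:E.
have FE (u : 'I_(1 + n) * bool -> R) :
    (expR (- complex.Re (qf A (cvec u))))%:E =
    F (u (head_index n false)) (u (head_index n true)) (fun i => u (behead_family i)).
  by rewrite (Re_qf_cvec u hA) A00 rA.
under eq_integral => w _ do rewrite FE.
have mF : measurable_family (fun u : 'I_(1 + n) * bool -> R =>
    F (u (head_index n false)) (u (head_index n true)) (fun i => u (behead_family i))).
  rewrite [X in measurable_family X](_ : _ =
    (fun u => (expR (- complex.Re (qf A (cvec u))))%:E)); last first.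
    by apply/funext => u; rewrite FE.
  apply/measurable_EFinP; apply: measurableT_comp => //; apply: measurable_funN.
  by apply: measurable_Re_qf_cvec => i; exact: measurable_tuple_fun.
have F0 x y u : (0 <= F x y u)%E by rewrite lee_fin expR_ge0.
rewrite (gaussian_elim_head GX mF F0).
have sa : Num.sqrt a != 0 by rewrite sqrtr_eq0 -ltNge.
have FI (u : 'I_n * bool -> R) : (\int[std]_x \int[std]_y F x y u =
    (a^-1)%:E * (expR (- complex.Re (qf (schur Q - 1%:M) (cvec u))))%:E)%E.
  (* The integral over [y] gives one factor [(sqrt a)^-1]; the integral over [x] gives the
     second. *)
  transitivity (\int[std]_x (((Num.sqrt a)^-1 *
     expR (complex.Im (p u) ^+ 2 / a - h u))%:E *
     (expR (- ((a - 1) * x ^+ 2 + 2 * complex.Re (p u) * x)))%:E))%E.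
    apply: eq_integral => x _.
    transitivity (\int[std]_y ((expR (- ((a - 1) * x ^+ 2 + 2 * complex.Re (p u) * x) - h u))%:E *
      (expR (- ((a - 1) * y ^+ 2 + 2 * complex.Im (p u) * y)))%:E))%E.
      apply: eq_integral => y _; rewrite /F -EFinM -expRD; congr (expR _)%:E; ring.
    rewrite ge0_integralZl //.
    - rewrite integral_std_expR; last by lra.
      rewrite subrKC -!EFinM; congr EFin; rewrite [LHS]mulrCA -[RHS]mulrA -!expRD.
      congr (_ * expR _); ring.
    - apply/measurable_EFinP; apply: measurableT_comp => //.
      apply: measurable_funN; apply: measurable_funD; exact: measurable_funM.
  rewrite ge0_integralZl //.
  - rewrite integral_std_expR; last by lra.
    rewrite subrKC -!EFinM; congr EFin; rewrite mulrACA -expRD; congr (_ * expR _).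
      by rewrite -invrM ?unitfE // -expr2 sqr_sqrtr // ltW.
    rewrite qfB qf_schur // qa -fmorphV.
    have ReB3 (b : R) (z1 z2 z3 : C) : complex.Re (z1 - b%:C%C * z2 - z3) =
        complex.Re z1 - b * complex.Re z2 - complex.Re z3.
      by case: z1 => ? ?; case: z2 => ? ?; case: z3 => ? ? /=; ring.
    have ReB (z1 z2 : C) : complex.Re (z1 - z2) = complex.Re z1 - complex.Re z2.
      by case: z1 => ? ?; case: z2 => ? ?.
    rewrite ReB3 Re_mul_conj -/(p u) /h dA qfB ReB.
    ring.
  - apply/measurable_EFinP; apply: measurableT_comp => //.
    apply: measurable_funN; apply: measurable_funD; exact: measurable_funM.
under eq_integral => w _ do rewrite FI.
have GX' := gaussian_family_inj (@behead_family_inj n) GX.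
rewrite ge0_integralZl //.
- rewrite (IH (schur Q) _ GX' pS) -EFinM; congr EFin.
  rewrite (det_schur hQ) ?gt_eqF // qa.
  by case: (\det _) => b c /=; rewrite mul0r subr0 invfM.
- apply/measurable_EFinP; apply: measurableT_comp => //; apply: measurable_funN.
  by apply: measurable_Re_qf_cvec => i; exact: GX'.1.1.
- by rewrite lee_fin invr_ge0 ltW.
Qed.

End gaussian_quadratic.

(** The integral of a nonnegative function is a supremum over the simple functions below it, so the
    comparison asks for no measurability. This matters when the integrands are themselves
    integrals. *)
Lemma le_integral_ge0 d (T : measurableType d) (R : realType)
    (mu : {measure set T -> \bar R}) (f g : T -> \bar R) :
  (forall x, 0 <= f x)%E -> (forall x, f x <= g x)%E ->
  (\int[mu]_x f x <= \int[mu]_x g x)%E.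
Proof.
move=> f0 fg; have g0 x : (0 <= g x)%E by exact: le_trans (f0 x) (fg x).
rewrite !ge0_integralTE //; apply: le_ereal_sup => _ [h hf <-].
by exists h => // x; exact: le_trans (hf x) (fg x).
Qed.

(** * Mean of a nonnegative Hermitian polynomial of degree two *)

Section gaussian_second_moment.
Context {R : realType}.
Local Notation C := R[i].
Local Notation std := (normal_prob 0 (Num.sqrt 2^-1 : R)).

Lemma expR_le_inv (x : R) : x < 1 -> expR x <= (1 - x)^-1.
Proof.
move=> x1; rewrite -[leLHS]invrK lef_pV2 ?posrE ?invr_gt0 ?expR_gt0 ?subr_gt0 //.
by rewrite -expRN; have := expR_ge1Dx (- x).
Qed.

(** Squaring reduces this second-order expansion to [5/4 (1 - t) - t^3 >= 0], which holds up to
    [t = 1/2]. *)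
Lemma invr_sqrt_1B_le (t : R) : 0 <= t <= 2^-1 ->
  (Num.sqrt (1 - t))^-1 <= 1 + t / 2 + t ^+ 2.
Proof.
move=> /andP[t0 t1]; have s0 : 0 < Num.sqrt (1 - t) by rewrite sqrtr_gt0; lra.
rewrite -(ler_pM2r s0) mulVf ?gt_eqF //.
have b0 : 0 <= 1 + t / 2 + t ^+ 2 by rewrite addr_ge0 ?sqr_ge0 //; lra.
rewrite -(@ler_pXn2r _ 2) ?nnegrE ?mulr_ge0 ?sqrtr_ge0 // expr1n exprMn sqr_sqrtr; last by lra.
rewrite -subr_ge0.
have -> : (1 + t / 2 + t ^+ 2) ^+ 2 * (1 - t) - 1 =
  t ^+ 2 * (5 / 4 * (1 - t) - t ^+ 3) by field.
rewrite mulr_ge0 ?sqr_ge0 //.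
have : t ^+ 3 <= t * 1 by rewrite exprS ler_wpM2l // exprn_ile1 //; lra.
lra.
Qed.

(** If [c < 0], averaging the values at [1 + t] and [- (1 + t)] removes the linear term; for
    [t = k / - c] the average is [c (1 + t + t^2) < 0]. *)
Lemma quadratic_ge0_lead (c q k : R) :
  (forall y, 0 <= c * y ^+ 2 + 2 * q * y + k) -> 0 <= c.
Proof.
move=> f0; have k0 : 0 <= k by have := f0 0; rewrite expr0n !mulr0 !add0r.
rewrite leNgt; apply/negP => c0; pose t := k / - c.
have t0 : 0 <= t by rewrite divr_ge0 // oppr_ge0 ltW.
have kE : k = - c * t by rewrite /t; field; rewrite lt_eqF.
have := f0 (1 + t); have := f0 (- (1 + t)).
have : 0 < - c * (1 + t + t ^+ 2).
  by rewrite mulr_gt0 ?oppr_gt0 // -addrA ltr_wpDr // addr_ge0 // sqr_ge0.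
lra.
Qed.

(* [f = c y^2 + 2 q y + k] is compared with [k + (expR (s (f - k)) - 1) / s],
   whose integral is explicit, and [s] is sent to [0]. *)
Lemma integral_std_quadratic (c q k : R) :
  (forall y, 0 <= c * y ^+ 2 + 2 * q * y + k) ->
  (\int[std]_y (c * y ^+ 2 + 2 * q * y + k)%:E <= (c / 2 + k)%:E)%E.
Proof.
move=> f0; have k0 : 0 <= k by have := f0 0; rewrite expr0n !mulr0 !add0r.
have c0 := quadratic_ge0_lead f0.
(* [B] collects the terms in [s^2] of the product of [1 + s c / 2 + (s c)^2] and [1 + 4 s^2 q^2];
   dividing by [s] leaves the error [s * B]. *)
pose B := c ^+ 2 + 4 * q ^+ 2 * (1 + c / 2 + c ^+ 2).
have c20 := sqr_ge0 c; have q20 := sqr_ge0 q.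
have B1 : 0 <= 1 + c / 2 + c ^+ 2 by lra.
have B0 : 0 <= B by rewrite addr_ge0 // mulr_ge0 // mulr_ge0.
have mf : measurable_fun setT (fun y : R => c * y ^+ 2 + 2 * q * y + k).
  by apply: measurable_funD => //; apply: measurable_funD; exact: measurable_funM.
have key (s : R) : 0 < s -> s <= 1 -> s * k <= 1 -> s * (2 * c) <= 1 ->
    s * (4 * q ^+ 2) <= 1 ->
  (\int[std]_y (c * y ^+ 2 + 2 * q * y + k)%:E <= (c / 2 + k + s * B)%:E)%E.
  move=> s0 s1 sk sc sq.
  have s20 := sqr_ge0 s.
  have lb : 0 <= s^-1 - k by rewrite subr_ge0 -(ler_pM2l s0) divff ?gt_eqF.
  have : (\int[std]_y (c * y ^+ 2 + 2 * q * y + k)%:E + (s^-1 - k)%:E <=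
      (s^-1 * ((Num.sqrt (1 - s * c))^-1 * expR ((s * q) ^+ 2 / (1 - s * c))))%:E)%E.
    have -> : (\int[std]_y (c * y ^+ 2 + 2 * q * y + k)%:E + (s^-1 - k)%:E =
       \int[std]_y ((c * y ^+ 2 + 2 * q * y + k)%:E + (s^-1 - k)%:E))%E.
      rewrite ge0_integralD //.
      - congr (_ + _)%E; rewrite integral_cst // -[LHS]mule1; congr (_ * _)%E.
        exact/esym/(@probability_setT _ _ _ std).
      - by move=> y _; rewrite lee_fin.
      - exact/measurable_EFinP.
    have -> : (s^-1 * ((Num.sqrt (1 - s * c))^-1 * expR ((s * q) ^+ 2 / (1 - s * c))))%:E =
      (\int[std]_y ((s^-1)%:E * (expR (- ((- (s * c)) * y ^+ 2 + 2 * (- (s * q)) * y)))%:E))%E.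
      rewrite ge0_integralZl //.
      - rewrite integral_std_expR; last by lra.
        by rewrite sqrrN -EFinM.
      - apply/measurable_EFinP; apply: measurableT_comp => //.
        apply: measurable_funN; apply: measurable_funD; exact: measurable_funM.
      - by rewrite lee_fin invr_ge0 ltW.
    apply: ge0_le_integral => //.
    - by move=> y _; rewrite -EFinD lee_fin addr_ge0.
    - by apply: emeasurable_funD => //; exact/measurable_EFinP.
    - apply: emeasurable_funM => //; apply/measurable_EFinP; apply: measurableT_comp => //.
      apply: measurable_funN; apply: measurable_funD; exact: measurable_funM.
    - move=> y _; rewrite -EFinD -EFinM lee_fin -(ler_pM2l s0) mulVKf ?gt_eqF //.
      apply: le_trans (expR_ge1Dx _).
      by rewrite mulrDr mulrBr divff ?gt_eqF //; lra.
  rewrite -leeBrDr // => /le_trans; apply.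
  rewrite -EFinB lee_fin.
  have ex : expR ((s * q) ^+ 2 / (1 - s * c)) <= 1 + 4 * s ^+ 2 * q ^+ 2.
    pose y := 2 * s ^+ 2 * q ^+ 2.
    have y0 : 0 <= y by rewrite /y mulr_ge0 // mulr_ge0.
    have y1 : y <= 2^-1.
      have : s * (s * (4 * q ^+ 2)) <= 1 * 1.
        by apply: ler_pM => //; [exact: ltW|rewrite mulr_ge0 ?(ltW s0) // mulr_ge0].
      by rewrite /y; lra.
    have h1 : (s * q) ^+ 2 / (1 - s * c) <= y.
      rewrite ler_pdivrMr; last by lra.
      have : 0 <= s ^+ 2 * q ^+ 2 * (1 - s * (2 * c)) by apply: mulr_ge0; [exact: mulr_ge0|lra].
      by rewrite /y; lra.
    apply: (@le_trans _ _ (expR y)); first by rewrite ler_expR.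
    apply: (le_trans (expR_le_inv _)); first by lra.
    rewrite -[X in X <= _]mul1r ler_pdivrMr; last by lra.
    have : 0 <= y * (1 - 2 * y) by rewrite mulr_ge0 //; lra.
    have -> : 4 * s ^+ 2 * q ^+ 2 = 2 * y by rewrite /y; ring.
    lra.
  have sv : (Num.sqrt (1 - s * c))^-1 <= 1 + (s * c) / 2 + (s * c) ^+ 2.
    by apply: invr_sqrt_1B_le; apply/andP; split; [rewrite mulr_ge0 // ltW|lra].
  have pr : (Num.sqrt (1 - s * c))^-1 * expR ((s * q) ^+ 2 / (1 - s * c)) <=
      1 + s * (c / 2) + s ^+ 2 * B.
    apply: (@le_trans _ _ ((1 + (s * c) / 2 + (s * c) ^+ 2) * (1 + 4 * s ^+ 2 * q ^+ 2))).
      by rewrite ler_pM ?expR_ge0 // invr_ge0 sqrtr_ge0.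
    have : 0 <= 4 * q ^+ 2 * s ^+ 2 * (c / 2 * (1 - s) + c ^+ 2 * (1 - s ^+ 2)).
      have sle : s ^+ 2 <= 1 by rewrite expr_le1 // ltW.
      rewrite mulr_ge0 //; first by rewrite !(mulr_ge0 _ s20) // mulr_ge0.
      by rewrite addr_ge0 // mulr_ge0 // ?subr_ge0 // divr_ge0.
    by rewrite /B; lra.
  have : s^-1 * ((Num.sqrt (1 - s * c))^-1 * expR ((s * q) ^+ 2 / (1 - s * c))) <=
      s^-1 * (1 + s * (c / 2) + s ^+ 2 * B) by rewrite ler_pM2l ?invr_gt0.
  have -> : s^-1 * (1 + s * (c / 2) + s ^+ 2 * B) = s^-1 + c / 2 + s * B.
    by field; rewrite gt_eqF.
  lra.
apply/lee_addgt0Pr => e e0.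
(* With [s = e / D] every smallness condition holds, since each compares [D] with [e] times one of
   its summands, and [B <= D] gives [s * B <= e]. *)
pose D := e * (1 + k + 2 * c + 4 * q ^+ 2) + B.
have D0 : 0 < D by rewrite /D ltr_wpDr // mulr_gt0 //; lra.
have sD (m : R) : e * m <= D -> e / D * m <= 1.
  by move=> emD; rewrite mulrAC ler_pdivrMr // mul1r.
have m1 : 0 <= e * k by rewrite mulr_ge0 // ltW.
have m2 : 0 <= e * c by rewrite mulr_ge0 // ltW.
have m3 : 0 <= e * q ^+ 2 by rewrite mulr_ge0 // ltW.
apply: (le_trans (key (e / D) _ _ _ _ _)).
- by rewrite divr_gt0.
- by rewrite -[leLHS]mulr1; apply: sD; rewrite /D; lra.
- by apply: sD; rewrite /D; lra.
- by apply: sD; rewrite /D; lra.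
- by apply: sD; rewrite /D; lra.
rewrite -EFinD lee_fin lerD2l mulrAC ler_pdivrMr // ler_pM2l //.
by rewrite /D lerDr; apply: mulr_ge0; [exact: ltW|lra].
Qed.

(** Each complex coordinate contributes its diagonal entry. Nonnegativity of the whole expression
    takes the place of integrability of its terms: it forces the diagonal entries to be nonnegative,
    and it is inherited by the smaller form on setting the removed coordinate to zero. *)
Lemma gaussian_integral_qf_le n (B : 'M[C]_n) (al : R) d (T : measurableType d)
    (P : probability T R) (X : 'I_n * bool -> T -> R) :
  gaussian_family P X -> adjmx B = B ->
  (forall u : 'I_n * bool -> R, 0 <= al + complex.Re (qf B (cvec u))) ->
  (\int[P]_w (al + complex.Re (qf B (cvec (X ^~ w))))%:E <=
   (al + complex.Re (\tr B))%:E)%E.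
Proof.
elim: n B X al => [|n IH]; last rewrite -[n.+1]/(1 + n)%N; move=> B X al GX hB B0.
  under eq_integral => w _.
    by rewrite /qf mxE big_ord0 addr0; over.
  rewrite integral_cst // /mxtrace big_ord0 addr0 -[leRHS]mule1 lee_pmul //.
    by have := B0 (fun=> 0); rewrite /qf mxE big_ord0 addr0 lee_fin.
  by rewrite [leLHS](@probability_setT _ _ _ P).
pose a := complex.Re (B 0 0).
pose p (u : 'I_n * bool -> R) := (ursubmx B *m cvec u) 0 0.
pose h (u : 'I_n * bool -> R) := complex.Re (qf (drsubmx B) (cvec u)).
pose F (x y : R) (u : 'I_n * bool -> R) :=
  al + (a * (x ^+ 2 + y ^+ 2) +
    2 * (x * complex.Re (p u) + y * complex.Im (p u)) + h u).
have FE (u : 'I_(1 + n) * bool -> R) : al + complex.Re (qf B (cvec u)) =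
    F (u (head_index n false)) (u (head_index n true)) (fun i => u (behead_family i)).
  by rewrite (Re_qf_cvec u hB).
have F0 x y u : 0 <= F x y u.
  pose v (i : 'I_(1 + n) * bool) := match fintype.split i.1 with
    | inl _ => if i.2 then y else x | inr j => u (j, i.2) end.
  have := B0 v; rewrite FE; congr (0 <= F _ _ _).
  - by rewrite /v /=; case: splitP => // j /=; case: j.
  - by rewrite /v /=; case: splitP => // j /=; case: j.
  - apply/funext => -[i b]; rewrite /v /=; case: splitP => [j /= e|j /= e].
      by have := ltn_ord j; rewrite -e.
    by congr (u (_, _)); apply/val_inj; move: e => /= /addnI ->.
under eq_integral => w _ do rewrite FE.
have mF : measurable_family (fun u : 'I_(1 + n) * bool -> R =>
    (F (u (head_index n false)) (u (head_index n true)) (fun i => u (behead_family i)))%:E).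
  rewrite [X in measurable_family X](_ : _ =
    (fun u => (al + complex.Re (qf B (cvec u)))%:E)); last first.
    by apply/funext => u; rewrite FE.
  apply/measurable_EFinP; apply: measurable_funD => //.
  by apply: measurable_Re_qf_cvec => i; exact: measurable_tuple_fun.
rewrite (gaussian_elim_head (F := fun x y u => (F x y u)%:E) GX mF) //.
have FI (u : 'I_n * bool -> R) : (\int[std]_x \int[std]_y (F x y u)%:E <=
    (al + a + h u)%:E)%E.
  have a0 : 0 <= a.
    apply: (@quadratic_ge0_lead a (complex.Re (p u)) (al + h u)) => y.
    by have := F0 y 0 u; rewrite /F; lra.
  apply: (@le_trans _ _ (\int[std]_x (a * x ^+ 2 + 2 * complex.Re (p u) * x +
      (a / 2 + al + h u))%:E)%E).
    apply: le_integral_ge0 => x.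
      by apply: integral_ge0 => y _; rewrite lee_fin.
    have -> : (a * x ^+ 2 + 2 * complex.Re (p u) * x + (a / 2 + al + h u))%:E =
        (a / 2 + (a * x ^+ 2 + 2 * complex.Re (p u) * x + al + h u))%:E.
      by congr EFin; ring.
    have FE' y : F x y u = a * y ^+ 2 + 2 * complex.Im (p u) * y +
        (a * x ^+ 2 + 2 * complex.Re (p u) * x + al + h u) by rewrite /F; ring.
    under eq_integral => y _ do rewrite FE'.
    by apply: integral_std_quadratic => y; rewrite -FE'.
  have -> : (al + a + h u)%:E = (a / 2 + (a / 2 + al + h u))%:E.
    by congr EFin; field.
  apply: integral_std_quadratic => x.
  by have := F0 x 0 u; rewrite /F; lra.
apply: (@le_trans _ _ (\int[P]_w (al + a + h (fun i => X (behead_family i) w))%:E)%E).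
  apply: le_integral_ge0 => w; last exact: FI.
  by apply: integral_ge0 => x _; apply: integral_ge0 => y _; rewrite lee_fin.
have -> : (al + complex.Re (\tr B))%:E = (al + a + complex.Re (\tr (drsubmx B)))%:E.
  have := congr1 mxtrace (hermitian_block hB); rewrite mxtrace_block mxtrace_scalar mulr1n => ->.
  by rewrite /a; case: (B 0 0) => ? ?; case: (\tr _) => ? ? /=; rewrite addrA.
apply: IH.
- exact: gaussian_family_inj (@behead_family_inj n) GX.
- exact: hermitian_drsub.
- move=> u; have := F0 0 0 u; have a0 : 0 <= a.
    apply: (@quadratic_ge0_lead a (complex.Re (p u)) (al + h u)) => y.
    by have := F0 y 0 u; rewrite /F; lra.
  by rewrite /F /h; lra.
Qed.

End gaussian_second_moment.

(** * The mean determinant *)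

Section gram_expectation.
Context {R : realType}.
Local Notation C := R[i].

Definition subcol N K n (f : 'I_n -> 'I_N) (j : 'I_K)
    (u : 'I_N * 'I_K * bool -> R) : 'cV[C]_n :=
  cvec (fun i : 'I_n * bool => u (f i.1, j, i.2)).

(** [f] selects rows and [r] columns. Deleting a row composes [f] with [lift i], so principal minors
    are again of this shape and the recursion on columns closes. *)
Definition gram N K n (f : 'I_n -> 'I_N) (r : seq 'I_K) (phi : 'I_K -> R)
    (u : 'I_N * 'I_K * bool -> R) : 'M[C]_n :=
  1%:M + \sum_(j <- r) (phi j)%:C%C *: (subcol f j u *m adjmx (subcol f j u)).

Lemma gram_cons N K n (f : 'I_n -> 'I_N) (j : 'I_K) r phi u :
  gram f (j :: r) phi u =
  gram f r phi u + (phi j)%:C%C *: (subcol f j u *m adjmx (subcol f j u)).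
Proof. by rewrite /gram big_cons -addrA [X in _ + X]addrC. Qed.

Lemma eq_gram N K n (f : 'I_n -> 'I_N) (r : seq 'I_K) phi u u' :
  (forall i j b, j \in r -> u (i, j, b) = u' (i, j, b)) ->
  gram f r phi u = gram f r phi u'.
Proof.
move=> uu'; congr (_ + _); apply: eq_big_seq => j jr.
suff -> : subcol f j u = subcol f j u' by [].
by congr cvec; apply/funext => -[i b] /=; exact: uu'.
Qed.

Lemma gram_minor N K n (f : 'I_n.+1 -> 'I_N) (r : seq 'I_K) phi u i :
  row' i (col' i (gram f r phi u)) = gram (f \o lift i) r phi u.
Proof.
apply/matrixP => a b; rewrite !mxE !summxE (inj_eq (@lift_inj _ i)); congr (_ + _).
by apply: eq_bigr => j _; rewrite !mxE; congr (_ * _); apply: eq_bigr => k _; rewrite !mxE.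
Qed.

Lemma pos_def_gram N K n (f : 'I_n -> 'I_N) (r : seq 'I_K) phi u :
  (forall j, 0 <= phi j) -> pos_def (gram f r phi u).
Proof. exact: pos_def1D_sum. Qed.

Lemma Re_gt0 (z : C) : 0 < z -> 0 < complex.Re z.
Proof. by case: z => a b; rewrite ltcE => /andP[]. Qed.

Lemma Re_det_gram_gt0 N K n (f : 'I_n -> 'I_N) (r : seq 'I_K) phi u :
  (forall j, 0 <= phi j) -> 0 < complex.Re (\det (gram f r phi u)).
Proof. by move=> phi0; apply/Re_gt0/pos_def_det/pos_def_gram. Qed.

Lemma mxmeasurable_subcol N K n (f : 'I_n -> 'I_N) (j : 'I_K) d
    (T : measurableType d) (Z : T -> 'I_N * 'I_K * bool -> R) :
  (forall i, measurable_fun setT (Z ^~ i)) ->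
  mxmeasurable (fun w => subcol f j (Z w)).
Proof. by move=> mZ; apply: mxmeasurable_cvec => i; exact: mZ. Qed.

Lemma mxmeasurable_gram N K n (f : 'I_n -> 'I_N) (r : seq 'I_K) d
    (T : measurableType d) (phi : T -> 'I_K -> R) (Z : T -> 'I_N * 'I_K * bool -> R) :
  (forall j, measurable_fun setT (phi ^~ j)) ->
  (forall i, measurable_fun setT (Z ^~ i)) ->
  mxmeasurable (fun w => gram f r (phi w) (Z w)).
Proof.
move=> mphi mZ; apply: mxmeasurableD; first exact: mxmeasurable_cst.
apply: mxmeasurable_sum => j; apply: mxmeasurableZ; first exact: cmeasurable_real.
apply: mxmeasurableM; first exact: mxmeasurable_subcol.
by apply: mxmeasurable_adj; exact: mxmeasurable_subcol.
Qed.

Lemma measurable_det_gram N K n (f : 'I_n -> 'I_N) (r : seq 'I_K) d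
    (T : measurableType d) (phi : T -> 'I_K -> R) (Z : T -> 'I_N * 'I_K * bool -> R) :
  (forall j, measurable_fun setT (phi ^~ j)) ->
  (forall i, measurable_fun setT (Z ^~ i)) ->
  measurable_fun setT (fun w => complex.Re (\det (gram f r (phi w) (Z w)))).
Proof.
by move=> mphi mZ; apply: (cmeasurable_det _).1; exact: mxmeasurable_gram.
Qed.

Lemma gaussian_column N K n (f : 'I_n -> 'I_N) (j : 'I_K) d (T : measurableType d)
    (P : probability T R) (X : 'I_N * 'I_K * bool -> T -> R) :
  injective f -> gaussian_family P X ->
  gaussian_family P (fun i : 'I_n * bool => X (f i.1, j, i.2)).
Proof.
move=> finj GX.
refine (gaussian_family_inj (f := fun i : 'I_n * bool => (f i.1, j, i.2)) _ GX).
by move=> [i b] [i' b'] /= [/finj -> ->].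
Qed.

Section fixed_family.
Variables (N K : nat) (d : measure_display) (T : measurableType d).
Variables (P : probability T R) (X : 'I_N * 'I_K * bool -> T -> R).
Hypothesis GX : gaussian_family P X.
Variable phi : 'I_K -> R.
Hypothesis phi0 : forall j, 0 <= phi j.

(* Expanding along the last column [j] gives
   [E det (n, j :: r) = E det (n, r) + phi j * n * E det (n - 1, r)]. *)
Lemma expected_det_gram_le (al : R) n (f : 'I_n -> 'I_N) (r : seq 'I_K) :
  0 < al -> injective f -> uniq r ->
  (\int[P]_w (complex.Re (\det (gram f r phi (X ^~ w))))%:E <=
   (n`!%:R / al ^+ n * expR al * \prod_(j <- r) (1 + phi j * al))%:E)%E.
Proof.
move=> al0; elim: r n f => [|j r IH] n f finj.
  move=> _; under eq_integral => w _ do rewrite /gram big_nil addr0 det1.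
  rewrite integral_cst // [X in (_ * X)%E](@probability_setT _ _ _ P) mule1 lee_fin.
  rewrite big_nil mulr1 mulrAC ler_pdivlMr ?exprn_gt0 // mul1r.
  case: n f finj => [|n] f finj; first by rewrite mul1r expr0 -[leLHS]expR0 ler_expR ltW.
  (* With no columns the determinant is [1], and one term of the exponential series gives
     [al^(n+1) <= (n+1)! e^al]. *)
  have := @expR_ge1Dxn R al n (ltW al0); set F := n.+1`!%:R.
  have F0 : 0 < F by rewrite ltr0n fact_gt0.
  rewrite -(ler_pM2l F0) mulrDr mulr1 mulrCA divff ?gt_eqF // mulr1 => h.
  by apply: le_trans h; rewrite lerDr ltW.
move=> /andP[jr ur].
pose F (u : 'I_N * 'I_K * bool -> R) := (complex.Re (\det (gram f (j :: r) phi u)))%:E.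
have mtf i : measurable_fun setT (tuple_fun ^~ i : #|{: 'I_N * 'I_K * bool}|.-tuple R -> R).
  exact: measurable_tuple_fun.
have mF : measurable_family F.
  by apply/measurable_EFinP; apply: measurable_det_gram.
rewrite (indep_decouple (F := F) (fun i => i.1.2 != j) GX.1 mF); last first.
  by move=> u; rewrite lee_fin ltW // Re_det_gram_gt0.
pose A w := gram f r phi (X ^~ w).
apply: (@le_trans _ _ (\int[P]_w (complex.Re (\det (A w)) +
    phi j * complex.Re (\tr (\adj (A w))))%:E)%E).
  apply: le_integral_ge0 => w.
    by apply: integral_ge0 => w' _; rewrite lee_fin ltW // Re_det_gram_gt0.
  have pA : pos_def (A w) by exact: pos_def_gram.
  have ReM (z : C) : complex.Re ((phi j)%:C%C * z) = phi j * complex.Re z.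
    by case: z => a b /=; ring.
  have ReD (z1 z2 : C) : complex.Re (z1 + z2) = complex.Re z1 + complex.Re z2.
    by case: z1 => ? ?; case: z2.
  have det_col (v : 'cV[C]_n) :
      complex.Re (\det (A w + (phi j)%:C%C *: (v *m adjmx v))) =
      complex.Re (\det (A w)) + complex.Re (qf ((phi j)%:C%C *: \adj (A w)) v).
    by rewrite det_D_rank1 ?gt_eqF ?pos_def_det // ReD qfZ.
  have -> : (\int[P]_w' F (fun i => if i.1.2 != j then X i w else X i w') =
     \int[P]_w' (complex.Re (\det (A w)) +
        complex.Re (qf ((phi j)%:C%C *: \adj (A w))
          (cvec (fun i : 'I_n * bool => X (f i.1, j, i.2) w'))))%:E)%E.
    apply: eq_integral => w' _; rewrite /F gram_cons -det_col.
    have -> : gram f r phi (fun i => if i.1.2 != j then X i w else X i w') = A w.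
      apply: eq_gram => i j' b j'r /=.
      by case: eqVneq => // e; rewrite -e j'r in jr.
    by rewrite /subcol /= eqxx.
  rewrite -ReM -mxtraceZ.
  apply: (gaussian_integral_qf_le
    (X := fun (i : 'I_n * bool) => X (f i.1, j, i.2))).
  - exact: (gaussian_column j finj GX).
  - by rewrite adjmxZ conjc_real adjmx_adjugate pA.1.
  (* For any [u] the expression is the determinant of the matrix with column [j] replaced by [u],
     hence nonnegative. *)
  - move=> u; rewrite -det_col; apply: ltW; apply/Re_gt0/pos_def_det.
    rewrite /A /gram -addrA.
    have -> : \sum_(j0 <- r) (phi j0)%:C%C *: (subcol f j0 (X^~ w) *m adjmx (subcol f j0 (X^~ w)))
       + (phi j)%:C%C *: (cvec u *m adjmx (cvec u)) =
      \sum_(j0 <- j :: r) (phi j0)%:C%C *: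
       ((if j0 == j then cvec u else subcol f j0 (X^~ w)) *m
        adjmx (if j0 == j then cvec u else subcol f j0 (X^~ w))).
      rewrite big_cons eqxx [RHS]addrC; congr (_ + _).
      apply: eq_big_seq => j' j'r; case: eqVneq => // e.
      by rewrite -e j'r in jr.
    exact: (pos_def1D_sum (j :: r)
      (fun j0 => if j0 == j then cvec u else subcol f j0 (X^~ w)) phi0).
pose p := \prod_(j' <- r) (1 + phi j' * al).
have p0 : 0 <= p.
  by apply: prodr_ge0 => j' _; rewrite addr_ge0 // mulr_ge0 // ltW.
(* In size [0] there are no minors, and the bound merely has to absorb one more factor
   [1 + phi j * al >= 1]. *)
move: @A; clear F mF; case: n f finj => [|n] f finj A.
  under eq_integral => w _ do rewrite [\tr _]big_ord0 [complex.Re 0]/= mulr0 addr0.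
  apply: (le_trans (IH 0%N f finj ur)); rewrite lee_fin big_cons.
  apply: ler_wpM2l.
    by rewrite mulr_ge0 ?expR_ge0 // divr_ge0 // exprn_ge0 // ltW.
  by rewrite ler_peMl // lerDl mulr_ge0 // ltW.
rewrite {}/A.
have Re_sum (J : Type) (s : seq J) (g : J -> C) :
    complex.Re (\sum_(k <- s) g k) = \sum_(k <- s) complex.Re (g k).
  elim: s => [|k s IHs]; first by rewrite !big_nil.
  by rewrite !big_cons -IHs; case: (g k) => ? ?; case: (\sum_(_ <- _) _).
have trE w : complex.Re (\tr (\adj (gram f r phi (X^~ w)))) =
    \sum_(i < n.+1) complex.Re (\det (gram (f \o lift i) r phi (X^~ w))).
  rewrite trace_adjugate [LHS]Re_sum; apply: eq_bigr => i _.
  by rewrite gram_minor.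
have mD n' (f' : 'I_n' -> 'I_N) :
    measurable_fun setT (fun w => (complex.Re (\det (gram f' r phi (X^~ w))))%:E).
  by apply/measurable_EFinP; apply: measurable_det_gram => // i; exact: GX.1.1.
have D0 n' (f' : 'I_n' -> 'I_N) w : (0 <= (complex.Re (\det (gram f' r phi (X^~ w))))%:E)%E.
  by rewrite lee_fin ltW // Re_det_gram_gt0.
have -> : (\int[P]_w (complex.Re (\det (gram f r phi (X^~ w))) + phi j * complex.Re (\tr (\adj (gram f r phi (X^~ w)))))%:E =
   \int[P]_w (complex.Re (\det (gram f r phi (X^~ w))))%:E + (phi j)%:E * \sum_(i < n.+1)
     \int[P]_w (complex.Re (\det (gram (f \o lift i) r phi (X^~ w))))%:E)%E.
  under eq_integral => w _ do rewrite trE EFinD EFinM -sumEFin.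
  rewrite ge0_integralD //; last 2 first.
  - move=> w _; rewrite mule_ge0 ?lee_fin //.
    by apply: sume_ge0 => i _; exact: D0.
  - apply: emeasurable_funM => //; apply: emeasurable_sum => i; exact: mD.
  congr (_ + _)%E; rewrite ge0_integralZl //.
  - by rewrite ge0_integral_sum.
  - by apply: emeasurable_sum => i; exact: mD.
  - by move=> w _; apply: sume_ge0 => i _; exact: D0.
  - by rewrite lee_fin.
(* The normalisation [n! / al^n] is made for this identity: [n + 1] minors of size [n], weighted by
   [phi j], give the bound of size [n + 1] times [phi j * al], which completes the factor
   [1 + phi j * al]. *)
rewrite [leRHS](_ : _ = ((n.+1`!%:R / al ^+ n.+1 * expR al * p)%:E +
   (phi j)%:E * \sum_(i < n.+1) (n`!%:R / al ^+ n * expR al * p)%:E)%E); last first.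
  rewrite sumEFin -EFinM -EFinD big_cons -/p sumr_const card_ord factS natrM exprS -mulr_natl.
  by congr EFin; field; rewrite expf_neq0 ?gt_eqF.
apply: leeD; first exact: IH.
apply: lee_wpmul2l; first by rewrite lee_fin.
by apply: lee_sum => i _; apply: IH => //; apply: inj_comp => //; exact: lift_inj.
Qed.

End fixed_family.
End gram_expectation.

(** * The mean inverse determinant *)

Section gamma_integral.
Context {R : realType}.
Local Notation mu := (@lebesgue_measure R).

(** For [0 < l], the antiderivative of [x^n e^(- l x) / n!] that vanishes at infinity, unfolded by
    integration by parts. *)
Fixpoint gamma_primitive (l : R) (n : nat) (x : R) : R :=
  if n is n'.+1
  then l^-1 * (gamma_primitive l n' x - n'.+1`!%:R^-1 * (x ^+ n'.+1 * expR (- (l * x))))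
  else - l^-1 * expR (- (l * x)).

Lemma is_derive_gamma_primitive (l : R) n (x : R) : l != 0 ->
  is_derive x 1 (gamma_primitive l n) (n`!%:R^-1 * (x ^+ n * expR (- (l * x)))).
Proof.
move=> l0; have dl : is_derive x 1 (fun y : R => - (l * y)) (- l).
  rewrite (_ : (fun y => _) = (- l) *: (@id R : R -> R^o)).
    by apply: is_derive_eq; rewrite /GRing.scale /= mulr1.
  by apply/funext => y; exact/esym/mulNr.
have de : is_derive x 1 (fun y : R => expR (- (l * y))) (- l * expR (- (l * x))).
  have := @is_derive1_comp R expR (fun y => - (l * y)) x _ _ (is_derive_expR _) dl.
  by rewrite mulrC.
elim: n => [|n IH] /=.
  rewrite (_ : (fun y => _) = (- l^-1) *: ((fun y => expR (- (l * y))) : R -> R^o)) //.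
  by apply: is_derive_eq; rewrite /GRing.scale /= fact0 invr1 expr0 !mul1r mulrA mulrNN mulVf ?mul1r.
have dX : is_derive x 1 (fun y : R => y ^+ n.+1) (n.+1%:R * x ^+ n).
  rewrite (_ : (fun y => _) = (@id R : R -> R^o) ^+ n.+1).
    by apply: is_derive_eq; rewrite /GRing.scale /= mulr1.
  by apply/funext => y; rewrite exprfctE.
rewrite (_ : (fun y => _) = l^-1 *: ((gamma_primitive l n : R -> R^o) - n.+1`!%:R^-1 *:
  (((fun y => y ^+ n.+1) : R -> R^o) * (fun y => expR (- (l * y)))) : R -> R^o)); last first.
  by apply/funext => y.
apply: is_derive_eq.
have n0 : n`!%:R != 0 :> R by rewrite pnatr_eq0 -lt0n fact_gt0.
rewrite /GRing.scale /= factS natrM; field.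
by rewrite l0 n0 /= addrC natr1 pnatr_eq0.
Qed.

(** The term of degree [n + 1] of the exponential series beats [x^n] by one power and leaves the
    bound [c / x]. *)
Lemma cvg_pow_expRN (l : R) n : 0 < l ->
  x ^+ n * expR (- (l * x)) @[x --> +oo] --> (0 : R).
Proof.
move=> l0; pose c := n.+1`!%:R / l ^+ n.+1.
have cx : c * x^-1 @[x --> +oo] --> (0 : R).
  rewrite -[0](mulr0 c); apply: cvgM; first exact: cvg_cst.
  apply/(gtr0_cvgV0 (f := id)); last exact: cvg_id.
  by near=> y; near: y; exact: nbhs_pinfty_gt.
apply: (squeeze_cvgr (f := fun=> 0) (h := fun x => c * x^-1)) => //; last exact: cvg_cst.
near=> x; have x0 : 0 < x by near: x; exact: nbhs_pinfty_gt.
apply/andP; split; first by rewrite mulr_ge0 ?expR_ge0 // exprn_ge0 // ltW.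
rewrite expRN ler_pdivrMr ?expR_gt0 // -(ler_pM2l x0) -exprS.
have F0 : 0 < n.+1`!%:R :> R by rewrite ltr0n fact_gt0.
have h : c * (1 + (l * x) ^+ n.+1 / n.+1`!%:R) <= c * expR (l * x).
  rewrite ler_pM2l ?divr_gt0 ?exprn_gt0 //.
  exact: @expR_ge1Dxn R (l * x) n (ltW (mulr_gt0 l0 x0)).
rewrite (_ : x * _ = c * expR (l * x)); last first.
  by rewrite mulrA mulrCA divff ?mulr1 // gt_eqF.
apply: le_trans h; rewrite mulrDr mulr1 exprMn /c.
have -> : n.+1`!%:R / l ^+ n.+1 * (l ^+ n.+1 * x ^+ n.+1 / n.+1`!%:R) = x ^+ n.+1.
  by field; rewrite expf_neq0 gt_eqF.
by rewrite lerDr divr_ge0 ?ltW // exprn_gt0.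
Unshelve. all: by end_near. Qed.

Lemma cvg_gamma_primitive (l : R) n : 0 < l ->
  gamma_primitive l n x @[x --> +oo] --> (0 : R).
Proof.
move=> l0; elim: n => [|n IH] /=.
  rewrite -[0](mulr0 (- l^-1)); apply: cvgM; first exact: cvg_cst.
  have := @cvg_pow_expRN l 0 l0.
  by under eq_cvg do rewrite expr0 mul1r.
rewrite -[0](mulr0 l^-1); apply: cvgM; first exact: cvg_cst.
rewrite -[0]subr0; apply: cvgB => //.
rewrite -[0](mulr0 n.+1`!%:R^-1); apply: cvgM; first exact: cvg_cst.
exact: cvg_pow_expRN.
Qed.

Lemma gamma_integral (l : R) n : 0 < l ->
  (\int[mu]_(x in `[0%R, +oo[) (n`!%:R^-1 * (x ^+ n * expR (- (l * x))))%:E =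
   (l^-1 ^+ n.+1)%:E)%E.
Proof.
move=> l0; have ln0 : l != 0 by rewrite gt_eqF.
rewrite (@ge0_continuous_FTC2y _ _ (gamma_primitive l n) 0 0).
- rewrite sub0e -EFinN; congr EFin; elim: n => [|n IH] /=.
    by rewrite mulr0 oppr0 expR0 mulr1 opprK expr1.
  by rewrite expr0n mul0r mulr0 subr0 exprS -IH mulrN.
- by move=> x x0; rewrite mulr_ge0 ?invr_ge0 // mulr_ge0 ?expR_ge0 // exprn_ge0.
- apply: continuous_subspaceT => x; apply: cvgM; first exact: cvg_cst.
  apply: cvgM; first exact: exprn_continuous.
  apply: (cvg_comp _ expR); last exact: continuous_expR.
  by apply: cvgN; apply: cvgM; [exact: cvg_cst|exact: cvg_id].
- exact: cvg_gamma_primitive.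
- by move=> x _; have [] := is_derive_gamma_primitive n x ln0.
- apply: cvg_at_right_filter.
  have [/derivable1_diffP/differentiable_continuous + _] :=
    is_derive_gamma_primitive n 0 ln0.
  exact.
- by move=> x _; rewrite derive1E; have [_ ->] := is_derive_gamma_primitive n x ln0.
Qed.

End gamma_integral.

(** * From Laplace transforms to products of inverse square roots *)

Section laplace.
Context {R : realType}.
Local Notation std := (normal_prob 0 (Num.sqrt 2^-1 : R)).
Implicit Types (c s : R) (r : seq R).

(** Square roots appear because one real Gaussian average produces [(1 + c x)^(-1/2)]; a coefficient
    listed twice restores [(1 + c x)^-1]. *)
Definition damping r (x : R) : R := \prod_(c <- r) (Num.sqrt (1 + c * x))^-1.

Lemma damping_ge0 r x : 0 <= damping r x.
Proof. by apply: prodr_ge0 => c _; rewrite invr_ge0 sqrtr_ge0. Qed.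

Lemma measurable_damping d (T : measurableType d) r (rho : T -> R) :
  (forall c, c \in r -> 0 <= c) -> (forall x, 0 <= rho x) ->
  measurable_fun setT rho -> measurable_fun setT (fun x => damping r (rho x)).
Proof.
move=> + rho0 mrho; rewrite /damping; elim: r => [|c r IH] r0.
  by under eq_fun do rewrite big_nil; exact: measurable_cst.
under eq_fun do rewrite big_cons.
apply: measurable_funM; last by apply: IH => c' c'r; apply: r0; rewrite inE c'r orbT.
have c0 : 0 <= c by apply: r0; rewrite mem_head.
rewrite (_ : (fun x => _) = fun x => expR (- (2^-1 * ln (1 + c * rho x)))).
  apply: measurableT_comp => //; apply: measurable_funN; apply: measurable_funM => //.
  apply: measurableT_comp; first exact: measurable_ln.
  by apply: measurable_funD => //; exact: measurable_funM.
apply/funext => x; have p : 0 < 1 + c * rho x by rewrite ltr_pwDl // mulr_ge0.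
rewrite expRN; congr (_^-1); apply/eqP.
rewrite -(@eqrXn2 _ 2) ?sqrtr_ge0 ?expR_ge0 // sqr_sqrtr ?(ltW p) // -expRM_natr mulrAC.
by rewrite mulVf // mul1r lnK.
Qed.

Section one_measure.
Context d (T : measurableType d) (m : {sigma_finite_measure set T -> \bar R}).
Variables g rho : T -> R.
Hypothesis g0 : forall x, 0 <= g x.
Hypothesis rho0 : forall x, 0 <= rho x.
Hypothesis mg : measurable_fun setT g.
Hypothesis mrho : measurable_fun setT rho.

(** At a fixed point, [(1 + c rho)^(-1/2)] is the Gaussian average of [exp (- c rho y^2)]; Tonelli
    moves this average outside. *)
Lemma integral_sqrt_mixture c : 0 <= c ->
  (\int[m]_x (g x * (Num.sqrt (1 + c * rho x))^-1)%:E =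
   \int[std]_y \int[m]_x (g x * expR (- (c * y ^+ 2 * rho x)))%:E)%E.
Proof.
move=> c0.
pose H (z : T * measurableTypeR R) : \bar R :=
  (g z.1 * expR (- (c * z.2 ^+ 2 * rho z.1)))%:E.
have mH : measurable_fun setT H.
  have m2 : measurable_fun setT (fun z : T * measurableTypeR R => (z.2 : R)).
    exact: measurable_snd.
  apply/measurable_EFinP; apply: measurable_funM; first exact: measurableT_comp.
  apply: measurableT_comp => //; apply: measurable_funN; apply: measurable_funM.
    by apply: measurable_funM => //; exact: measurable_funX.
  exact: measurableT_comp.
have H0 z : (0 <= H z)%E by rewrite lee_fin mulr_ge0 ?expR_ge0.
rewrite -(@fubini_tonelli _ _ _ _ _ m std H) //.
apply: eq_integral => x _; rewrite /H /=.
transitivity ((g x)%:E *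
    \int[std]_y (expR (- (c * rho x * y ^+ 2 + 2 * 0 * y)))%:E)%E.
  rewrite integral_std_expR ?expr0n ?mul0r ?expR0 ?mulr1 ?EFinM //.
  by have := mulr_ge0 c0 (rho0 x); lra.
rewrite -ge0_integralZl //; last 2 first.
- apply/measurable_EFinP; apply: measurableT_comp => //.
  by apply: measurable_funN; apply: measurable_funD; exact: measurable_funM.
- by rewrite lee_fin.
apply: eq_integral => y _; rewrite -EFinM; congr (_ * expR _)%:E; ring.
Qed.

End one_measure.

(** Each factor of [damping] is a mixture of exponentials, so it only shifts the Laplace parameter
    from [s] to [s + c y^2] under an outer average over [y]. Equality of the transforms thus
    propagates along [r], with no inversion of the Laplace transform. *)
Lemma laplace_damping d1 d2 (T1 : measurableType d1) (T2 : measurableType d2)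
    (m1 : {sigma_finite_measure set T1 -> \bar R})
    (m2 : {sigma_finite_measure set T2 -> \bar R})
    (g1 rho1 : T1 -> R) (g2 rho2 : T2 -> R) :
  (forall x, 0 <= g1 x) -> (forall x, 0 <= rho1 x) ->
  measurable_fun setT g1 -> measurable_fun setT rho1 ->
  (forall x, 0 <= g2 x) -> (forall x, 0 <= rho2 x) ->
  measurable_fun setT g2 -> measurable_fun setT rho2 ->
  (forall s, (0 <= s)%R -> \int[m1]_x (g1 x * expR (- (s * rho1 x)))%:E =
                       \int[m2]_x (g2 x * expR (- (s * rho2 x)))%:E)%E ->
  forall r, (forall c, c \in r -> 0 <= c) -> forall s, 0 <= s ->
  (\int[m1]_x (g1 x * expR (- (s * rho1 x)) * damping r (rho1 x))%:E =
   \int[m2]_x (g2 x * expR (- (s * rho2 x)) * damping r (rho2 x))%:E)%E.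
Proof.
move=> g10 rho10 mg1 mrho1 g20 rho20 mg2 mrho2 E12; elim=> [|c r IH] r0 s s0.
  under eq_integral => x _ do rewrite /damping big_nil mulr1.
  by under [RHS]eq_integral => x _ do rewrite /damping big_nil mulr1; exact: E12.
have c0 : 0 <= c by apply: r0; rewrite mem_head.
have {}r0 c' : c' \in r -> 0 <= c' by move=> c'r; apply: r0; rewrite inE c'r orbT.
have step d (T : measurableType d) (m : {sigma_finite_measure set T -> \bar R})
    (g rho : T -> R) : (forall x, 0 <= g x) -> (forall x, 0 <= rho x) ->
    measurable_fun setT g -> measurable_fun setT rho ->
  (\int[m]_x (g x * expR (- (s * rho x)) * damping (c :: r) (rho x))%:E =
   \int[std]_y \int[m]_x (g x * expR (- ((s + c * y ^+ 2) * rho x)) *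
      damping r (rho x))%:E)%E.
  move=> g0 rho0 mg mrho.
  transitivity (\int[m]_x ((g x * expR (- (s * rho x)) * damping r (rho x)) *
      (Num.sqrt (1 + c * rho x))^-1)%:E)%E.
    apply: eq_integral => x _; rewrite /damping big_cons; congr EFin; ring.
  rewrite (integral_sqrt_mixture m) //.
  - apply: eq_integral => y _; apply: eq_integral => x _.
    rewrite mulrAC -[_ * expR _ * expR _]mulrA -expRD; congr (_ * expR _ * _)%:E; ring.
  - by move=> x; rewrite mulr_ge0 ?damping_ge0 // mulr_ge0 ?expR_ge0.
  - apply: measurable_funM; last exact: measurable_damping.
    apply: measurable_funM => //; apply: measurableT_comp => //.
    by apply: measurable_funN; exact: measurable_funM.
rewrite (step _ _ m1) // (step _ _ m2) //; apply: eq_integral => y _.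
by apply: IH => //; rewrite addr_ge0 // mulr_ge0 ?sqr_ge0.
Qed.

End laplace.

(** * The inverse determinant as a Gaussian integral *)

Section inverse_determinant.
Context {R : realType}.
Local Notation C := R[i].

Definition nrm2 n (z : 'cV[C]_n) : R := complex.Re (qf 1%:M z).

Lemma nrm2_ge0 n (z : 'cV[C]_n) : 0 <= nrm2 z.
Proof.
have := qf1_ge0 z; rewrite /nrm2; case: (qf _ z) => a b.
by rewrite lecE /= => /andP[].
Qed.

Lemma qf_scalar n (a : C) (z : 'cV[C]_n) : qf a%:M z = a * qf 1%:M z.
Proof. by rewrite -qfZ scalemx1. Qed.

Lemma ReZ (a : R) (z : C) : complex.Re (a%:C%C * z) = a * complex.Re z.
Proof. by case: z => ? ? /=; ring. Qed.

Lemma qf1_real n (z : 'cV[C]_n) : qf 1%:M z = (nrm2 z)%:C%C.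
Proof. by rewrite /nrm2 RRe_real // ger0_real // qf1_ge0. Qed.

(** The Gaussian integral for [Q = (1 + s) I]; the value is the Laplace transform of a Gamma law of
    shape [n]. *)
Lemma integral_exp_nrm2 n d (T : measurableType d) (P : probability T R)
    (X : 'I_n * bool -> T -> R) (s : R) :
  gaussian_family P X -> 0 <= s ->
  (\int[P]_w (expR (- (s * nrm2 (cvec (X ^~ w)))))%:E = ((1 + s)^-1 ^+ n)%:E)%E.
Proof.
move=> GX s0; have s1 : 0 < 1 + s by lra.
have pQ : pos_def ((1 + s)%:C%C%:M : 'M[C]_n).
  split; first by rewrite adjmx_scalar conjc_real.
  by move=> x x0; rewrite qf_scalar mulr_gt0 ?qf1_gt0 // -[0]/(0%:C%C) ltcR.
rewrite -[RHS](_ : ((complex.Re (\det ((1 + s)%:C%C%:M : 'M[C]_n)))^-1)%:E = _); last first.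
  by rewrite det_scalar -rmorphXn /= exprVn.
rewrite -(gaussian_integral_exp_qf GX pQ); apply: eq_integral => w _.
have e : (1 + s)%:C%C - 1 = s%:C%C :> C.
  by apply/eqP; rewrite eq_complex /= subr0 eqxx andbT addrAC subrr add0r.
by rewrite -raddfB /= e qf_scalar ReZ.
Qed.

(** The form of [v v^H] at [z] is also the form of [z z^H] at [v], so this is the Gaussian integral
    for [Q = 1 + phi z z^H], whose determinant is [1 + phi |z|^2]. *)
Lemma integral_exp_rank1 n d (T : measurableType d) (P : probability T R)
    (X : 'I_n * bool -> T -> R) (z : 'cV[C]_n) (phi : R) :
  gaussian_family P X -> 0 <= phi ->
  (\int[P]_w (expR (- (phi * complex.Re
     (qf (cvec (X ^~ w) *m adjmx (cvec (X ^~ w))) z))))%:E =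
   ((1 + phi * nrm2 z)^-1)%:E)%E.
Proof.
move=> GX phi0; pose Q : 'M[C]_n := 1%:M + phi%:C%C *: (z *m adjmx z).
have pQ : pos_def Q.
  have := @pos_def1D_sum R n unit [:: tt] (fun=> phi) (fun=> z) (fun=> phi0).
  by rewrite big_seq1.
have dQ : complex.Re (\det Q) = 1 + phi * nrm2 z.
  rewrite /Q scalemxAl det_1D_rank1 -scalemxAr mxE.
  have -> : (adjmx z *m z) 0 0 = qf 1%:M z by rewrite /qf mulmx1.
  by rewrite qf1_real /=; ring.
rewrite -dQ -(gaussian_integral_exp_qf GX pQ); apply: eq_integral => w _.
rewrite /Q [1%:M + _]addrC addrK qfZ ReZ 2!qf_rank1.
set v := cvec _; have -> : (adjmx v *m z) 0 0 = conjc ((adjmx z *m v) 0 0).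
  have -> : adjmx v *m z = adjmx (adjmx z *m v) by rewrite adjmxM adjmxK.
  by rewrite !mxE.
by rewrite normcJ.
Qed.

Section fixed_family.
Variables (N K : nat) (d : measure_display) (T : measurableType d).
Variables (P : probability T R) (X : 'I_N * 'I_K * bool -> T -> R).
Hypothesis GX : gaussian_family P X.
Variable phi : 'I_K -> R.
Hypothesis phi0 : forall j, 0 <= phi j.

Let id_inj : injective (@id 'I_N). Proof. by []. Qed.

(** At a fixed [z] the exponent is a sum over independent columns; decoupling peels off one column
    and one factor at a time. *)
Lemma integral_exp_gram (z : 'cV[C]_N) (r : seq 'I_K) : uniq r ->
  (\int[P]_w (expR (- complex.Re (qf (gram id r phi (X ^~ w) - 1%:M) z)))%:E =
   (\prod_(j <- r) (1 + phi j * nrm2 z)^-1)%:E)%E.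
Proof.
elim: r => [|j r IH].
  move=> _; under eq_integral => w _.
    rewrite /gram big_nil addr0 subrr /qf mulmx0 mul0mx mxE oppr0 expR0; over.
  by rewrite integral_cst // [X in (_ * X)%E](@probability_setT _ _ _ P) mule1 big_nil.
move=> /= /andP[jr ur].
pose F (u : 'I_N * 'I_K * bool -> R) :=
  (expR (- complex.Re (qf (gram id (j :: r) phi u - 1%:M) z)))%:E.
have mF : measurable_family F.
  have mt i := @measurable_tuple_fun R ('I_N * 'I_K * bool)%type i.
  apply/measurable_EFinP; apply: measurableT_comp => //; apply: measurable_funN.
  apply: (cmeasurable_qf _ (mxmeasurable_cst z)).1.
  apply: mxmeasurableD; last exact: mxmeasurable_cst.
  exact: mxmeasurable_gram.
rewrite (indep_decouple (F := F) (fun i => i.1.2 != j) GX.1 mF); last first.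
  by move=> u; rewrite lee_fin expR_ge0.
pose v w := subcol id j (X ^~ w).
have FE w w' : F (fun i => if i.1.2 != j then X i w else X i w') =
    ((expR (- complex.Re (qf (gram id r phi (X ^~ w) - 1%:M) z)))%:E *
     (expR (- (phi j * complex.Re (qf (v w' *m adjmx (v w')) z))))%:E)%E.
  rewrite /F gram_cons.
  have -> : gram id r phi (fun i => if i.1.2 != j then X i w else X i w') =
      gram id r phi (X ^~ w).
    apply: eq_gram => i j' b j'r /=.
    by case: eqVneq => // e; rewrite -e j'r in jr.
  have -> : subcol id j (fun i => if i.1.2 != j then X i w else X i w') = v w'.
    by rewrite /v /subcol /= eqxx.
  rewrite -EFinM -expRD -ReZ.
  set A := gram _ _ _ _; set B := v w' *m _.
  have -> : qf (A + (phi j)%:C%C *: B - 1%:M) z =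
      qf (A - 1%:M) z + (phi j)%:C%C * qf B z by rewrite addrAC [LHS]qfD qfZ.
  by case: (qf (A - _) z) => ? ?; case: (_ * qf B z) => ? ? /=; rewrite opprD.
have Gj := gaussian_column j id_inj GX.
have mv : mxmeasurable v by apply: mxmeasurable_subcol => i; exact: GX.1.1.
have inner w : (\int[P]_w' F (fun i => if i.1.2 != j then X i w else X i w') =
    (expR (- complex.Re (qf (gram id r phi (X ^~ w) - 1%:M) z)))%:E *
    ((1 + phi j * nrm2 z)^-1)%:E)%E.
  under eq_integral => w' _ do rewrite FE.
  rewrite ge0_integralZl //; last first.
    apply/measurable_EFinP; apply: measurableT_comp => //; apply: measurable_funN.
    apply: measurable_funM => //.
    apply: (cmeasurable_qf _ (mxmeasurable_cst z)).1.
    by apply: mxmeasurableM => //; exact: mxmeasurable_adj.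
  by rewrite (integral_exp_rank1 z Gj).
rewrite big_cons mulrC EFinM -(IH ur).
under eq_integral => w _ do rewrite inner.
rewrite ge0_integralZr //.
- apply/measurable_EFinP; apply: measurableT_comp => //; apply: measurable_funN.
  apply: (cmeasurable_qf _ (mxmeasurable_cst z)).1.
  apply: mxmeasurableD; last exact: mxmeasurable_cst.
  by apply: mxmeasurable_gram => // i; exact: GX.1.1.
- by rewrite lee_fin invr_ge0 addr_ge0 // mulr_ge0 // nrm2_ge0.
Qed.

(* [1 / det] is a Gaussian integral over an auxiliary vector, for which an
   independent copy of the column [j0] is taken. *)
Lemma expected_inv_det_gram (j0 : 'I_K) (r : seq 'I_K) : uniq r ->
  (\int[P]_w ((complex.Re (\det (gram id r phi (X ^~ w))))^-1)%:E =
   \int[P]_w (\prod_(j <- r) (1 + phi j * nrm2 (subcol id j0 (X ^~ w)))^-1)%:E)%E.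
Proof.
move=> ur; have G0 := gaussian_column j0 id_inj GX.
pose H (z : T * T) : \bar R := (expR (- complex.Re
  (qf (gram id r phi (X ^~ z.1) - 1%:M) (subcol id j0 (X ^~ z.2)))))%:E.
have mX1 i : measurable_fun setT (fun z : T * T => X i z.1).
  by apply: measurableT_comp => //; exact: GX.1.1.
have mX2 i : measurable_fun setT (fun z : T * T => X i z.2).
  by apply: measurableT_comp => //; exact: GX.1.1.
have mH : measurable_fun setT H.
  apply/measurable_EFinP; apply: measurableT_comp => //; apply: measurable_funN.
  apply: (cmeasurable_qf _ _).1; last exact: mxmeasurable_subcol.
  by apply: mxmeasurableD; [exact: mxmeasurable_gram|exact: mxmeasurable_cst].
transitivity (\int[P]_w \int[P]_w' H (w, w'))%E.
  by apply: eq_integral => w _; rewrite -(gaussian_integral_exp_qf G0) //; exact: pos_def_gram.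
rewrite (@fubini_tonelli _ _ _ _ _ P P H) //; last first.
  by move=> z; rewrite lee_fin expR_ge0.
apply: eq_integral => w' _; rewrite -(integral_exp_gram (subcol id j0 (X ^~ w')) ur).
exact: eq_integral.
Qed.

End fixed_family.

(** The mean depends only on the law of the squared norm of a column, whose Laplace transform
    [(1 + s)^-(n+1)] is also that of the density [x^n e^-x / n!]; [laplace_damping] exchanges the
    two. *)
Lemma expected_inv_det_gram_gamma n K d (T : measurableType d) (P : probability T R)
    (X : 'I_n.+1 * 'I_K * bool -> T -> R) (phi : 'I_K -> R) (r : seq 'I_K) (j0 : 'I_K) :
  gaussian_family P X -> (forall j, 0 <= phi j) -> uniq r ->
  (\int[P]_w ((complex.Re (\det (gram id r phi (X ^~ w))))^-1)%:E =
   \int[lebesgue_measure]_(x in `[0%R, +oo[)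
     (n`!%:R^-1 * (x ^+ n * expR (- x)) * \prod_(j <- r) (1 + phi j * x)^-1)%:E)%E.
Proof.
move=> GX phi0 ur; rewrite (expected_inv_det_gram GX phi0 j0 ur).
have G0 := gaussian_column j0 (@inj_id 'I_n.+1) GX.
(* Every coefficient occurs twice, so that two inverse square roots combine into
   [(1 + phi j * x)^-1]. *)
pose c := [seq phi j | j <- r ++ r].
have dampE (x : R) : 0 <= x -> damping c x = \prod_(j <- r) (1 + phi j * x)^-1.
  move=> x0; rewrite /damping /c big_map big_cat /= -expr2 -prodrXl.
  by apply: eq_bigr => j _; rewrite exprVn sqr_sqrtr // addr_ge0 // mulr_ge0.
have c0 a : a \in c -> 0 <= a by move=> /mapP[j _ ->].
(* The density is extended by zero and the variable clipped at zero, because [laplace_damping] works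
   on a whole space with nonnegative [g] and [rho]. *)
pose g (x : R) : R := if 0 <= x then n`!%:R^-1 * (x ^+ n * expR (- x)) else 0.
have g0 x : 0 <= g x.
  rewrite /g; case: ifP => // x0.
  by rewrite mulr_ge0 ?invr_ge0 // mulr_ge0 ?expR_ge0 // exprn_ge0.
pose rho (x : R) := Num.max 0 x.
have rho0 x : 0 <= rho x by rewrite le_max lexx.
have mrho : measurable_fun setT rho by exact: measurable_maxr.
have mg : measurable_fun setT g.
  apply: measurable_fun_ifT => //; first exact: measurable_fun_ler.
  apply: measurable_funM => //; apply: measurable_funM => //.
  by apply: measurableT_comp.
have restr (h : R -> R) : (\int[lebesgue_measure]_x (g x * h (rho x))%:E =
   \int[lebesgue_measure]_(x in `[0%R, +oo[) (n`!%:R^-1 * (x ^+ n * expR (- x)) * h x)%:E)%E.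
  rewrite [RHS]integral_mkcond; apply: eq_integral => x _.
  rewrite patchE mem_setE in_itv /= andbT /g /rho; case: ifP => x0; last by rewrite mul0r.
  by rewrite (max_idPr x0).
pose nr w := nrm2 (subcol id j0 (X ^~ w)).
have mnr : measurable_fun setT nr.
  apply: (cmeasurable_qf (mxmeasurable_cst _) _).1.
  by apply: mxmeasurable_subcol => i; exact: GX.1.1.
have nr0 w : 0 <= nr w by exact: nrm2_ge0.
have L (s : R) : 0 <= s -> (\int[P]_w (1 * expR (- (s * nr w)))%:E =
    \int[lebesgue_measure]_x (g x * expR (- (s * rho x)))%:E)%E.
  move=> s0; rewrite (restr (fun x => expR (- (s * x)))).
  under eq_integral => w _ do rewrite mul1r.
  rewrite (integral_exp_nrm2 G0 s0) -gamma_integral; last by lra.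
  apply: eq_integral => x _; rewrite -!mulrA -expRD; congr (_ * (_ * expR _))%:E; ring.
have := @laplace_damping R _ _ T (measurableTypeR R) P lebesgue_measure (fun=> 1) nr g rho
  (fun=> ler01) nr0 (measurable_cst _) mnr g0 rho0 mg mrho L c c0 0 (lexx 0).
under eq_integral => w _ do rewrite mul0r oppr0 expR0 !mul1r dampE //.
move=> ->; rewrite -(restr (fun x => \prod_(j <- r) (1 + phi j * x)^-1)).
by apply: eq_integral => x _; rewrite mul0r oppr0 expR0 mulr1 dampE.
Qed.

End inverse_determinant.

Lemma le_integral_ge0_in d (T : measurableType d) (R : realType)
    (mu : {measure set T -> \bar R}) (D : set T) (f g : T -> \bar R) :
  (forall x, D x -> 0 <= f x)%E -> (forall x, D x -> f x <= g x)%E ->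
  (\int[mu]_(x in D) f x <= \int[mu]_(x in D) g x)%E.
Proof.
move=> f0 fg; rewrite !(integral_mkcond D); apply: le_integral_ge0 => x.
  by rewrite patchE; case: ifPn => // /set_mem; exact: f0.
by rewrite !patchE; case: ifPn => // /set_mem; exact: fg.
Qed.

(** * Two-sided bounds for the mean logarithm of the determinant *)

Section log_determinant.
Context {R : realType}.
Local Notation C := R[i].

Lemma ln_le_Bl (x : R) : 0 < x -> ln x <= x - 1.
Proof.
move=> x0; have := expR_ge1Dx (ln x); rewrite lnK ?posrE //; lra.
Qed.

Lemma ln_prod (J : Type) (r : seq J) (f : J -> R) : (forall j, 0 < f j) ->
  ln (\prod_(j <- r) f j) = \sum_(j <- r) ln (f j).
Proof.
move=> f0; elim: r => [|j r IH]; first by rewrite !big_nil ln1.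
by rewrite !big_cons lnM ?posrE ?prodr_gt0 // IH.
Qed.

(** Stirling up to a logarithm: the induction step is [ln (b / a) <= b / a - 1] for consecutive
    integers [b] and [a]. *)
Lemma ln_fact_le n : ln (n.+1`!%:R : R) <= 1 + ln n.+1%:R + n.+1%:R * ln n.+1%:R - n.+1%:R.
Proof.
elim: n => [|n IH]; first by rewrite (_ : 1`! = 1)%N // ln1; lra.
rewrite factS natrM lnM ?posrE ?ltr0n ?fact_gt0 //.
set a := n.+2%:R; set b := n.+1%:R : R in IH *.
have b0 : 0 < b by rewrite ltr0n.
have ab : a = b + 1 :> R by rewrite /a -natr1.
have a0 : 0 < a by rewrite ltr0n.
have : ln (b / a) <= b / a - 1 by apply: ln_le_Bl; rewrite divr_gt0.
rewrite ln_div ?posrE // => h.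
have {}h : a * (ln b - ln a) <= a * (b / a - 1) by rewrite ler_pM2l.
have e : a * (b / a - 1) = -1.
  by rewrite mulrBr mulr1 mulrCA divff ?gt_eqF // mulr1 ab; lra.
by rewrite e in h; rewrite ab in h *; lra.
Qed.

(** One term of the exponential series gives [N^N / N! <= e^N]. *)
Lemma ln_fact_ge n : n.+1%:R * ln n.+1%:R - n.+1%:R <= ln (n.+1`!%:R : R).
Proof.
have F0 : 0 < n.+1`!%:R :> R by rewrite ltr0n fact_gt0.
have N0 : 0 < n.+1%:R :> R by rewrite ltr0n.
have := @expR_ge1Dxn R n.+1%:R n (ltW N0) => h.
have : n.+1%:R ^+ n.+1 / n.+1`!%:R <= expR n.+1%:R :> R by apply: le_trans h; rewrite lerDr.
have P0 : 0 < n.+1%:R ^+ n.+1 :> R by rewrite exprn_gt0.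
rewrite -ler_ln ?posrE ?expR_gt0 ?divr_gt0 // expRK ln_div ?posrE // lnXn // -[ln _ *+ _]mulr_natl.
lra.
Qed.

(** A new column raises the determinant by [phi j] times the form of the adjugate at [v]; for
    [v = A y] this form is [det A] times [qf A y], hence nonnegative. The bound makes [ln D] a
    nonnegative integrand. *)
Lemma det_gram_ge1 N K n (f : 'I_n -> 'I_N) (r : seq 'I_K) (phi : 'I_K -> R) u :
  (forall j, 0 <= phi j) -> 1 <= \det (gram f r phi u).
Proof.
move=> phi0; elim: r => [|j r IH]; first by rewrite /gram big_nil addr0 det1.
have [hA pA] := pos_def_gram f r u phi0; set A := gram f r phi u in IH hA pA *.
have d0 : 0 < \det A by exact: lt_le_trans IH.
have dn0 : \det A != 0 by rewrite gt_eqF.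
rewrite gram_cons -/A det_D_rank1 //; apply: (le_trans IH); rewrite lerDl.
set v := subcol f j u; have uA : A \in unitmx by rewrite unitmxE unitfE.
rewrite mulr_ge0 ?ler0c // -(mulKVmx uA v); set y := invmx A *m v.
have -> : qf (\adj A) (A *m y) = \det A * qf A y.
  rewrite /qf adjmxM hA -!mulmxA (mulmxA (\adj A)) mul_adj_mx mul_scalar_mx.
  by rewrite -!scalemxAr mxE.
rewrite mulr_ge0 ?(ltW d0) //; have [->|y0] := eqVneq y 0; last exact/ltW/pA.
by rewrite /qf mulmx0 mxE.
Qed.

Lemma Re_det_gram_ge1 N K n (f : 'I_n -> 'I_N) (r : seq 'I_K) (phi : 'I_K -> R) u :
  (forall j, 0 <= phi j) -> 1 <= complex.Re (\det (gram f r phi u)).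
Proof.
move=> phi0; have := det_gram_ge1 f r u phi0.
by case: (\det _) => a b; rewrite lecE /= => /andP[].
Qed.

Section fixed_family.
Variables (n K : nat) (d : measure_display) (T : measurableType d).
Variables (P : probability T R) (X : 'I_n.+1 * 'I_K * bool -> T -> R).
Hypothesis GX : gaussian_family P X.
Variable phi : 'I_K -> R.
Hypothesis phi0 : forall j, 0 <= phi j.

Local Notation N := (n.+1%:R : R).
Let D w := complex.Re (\det (gram id (index_enum 'I_K) phi (X ^~ w))).

Let D1 w : 1 <= D w. Proof. exact: Re_det_gram_ge1. Qed.
Let D0 w : 0 < D w. Proof. exact: lt_le_trans (D1 w). Qed.
Let mD : measurable_fun setT D.
Proof. by apply: measurable_det_gram => // i; exact: GX.1.1. Qed.
Let mlnD : measurable_fun setT (fun w => ln (D w)).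
Proof. by apply: measurableT_comp => //; exact: measurable_ln. Qed.
Let lnD0 w : 0 <= ln (D w). Proof. exact: ln_ge0. Qed.

Let integral_cstP (c : R) : (\int[P]_w c%:E = c%:E)%E.
Proof.
by rewrite integral_cst // [X in (_ * X)%E](@probability_setT _ _ _ P) mule1.
Qed.

(** Jensen as the tangent of [ln] at the bound [Z] for [E D], where the free parameter is
    [al = N x]; [ln_fact_le] then absorbs [N!]. The extra [1] on both sides keeps all integrands
    nonnegative. *)
Lemma expected_ln_det_le (x : R) : 0 < x ->
  (\int[P]_w (ln (D w))%:E <=
   (\sum_j ln (1 + N * phi j * x) + N * (x - 1 - ln x) + (1 + ln N))%:E)%E.
Proof.
move=> x0; have N0 : 0 < N by rewrite ltr0n.
pose al := N * x; have al0 : 0 < al by rewrite mulr_gt0.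
pose Z := n.+1`!%:R / al ^+ n.+1 * expR al * \prod_j (1 + phi j * al).
have EZ : (\int[P]_w (D w)%:E <= Z%:E)%E.
  by apply: expected_det_gram_le => //; exact: index_enum_uniq.
have Z1 : 1 <= Z.
  rewrite -lee_fin -(integral_cstP 1); apply: le_trans EZ.
  by apply: le_integral_ge0 => w; rewrite lee_fin.
have Z0 : 0 < Z by exact: lt_le_trans Z1.
have : (\int[P]_w (ln (D w))%:E + 1%:E <= (ln Z + 1)%:E)%E.
  rewrite -{1}(integral_cstP 1) -ge0_integralD //; last 2 first.
  - by move=> w _; rewrite lee_fin.
  - exact/measurable_EFinP.
  apply: (@le_trans _ _ (\int[P]_w ((ln Z)%:E + (Z^-1)%:E * (D w)%:E))%E).
    apply: le_integral_ge0 => w; first by rewrite -EFinD lee_fin addr_ge0.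
    rewrite -EFinM -!EFinD lee_fin.
    have := @ln_le_Bl (Z^-1 * D w); rewrite lnM ?posrE ?invr_gt0 // lnV ?posrE //.
    by rewrite mulr_gt0 ?invr_gt0 // => /(_ isT); lra.
  rewrite ge0_integralD //; last 3 first.
  - by move=> w _; rewrite lee_fin ln_ge0.
  - by move=> w _; rewrite -EFinM lee_fin mulr_ge0 ?invr_ge0 // ltW.
  - apply/measurable_EFinP; exact: measurable_funM.
  rewrite integral_cstP EFinD leeD2l // ge0_integralZl //; last 3 first.
  - exact/measurable_EFinP.
  - by move=> w _; rewrite lee_fin ltW.
  - by rewrite lee_fin invr_ge0 ltW.
  apply: (le_trans (lee_wpmul2l _ EZ)); first by rewrite lee_fin invr_ge0 ltW.
  by rewrite -EFinM mulVf // gt_eqF.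
rewrite EFinD leeD2rE // => /le_trans; apply; rewrite lee_fin.
have F0 : 0 < n.+1`!%:R :> R by rewrite ltr0n fact_gt0.
have A0 : 0 < al ^+ n.+1 by rewrite exprn_gt0.
have p0 j : 0 < 1 + phi j * al by rewrite ltr_pwDl // mulr_ge0 // ltW.
have Pr0 : 0 < \prod_j (1 + phi j * al) by apply: prodr_gt0 => j _; exact: p0.
have a1 : 0 < n.+1`!%:R / al ^+ n.+1 by rewrite divr_gt0.
have a2 := expR_gt0 al; have a3 := mulr_gt0 a1 a2.
rewrite /Z lnM ?posrE // lnM ?posrE // expRK ln_div ?posrE // lnXn // -[ln _ *+ _]mulr_natl.
have -> : ln (\prod_j (1 + phi j * al)) = \sum_j ln (1 + N * phi j * x).
  by rewrite ln_prod //; apply: eq_bigr => j _; rewrite /al mulrA [phi j * _]mulrC.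
have := ln_fact_le n; rewrite /al lnM ?posrE //; lra.
Qed.

(** In the Gamma integral at [x = N y] the exponent contains [n ln y - N y]. There [n] units of
    [- N y] join the [n] logarithms and are bounded through [m]; the last unit [- y = - x / N] keeps
    the majorant integrable, with integral [N]. Hence [n * m] where [N * m] might be expected. *)
Lemma expected_ln_det_ge (m : R) (j0 : 'I_K) :
  (forall x, 0 < x -> m <= x - 1 - ln x + N^-1 * \sum_j ln (1 + N * phi j * x)) ->
  ((n%:R * m - 1 - ln N)%:E <= \int[P]_w (ln (D w))%:E)%E.
Proof.
move=> mle; have N0 : 0 < N by rewrite ltr0n.
pose W := N * (n`!%:R^-1 * expR (n%:R * ln N + 1 - N - n%:R * m)).
have F0 : 0 < n`!%:R :> R by rewrite ltr0n fact_gt0.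
have W0 : 0 < W by rewrite !mulr_gt0 ?invr_gt0 ?expR_gt0.
have EW : (\int[P]_w ((D w)^-1)%:E <= W%:E)%E.
  rewrite (expected_inv_det_gram_gamma j0 GX phi0 (index_enum_uniq _)).
  have -> : W%:E = (\int[lebesgue_measure]_(x in `[0%R, +oo[)
      ((n`!%:R^-1 * expR (n%:R * ln N + 1 - N - n%:R * m))%:E *
       (0`!%:R^-1 * (x ^+ 0 * expR (- (N^-1 * x))))%:E))%E.
    rewrite ge0_integralZl //.
    - by rewrite gamma_integral ?invr_gt0 // invrK expr1 -EFinM mulrC.
    - apply/measurable_EFinP; apply: measurable_funTS; apply: measurable_funM => //.
      apply: measurable_funM => //; apply: measurableT_comp => //.
      by apply: measurable_funN; exact: measurable_funM.
    - by move=> x _; rewrite fact0 invr1 !mul1r lee_fin expR_ge0.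
  have pr0 x : 0 <= x -> 0 < \prod_j (1 + phi j * x).
    by move=> x0; apply: prodr_gt0 => j _; rewrite ltr_pwDl // mulr_ge0.
  apply: le_integral_ge0_in => x /=; rewrite in_itv /= andbT => x0.
    rewrite lee_fin mulr_ge0 //; last by rewrite prodfV invr_ge0 ltW ?pr0.
    by rewrite mulr_ge0 ?invr_ge0 ?(ltW F0) // mulr_ge0 ?expR_ge0 // exprn_ge0.
  rewrite fact0 invr1 !mul1r -EFinM lee_fin prodfV -!mulrA ler_pM2l ?invr_gt0 //.
  have [{}x0|] := ltP 0 x; last first.
    (* At [x = 0] logarithms cannot be used: [x ^+ n] is [1] for [n = 0], where the bound is an
       equality, and [0] otherwise. *)
    move=> x0'; have -> : x = 0 by apply/eqP; rewrite eq_le x0 x0'.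
    case: (n) => [|n'].
      have -> : 0%:R * ln 1%:R + 1 - 1%:R - 0%:R * m = 0.
        by rewrite !mul0r add0r subrr subr0.
      rewrite mulr0 oppr0 expR0 expr0 !mul1r big1 ?invr1 // => j _.
      by rewrite mulr0 addr0.
    by rewrite expr0n mul0r mulr_ge0 ?expR_ge0.
  pose y := N^-1 * x; have y0 : 0 < y by rewrite mulr_gt0 ?invr_gt0.
  have xy : x = N * y by rewrite /y mulVKf // gt_eqF.
  pose S := \sum_j ln (1 + phi j * x).
  have S0 : 0 <= S by apply: sumr_ge0 => j _; rewrite ln_ge0 // lerDl mulr_ge0 // ltW.
  have my := mle y y0.
  have SE : \sum_j ln (1 + N * phi j * y) = S.
    by apply: eq_bigr => j _; rewrite xy mulrA [phi j * N]mulrC.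
  rewrite SE in my.
  have P1 : 0 < x ^+ n by rewrite exprn_gt0.
  have P2 : 0 < (\prod_j (1 + phi j * x))^-1 by rewrite invr_gt0 pr0 ?ltW.
  have P3 := expR_gt0 (- x); have P4 := mulr_gt0 P3 P2.
  rewrite -ler_ln ?posrE ?(mulr_gt0 P1 P4) ?mulr_gt0 ?expR_gt0 //.
  rewrite lnM ?posrE // lnM ?posrE // lnM ?posrE ?expR_gt0 // !expRK.
  rewrite lnXn // -[ln _ *+ _]mulr_natl lnV ?posrE ?pr0 ?(ltW x0) // ln_prod; last first.
    by move=> j; rewrite ltr_pwDl // mulr_ge0 // ltW.
  rewrite -/S -/y {1}xy lnM ?posrE //.
  have nm : n%:R * m <= n%:R * (y - 1 - ln y) + S.
    apply: (le_trans (ler_wpM2l _ my)) => //.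
    rewrite mulrDr lerD2l mulrA ler_piMl // ler_pdivrMr // mul1r ler_nat.
    exact: leqnSn.
  have e : n%:R + 1 = N by rewrite natr1.
  have e2 : x = n%:R * y + y by rewrite xy -e; ring.
  lra.
have : ((1 - ln W)%:E <= \int[P]_w (ln (D w))%:E + 1%:E)%E.
  apply: (@le_trans _ _ (\int[P]_w ((ln (D w))%:E + (W^-1)%:E * ((D w)^-1)%:E))%E).
    (* A nonpositive left side is settled by the sign of the right side; what remains compares
       nonnegative functions. *)
    have [h|/ltW h] := leP (1 - ln W) 0.
      apply: (@le_trans _ _ 0%E); first by rewrite lee_fin.
      apply: integral_ge0 => w _; rewrite -EFinM -EFinD lee_fin addr_ge0 //.
      by rewrite mulr_ge0 ?invr_ge0 // ltW.
    rewrite -(integral_cstP (1 - ln W)); apply: le_integral_ge0 => w.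
      by rewrite lee_fin.
    rewrite -EFinM -EFinD lee_fin.
    have := @ln_le_Bl (W^-1 * (D w)^-1); rewrite lnM ?posrE ?invr_gt0 // !lnV ?posrE //.
    by rewrite mulr_gt0 ?invr_gt0 // => /(_ isT); lra.
  have mDV : measurable_fun setT (fun w => (D w)^-1).
    rewrite (_ : (fun w => _) = fun w => expR (- ln (D w))).
      by apply: measurableT_comp => //; exact: measurable_funN.
    by apply/funext => w; rewrite expRN lnK // posrE.
  rewrite ge0_integralD //; last 4 first.
  - by move=> w _; rewrite lee_fin.
  - exact/measurable_EFinP.
  - by move=> w _; rewrite -EFinM lee_fin mulr_ge0 ?invr_ge0 // ltW.
  - apply/measurable_EFinP; exact: measurable_funM.
  rewrite leeD2l // ge0_integralZl //; last 3 first.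
  - exact/measurable_EFinP.
  - by move=> w _; rewrite lee_fin invr_ge0 ltW.
  - by rewrite lee_fin invr_ge0 ltW.
  apply: (le_trans (lee_wpmul2l _ EW)); first by rewrite lee_fin invr_ge0 ltW.
  by rewrite -EFinM mulVf // gt_eqF.
have lW : n%:R * m - 1 - ln N <= - ln W.
  have a1 : 0 < n`!%:R^-1 :> R by rewrite invr_gt0.
  have a2 := expR_gt0 (n%:R * ln N + 1 - N - n%:R * m).
  rewrite /W lnM ?posrE ?(mulr_gt0 a1 a2) // lnM ?posrE // lnV ?posrE // expRK.
  have := ln_fact_ge n; rewrite factS natrM lnM ?posrE //.
  have : n%:R + 1 = N by rewrite natr1.
  move=> <-; lra.
rewrite -leeBlDr // -EFinB => h; apply: le_trans h; rewrite lee_fin.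
lra.
Qed.

End fixed_family.
End log_determinant.

Section nonneg_integrals.
Context {R : realType} d (T : measurableType d) (mu : {measure set T -> \bar R}).
Implicit Types f g : T -> R.

Lemma integralZ_nneg (k : R) f : 0 <= k -> measurable_fun setT f ->
  (forall x, 0 <= f x) -> (\int[mu]_x (k * f x)%:E = k%:E * \int[mu]_x (f x)%:E)%E.
Proof.
move=> k0 mf f0; rewrite -ge0_integralZl_EFin //.
- by move=> x _; rewrite lee_fin.
- exact/measurable_EFinP.
Qed.

Lemma integralD_nneg f g : measurable_fun setT f -> measurable_fun setT g ->
  (forall x, 0 <= f x) -> (forall x, 0 <= g x) ->
  (\int[mu]_x (f x + g x)%:E = \int[mu]_x (f x)%:E + \int[mu]_x (g x)%:E)%E.
Proof.
move=> mf mg f0 g0; rewrite -ge0_integralD //.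
- by move=> x _; rewrite lee_fin.
- exact/measurable_EFinP.
- by move=> x _; rewrite lee_fin.
- exact/measurable_EFinP.
Qed.

Lemma integral_sum_nneg (J : Type) (r : seq J) (f : J -> T -> R) :
  (forall j, measurable_fun setT (f j)) -> (forall j x, 0 <= f j x) ->
  (\int[mu]_x (\sum_(j <- r) f j x)%:E = \sum_(j <- r) \int[mu]_x (f j x)%:E)%E.
Proof.
move=> mf f0; rewrite -ge0_integral_sum //.
- by apply: eq_integral => x _; rewrite sumEFin.
- by move=> j; exact/measurable_EFinP.
- by move=> j x _; rewrite lee_fin.
Qed.

End nonneg_integrals.

(** * Second moments of empirical means *)

Section weak_law.
Context {R : realType} d (T : measurableType d) (P : probability T R).

Lemma integral_prob_cst (c : R) : (\int[P]_w c%:E = c%:E)%E.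
Proof.
by rewrite integral_cst // [X in (_ * X)%E](@probability_setT _ _ _ P) mule1.
Qed.

(* With [S] the sum, [(S - K m)^2 + 2 K m S = S^2 + (K m)^2] only involves
   nonnegative functions. *)
Lemma integral_mean_sqr_le (K : nat) (W : 'I_K -> T -> R) (B m : R) : (0 < K)%N ->
  (forall j, measurable_fun setT (W j)) -> (forall j w, 0 <= W j w <= B) ->
  (forall j, \int[P]_w (W j w)%:E = m%:E)%E ->
  (forall j j', j != j' -> \int[P]_w (W j w * W j' w)%:E = (m ^+ 2)%:E)%E ->
  (\int[P]_w ((K%:R^-1 * \sum_j W j w - m) ^+ 2)%:E <= (B ^+ 2 / K%:R)%:E)%E.
Proof.
move=> K0 mW WB Wm Wmm; have k0 : 0 < K%:R :> R by rewrite ltr0n.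
have W0 j w : 0 <= W j w by have /andP[] := WB j w.
have m0 : 0 <= m.
  by rewrite -lee_fin -(Wm (Ordinal K0)); apply: integral_ge0 => w _; rewrite lee_fin.
pose S w := \sum_j W j w.
have S0 w : 0 <= S w by apply: sumr_ge0.
have mS : measurable_fun setT S by exact: measurable_sum.
have ES : (\int[P]_w (S w)%:E = (K%:R * m)%:E)%E.
  rewrite integral_sum_nneg //.
  by under eq_bigr => j _ do rewrite Wm; rewrite sumEFin sumr_const card_ord -[m *+ K]mulr_natl.
have mWW j j' : measurable_fun setT (fun w => W j w * W j' w) by exact: measurable_funM.
have WW0 j j' w : 0 <= W j w * W j' w by rewrite mulr_ge0.
have ESS : (\int[P]_w (S w ^+ 2)%:E <= (K%:R * B ^+ 2 + K%:R ^+ 2 * m ^+ 2)%:E)%E.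
  have -> : (\int[P]_w (S w ^+ 2)%:E =
      \sum_j \sum_j' \int[P]_w (W j w * W j' w)%:E)%E.
    transitivity (\int[P]_w (\sum_j \sum_j' (W j w * W j' w))%:E)%E.
      apply: eq_integral => w _; rewrite expr2 /S mulr_suml; congr EFin.
      by apply: eq_bigr => j _; rewrite mulr_sumr.
    rewrite integral_sum_nneg.
    - by apply: eq_bigr => j _; rewrite integral_sum_nneg.
    - by move=> j; exact: measurable_sum.
    - by move=> j w; exact: sumr_ge0.
  apply: (@le_trans _ _ (\sum_(j < K) (B ^+ 2 + K%:R * m ^+ 2)%:E)%E).
    apply: lee_sum => j _; rewrite (bigD1 j) //= EFinD; apply: leeD.
      rewrite -(integral_prob_cst (B ^+ 2)); apply: le_integral_ge0 => w.
        by rewrite lee_fin mulr_ge0.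
      by have /andP[? ?] := WB j w; rewrite lee_fin expr2 ler_pM.
    apply: (@le_trans _ _ (\sum_(j' < K | j' != j) (m ^+ 2)%:E)%E).
      by apply: lee_sum => j' jj'; rewrite Wmm // eq_sym.
    rewrite sumEFin lee_fin sumr_const -[m ^+ 2 *+ _]mulr_natl ler_wpM2r ?sqr_ge0 // ler_nat.
    by rewrite -[leqRHS]card_ord; exact: max_card.
  rewrite sumEFin lee_fin sumr_const card_ord -[(_ + _) *+ K]mulr_natl mulrDr.
  by rewrite lerD2l mulrA -expr2.
have key : (\int[P]_w ((S w - K%:R * m) ^+ 2)%:E <= (K%:R * B ^+ 2)%:E)%E.
  have : (\int[P]_w ((S w - K%:R * m) ^+ 2)%:E + (2 * K%:R * m)%:E * (K%:R * m)%:E <=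
      (K%:R * B ^+ 2 + K%:R ^+ 2 * m ^+ 2)%:E + (K%:R ^+ 2 * m ^+ 2)%:E)%E.
    have c0 : 0 <= 2 * K%:R * m by rewrite mulr_ge0 // mulr_ge0.
    have cS0 w : 0 <= 2 * K%:R * m * S w by rewrite mulr_ge0.
    have q0 w : 0 <= (S w - K%:R * m) ^+ 2 by exact: sqr_ge0.
    have mq : measurable_fun setT (fun w => (S w - K%:R * m) ^+ 2).
      by apply: measurable_funX; exact: measurable_funB.
    have mcS : measurable_fun setT (fun w => 2 * K%:R * m * S w) by exact: measurable_funM.
    have mS2 : measurable_fun setT (fun w => S w ^+ 2) by exact: measurable_funX.
    rewrite -ES -integralZ_nneg // -integralD_nneg //.
    rewrite -[X in (_ <= _ + X)%E]integral_prob_cst.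
    have -> : (\int[P]_w ((S w - K%:R * m) ^+ 2 + 2 * K%:R * m * S w)%:E =
        \int[P]_w (S w ^+ 2 + K%:R ^+ 2 * m ^+ 2)%:E)%E.
      by apply: eq_integral => w _; congr EFin; ring.
    rewrite integralD_nneg //; first by rewrite leeD2r.
    - by move=> w; exact: sqr_ge0.
    - by move=> w; rewrite mulr_ge0 ?sqr_ge0.
  rewrite -EFinM -leeBrDr // => /le_trans; apply.
  rewrite -!EFinD lee_fin.
  lra.
have -> : (\int[P]_w ((K%:R^-1 * \sum_j W j w - m) ^+ 2)%:E =
    ((K%:R ^+ 2)^-1)%:E * \int[P]_w ((S w - K%:R * m) ^+ 2)%:E)%E.
  rewrite -integralZ_nneg ?invr_ge0 ?sqr_ge0 //.
  - apply: eq_integral => w _; rewrite -/(S w); congr EFin; field.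
    by rewrite gt_eqF.
  - by apply: measurable_funX; exact: measurable_funB.
  - by move=> w; exact: sqr_ge0.
apply: (le_trans (lee_wpmul2l _ key)); first by rewrite lee_fin invr_ge0 sqr_ge0.
rewrite -EFinM lee_fin le_eqVlt; apply/orP; left; apply/eqP; field.
by rewrite gt_eqF.
Qed.

Section iid_rows.
Context d0 (T0 : measurableType d0) (P0 : probability T0 R) (L K : nat).
Variables (X : 'I_L * 'I_K -> T -> R) (e : 'I_L -> T0 -> R).
Hypothesis iX : mutually_independent P X.
Hypothesis ie : mutually_independent P0 e.
Hypothesis Xe : forall l j B, measurable B -> P (X (l, j) @^-1` B) = P0 (e l @^-1` B).

Lemma integral_row (psi : ('I_L -> R) -> \bar R) j :
  measurable_family psi -> (forall x, 0 <= psi x)%E ->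
  (\int[P]_w psi (fun l => X (l, j) w) = \int[P0]_w psi (e ^~ w))%E.
Proof.
move=> mpsi psi0; apply: (indep_integral_eq (X := fun l => X (l, j))) => //.
- by apply: (mutually_independent_inj (f := fun l => (l, j))) => // l l' [].
- by move=> l B; exact: Xe.
Qed.

(** Distinct [j] involve disjoint coordinates, so decoupling those with second index [j] factors the
    mixed moments. *)
Lemma integral_row_mean_sqr_le (psi : ('I_L -> R) -> R) (B m : R) : (0 < K)%N ->
  measurable_family psi -> (forall x, 0 <= psi x <= B) ->
  (\int[P0]_w (psi (e ^~ w))%:E = m%:E)%E ->
  (\int[P]_w ((K%:R^-1 * \sum_j psi (fun l => X (l, j) w) - m) ^+ 2)%:E <=
   (B ^+ 2 / K%:R)%:E)%E.
Proof.
move=> K0 mpsi psiB psim.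
have psi0 x : 0 <= psi x by have /andP[] := psiB x.
have mpsiE : measurable_family (fun x => (psi x)%:E) by exact/measurable_EFinP.
have mrow d1 (T1 : measurableType d1) (Z : T1 -> 'I_L -> R) :
    (forall l, measurable_fun setT (Z ^~ l)) -> measurable_fun setT (fun w => psi (Z w)).
  by move=> mZ; exact: (measurable_comp_family mpsi).
have Erow j : (\int[P]_w (psi (fun l => X (l, j) w))%:E = m%:E)%E.
  by rewrite (integral_row (psi := fun x => (psi x)%:E)) // => x; rewrite lee_fin.
apply: integral_mean_sqr_le => // [j|j j' jj'].
  by apply: mrow => l; exact: iX.1.
pose F (u : 'I_L * 'I_K -> R) := (psi (fun l => u (l, j)) * psi (fun l => u (l, j')))%:E.
have mF : measurable_family F.
  by apply/measurable_EFinP; apply: measurable_funM; apply: mrow => l; exact: measurable_tuple_fun.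
rewrite (indep_decouple (F := F) (fun i => i.2 == j) iX mF); last first.
  by move=> u; rewrite lee_fin mulr_ge0.
have mrowX j1 : measurable_fun setT (fun w => psi (fun l => X (l, j1) w)).
  by apply: mrow => l; exact: iX.1.
have m0 : 0 <= m.
  by rewrite -lee_fin -(Erow j); apply: integral_ge0 => w _; rewrite lee_fin.
transitivity (\int[P]_w (m * psi (fun l => X (l, j) w))%:E)%E.
  apply: eq_integral => w _; rewrite mulrC EFinM -(Erow j') -integralZ_nneg //.
  by apply: eq_integral => w' _; rewrite /F /= eqxx eq_sym (negbTE jj').
by rewrite integralZ_nneg // Erow -EFinM -expr2.
Qed.

End iid_rows.
End weak_law.

(** * The variational problem *)

Section free_energy.
Context {R : realType}.

(* [ln (1 + a x)] is convex in [ln x]; this is its tangent at [eta]. *)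
Lemma ln1D_tangent (a eta x : R) : 0 <= a -> 0 < eta -> 0 < x ->
  ln (1 + a * eta) + a * eta / (1 + a * eta) * (ln x - ln eta) <= ln (1 + a * x).
Proof.
move=> a0 e0 x0; have ae0 : 0 <= a * eta by rewrite mulr_ge0 // ltW.
have ax0 : 0 <= a * x by rewrite mulr_ge0 // ltW.
have d0 : 0 < 1 + a * eta by lra.
pose p := a * eta / (1 + a * eta); pose t := ln x - ln eta.
have p0 : 0 <= p by rewrite divr_ge0 // ltW.
have p1 : 0 <= 1 - p.
  have -> : 1 - p = (1 + a * eta)^-1 by rewrite /p; field; rewrite gt_eqF.
  by rewrite invr_ge0 ltW.
have et : expR t = x / eta by rewrite /t expRB !lnK ?posrE.
have h1 : 1 - p * t <= expR (- (p * t)) by have := expR_ge1Dx (- (p * t)).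
have h2 : 1 + (1 - p) * t <= expR ((1 - p) * t) by exact: expR_ge1Dx.
have h3 : 1 <= (1 - p) * expR (- (p * t)) + p * expR ((1 - p) * t).
  have := ler_wpM2l p1 h1; have := ler_wpM2l p0 h2; lra.
(* The weighted arithmetic-geometric inequality [e^(p t) <= (1 - p) + p e^t]; its right side equals
   [(1 + a x) / (1 + a eta)]. *)
have h4 : expR (p * t) <= (1 - p) + p * (x / eta).
  have := ler_wpM2l (ltW (expR_gt0 (p * t))) h3; rewrite mulr1.
  have -> : expR (p * t) * ((1 - p) * expR (- (p * t)) + p * expR ((1 - p) * t)) =
     (1 - p) * (expR (p * t) * expR (- (p * t))) + p * (expR (p * t) * expR ((1 - p) * t)).
    by ring.
  rewrite -!expRD subrr expR0 mulr1 -et; congr (_ <= _ + _ * expR _).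
  by ring.
have e5 : (1 - p) + p * (x / eta) = (1 + a * x) / (1 + a * eta).
  by rewrite /p; field; rewrite !gt_eqF.
rewrite e5 in h4.
have := h4; rewrite -ler_ln ?posrE ?expR_gt0 ?divr_gt0 //; last by lra.
rewrite expRK ln_div ?posrE //; last by lra.
rewrite -/p -/t; lra.
Qed.

(** The tangents at [eta] leave, up to a constant, [x - q ln x], which is minimal at [x = q]; going
    from [q] back to [eta] costs [(q - eta)^2 / eta]. The single number [q] thus controls every [x],
    and [q = eta] is the fixed-point equation. *)
Lemma free_energy_ge (K : nat) (A : 'I_K -> R) (N eta x : R) :
  0 < N -> (forall j, 0 <= A j) -> 0 < eta -> 0 < x ->
  let q := 1 - N^-1 * \sum_j A j * eta / (1 + A j * eta) in 0 < q ->
  eta - 1 - ln eta - (q - eta) ^+ 2 / eta + N^-1 * \sum_j ln (1 + A j * eta) <=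
  x - 1 - ln x + N^-1 * \sum_j ln (1 + A j * x).
Proof.
move=> N0 A0 e0 x0 q q0.
pose S := \sum_j A j * eta / (1 + A j * eta).
have h1 : \sum_j ln (1 + A j * eta) + S * (ln x - ln eta) <= \sum_j ln (1 + A j * x).
  rewrite /S mulr_suml -big_split /=; apply: ler_sum => j _; exact: ln1D_tangent.
have Ni0 : 0 < N^-1 by rewrite invr_gt0.
have {}h1 := ler_wpM2l (ltW Ni0) h1.
have h2 : ln (x / q) <= x / q - 1 by apply: ln_le_Bl; rewrite divr_gt0.
have h3 : ln (q / eta) <= q / eta - 1 by apply: ln_le_Bl; rewrite divr_gt0.
have {}h2 : q * (ln x - ln q) <= x - q.
  have := ler_wpM2l (ltW q0) h2; rewrite ln_div ?posrE //.
  by have -> : q * (x / q - 1) = x - q by field; rewrite gt_eqF.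
have {}h3 : q * (ln q - ln eta) <= q ^+ 2 / eta - q.
  have := ler_wpM2l (ltW q0) h3; rewrite ln_div ?posrE //.
  by have -> : q * (q / eta - 1) = q ^+ 2 / eta - q by field; rewrite gt_eqF.
have e1 : (q - eta) ^+ 2 / eta = q ^+ 2 / eta - 2 * q + eta by field; rewrite gt_eqF.
have e2 : N^-1 * (\sum_j ln (1 + A j * eta) + S * (ln x - ln eta)) =
   N^-1 * \sum_j ln (1 + A j * eta) + (1 - q) * (ln x - ln eta).
  by rewrite /q -/S; ring.
rewrite e2 in h1; rewrite e1; lra.
Qed.

Section channel.
Variables (n K : nat) (c v : 'I_K -> R) (s0 mu beta eta eps : R).
Hypothesis K0 : (0 < K)%N.
Hypothesis c0 : forall j, 0 <= c j.
Hypothesis v0 : forall j, 0 <= v j.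
Hypothesis s00 : 0 < s0.
Hypothesis mu0 : 0 < mu.
Hypothesis beta0 : 0 < beta.
Hypothesis KN : K%:R = beta * n.+1%:R.
Hypothesis eta01 : 0 < eta <= 1.
Hypothesis eps0 : 0 < eps.

Local Notation N := (n.+1%:R : R).
Let phi j := c j / (\sum_m v m + s0).
Let A j := c j / (beta * mu).
(** Mean interference over actual interference plus noise; [N * phi j = theta * A j], so
    concentration amounts to [theta] being close to [1]. *)
Let theta := K%:R * mu / (\sum_m v m + s0).
Let kappa := eta - 1 - ln eta.
Let mean (f : 'I_K -> R) := K%:R^-1 * \sum_j f j.

Let k0 : 0 < K%:R :> R. Proof. by rewrite ltr0n. Qed.
Let N0 : 0 < N. Proof. by rewrite ltr0n. Qed.
Let eta0 : 0 < eta. Proof. by have /andP[] := eta01. Qed.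
Let tr0 : 0 < \sum_m v m + s0. Proof. by rewrite ltr_wpDl // sumr_ge0. Qed.
Let theta0 : 0 < theta. Proof. by rewrite divr_gt0 // mulr_gt0. Qed.
Let A0 j : 0 <= A j. Proof. by rewrite divr_ge0 // mulr_ge0 // ltW. Qed.
Let NphiE j : N * phi j = theta * A j.
Proof. by rewrite /phi /theta /A KN; field; rewrite !gt_eqF. Qed.
Let kappa0 : 0 <= kappa.
Proof. by have := ln_le_Bl eta0; rewrite /kappa; lra. Qed.

(** Replacing [theta > 1] by [1] costs at most [ln theta] per term. Either [theta <= 1 + eps], or
    the truncated mean lies more than [delta] below [muB]; then the quotient of squares is at least
    [1] and pays for the crude bound [theta <= 1 + K mu / s0]. Truncation is harmless since it only
    lowers the interference. *)
Lemma log_sum_le (B muB delta : R) : 0 < delta -> mu / (1 + eps) + delta <= muB ->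
  \sum_j ln (1 + N * phi j * eta) <= \sum_j ln (1 + A j * eta) +
    K%:R * (ln (1 + eps) + ln (1 + K%:R * mu / s0) *
      ((mean (fun j => Num.min (v j) B) - muB) ^+ 2 / delta ^+ 2)).
Proof.
have hep := eps0; have het := eta0; have hmu := mu0; have hth := theta0.
have hs0 := s00; have hka := kappa0; have hN := N0; have hk := k0.
move=> d0 muBd; set V := _ / delta ^+ 2; set b := ln (1 + eps) + _ * V.
have V0 : 0 <= V by rewrite divr_ge0 ?sqr_ge0.
have k1 : 0 <= K%:R * mu / s0 by rewrite divr_ge0 ?mulr_ge0 // ltW.
have l0 : 0 <= ln (1 + K%:R * mu / s0) by rewrite ln_ge0 // lerDl.
have le0 : 0 <= ln (1 + eps) by rewrite ln_ge0 // lerDl ltW.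
have b0 : 0 <= b by rewrite addr_ge0 // mulr_ge0.
suff lth : ln theta <= b.
  have -> : K%:R * b = \sum_(j < K) b by rewrite sumr_const card_ord -[b *+ K]mulr_natl.
  rewrite -big_split /=; apply: ler_sum => j _; rewrite NphiE.
  have a0 : 0 <= A j * eta by rewrite mulr_ge0 // ltW.
  have a1 : 0 < 1 + A j * eta by lra.
  have ta0 : 0 <= theta * (A j * eta) by rewrite mulr_ge0 // ltW.
  rewrite -mulrA; have [t1|t1] := leP theta 1.
    apply: (@le_trans _ _ (ln (1 + A j * eta))); last by rewrite lerDl.
    by rewrite ler_ln ?posrE ?lerD2l ?ler_piMl //; lra.
  apply: (@le_trans _ _ (ln (theta * (1 + A j * eta)))).
    rewrite ler_ln ?posrE ?(mulr_gt0 theta0 a1) //; last by lra.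
    by rewrite mulrDr mulr1 lerD2r ltW.
  by rewrite lnM ?posrE // [leLHS]addrC lerD2l.
have e1 : 0 < 1 + eps by rewrite addr_gt0.
have [t1|t1] := leP theta (1 + eps).
  apply: (@le_trans _ _ (ln (1 + eps))); first by rewrite ler_ln ?posrE ?theta0 ?e1.
  by rewrite lerDl mulr_ge0.
have V1 : 1 <= V.
  have trmu : \sum_m v m + s0 < K%:R * mu / (1 + eps).
    rewrite ltr_pdivlMr; last by lra.
    by move: t1; rewrite /theta ltr_pdivlMr // mulrC.
  have meanlt : mean (fun j => Num.min (v j) B) < mu / (1 + eps).
    rewrite /mean -(ltr_pM2l k0) mulVKf ?gt_eqF // mulrA.
    apply: le_lt_trans trmu; apply: (@le_trans _ _ (\sum_m v m)).
      by apply: ler_sum => j _; rewrite ge_min lexx.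
    by rewrite lerDl ltW.
  rewrite /V ler_pdivlMr ?exprn_gt0 // mul1r -[leRHS]sqrrN ler_pXn2r ?nnegrE //; lra.
have tK : theta <= 1 + K%:R * mu / s0.
  have : theta <= K%:R * mu / s0.
    rewrite /theta ler_wpM2l ?mulr_ge0 // ?(ltW mu0) // lef_pV2 ?posrE //.
    by rewrite lerDr sumr_ge0.
  lra.
apply: (@le_trans _ _ (ln (1 + K%:R * mu / s0))).
  by rewrite ler_ln ?posrE ?theta0 ?ltr_wpDr.
by rewrite -[leLHS]add0r lerD // ler_peMr.
Qed.

(** This is [(q - eta)^2] for the [q] of [free_energy_ge], written with an empirical mean centred at
    [(1 - eta) / beta], its expectation at the fixed point. *)
Let Q := (beta * (mean (fun j => A j * eta / (1 + A j * eta)) - (1 - eta) / beta)) ^+ 2.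

(** The first assumption says [theta >= 1 / (1 + eps)]; shrinking a coefficient by this factor costs
    at most [ln (1 + eps)], whatever [x] is, and [K / N = beta]. *)
Lemma free_energy_channel_ge : \sum_m v m + s0 <= (1 + eps) * (K%:R * mu) -> Q < eta ^+ 2 ->
  forall x : R, 0 < x ->
  kappa - Q / eta + N^-1 * \sum_j ln (1 + A j * eta) - beta * ln (1 + eps) <=
  x - 1 - ln x + N^-1 * \sum_j ln (1 + N * phi j * x).
Proof.
have hep := eps0; have het := eta0; have hmu := mu0; have hth := theta0.
have hs0 := s00; have hka := kappa0; have hN := N0; have hk := k0.
move=> tr1 Qe x x0.
set q := 1 - N^-1 * \sum_j A j * eta / (1 + A j * eta).
have qQ : (q - eta) ^+ 2 = Q.
  rewrite /Q /q /mean KN -sqrrN; congr (_ ^+ 2); field.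
  by rewrite !gt_eqF.
have q0 : 0 < q.
  rewrite ltNge; apply/negP => q0; move: Qe; rewrite ltNge -qQ => /negP; apply.
  have q1 : eta <= - (q - eta) by rewrite opprB lerDl oppr_ge0.
  by rewrite -[leRHS]sqrrN ler_pXn2r ?nnegrE ?(le_trans _ q1) ?(ltW eta0).
have := free_energy_ge N0 A0 eta0 x0 q0; rewrite -/q qQ -/kappa => h.
have le0 : 0 <= ln (1 + eps) by rewrite ln_ge0 // lerDl ltW.
have e1 : 0 < 1 + eps by lra.
have th : 1 <= (1 + eps) * theta.
  by rewrite /theta mulrA ler_pdivlMr // mul1r.
have hj : \sum_j ln (1 + A j * x) - K%:R * ln (1 + eps) <= \sum_j ln (1 + N * phi j * x).
  have -> : K%:R * ln (1 + eps) = \sum_(j < K) ln (1 + eps).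
    by rewrite sumr_const card_ord -[ln _ *+ K]mulr_natl.
  rewrite -sumrB; apply: ler_sum => j _; rewrite NphiE lerBlDl -mulrA.
  have a0 : 0 <= A j * x by rewrite mulr_ge0 // ltW.
  have ta0 : 0 <= theta * (A j * x) by rewrite mulr_ge0 // ltW.
  have ta1 : 0 < 1 + theta * (A j * x) by lra.
  rewrite -lnM ?posrE // ler_ln ?posrE ?(mulr_gt0 e1 ta1) //; last by lra.
  rewrite mulrDr mulr1 [(1 + eps) * (theta * _)]mulrA.
  have := ler_wpM2r a0 th; rewrite mul1r; lra.
have {}hj := ler_wpM2l (ltW (_ : 0 < N^-1)) hj.
have : N^-1 * (\sum_j ln (1 + A j * x) - K%:R * ln (1 + eps)) =
   N^-1 * \sum_j ln (1 + A j * x) - beta * ln (1 + eps).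
  by rewrite KN; field; rewrite gt_eqF.
move=> e; rewrite e in hj; rewrite invr_gt0 in hj; have {}hj := hj N0.
have tri (a1 a2 a3 a4 a5 : R) : a1 <= a2 + a3 -> a3 - a4 <= a5 -> a1 - a4 <= a2 + a5 by lra.
exact: tri h hj.
Qed.

Variables (C B muB : R).
Hypothesis C0 : 0 <= C.
Hypothesis muBmu : muB <= mu.
Hypothesis s0small : s0 <= K%:R * (eps * mu / 2).

Let ell j := Num.min C (ln (1 + A j * eta)).
(** At least [1] when interference plus noise exceeds [(1 + eps) K mu]: of the excess [eps mu] per
    user, half is allotted to [s0], a quarter to the truncated mean and a quarter to the tail above
    [B]. *)
Let U := (mean (fun j => Num.min (v j) B) - muB) ^+ 2 * (16 / (eps * mu) ^+ 2) +
  mean (fun j => Num.max 0 (v j - B)) * (4 / (eps * mu)).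

(** [Y] stands for the mean of [ln D] at frozen attenuations. If the interference is too large or
    [Q >= eta^2], the error alone exceeds the main term, which the cap keeps below
    [n (kappa + beta C)], and [0 <= Y] suffices. Otherwise the free energy bound applies. *)
Lemma channel_lower (Y : \bar R) : (0 <= Y)%E ->
  (forall m, (forall x : R, 0 < x ->
      m <= x - 1 - ln x + N^-1 * \sum_j ln (1 + N * phi j * x)) ->
    ((n%:R * m - 1 - ln N)%:E <= Y)%E) ->
  ((n%:R * (kappa + N^-1 * \sum_j ell j))%:E <=
   Y + (n%:R * ((kappa + beta * C) * (Q / eta ^+ 2 + U) + Q / eta + beta * ln (1 + eps)) +
        (1 + ln N))%:E)%E.
Proof.
have hep := eps0; have het := eta0; have hmu := mu0; have hth := theta0.
have hs0 := s00; have hka := kappa0; have hN := N0; have hk := k0.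
have hsm := s0small; have hmB := muBmu; have hC := C0.
move=> Y0 YL.
have em0 : 0 < eps * mu by rewrite mulr_gt0.
have mx0 : 0 <= mean (fun j => Num.max 0 (v j - B)).
  by rewrite /mean mulr_ge0 ?invr_ge0 ?(ltW k0) // sumr_ge0 // => j _; rewrite le_max lexx.
have U0 : 0 <= U.
  rewrite /U addr_ge0 // mulr_ge0 ?sqr_ge0 ?divr_ge0 ?sqr_ge0 //; exact: ltW.
have Q0 : 0 <= Q by exact: sqr_ge0.
have Qe0 : 0 <= Q / eta ^+ 2 by rewrite divr_ge0 // sqr_ge0.
have Qe1 : 0 <= Q / eta by rewrite divr_ge0 // ltW.
have le0 : 0 <= ln (1 + eps) by rewrite ln_ge0 // lerDl ltW.
have lN0 : 0 <= ln N by rewrite ln_ge0 // ler1n.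
have bC0 : 0 <= beta * C by rewrite mulr_ge0 // ltW.
have kb0 : 0 <= kappa + beta * C by rewrite addr_ge0.
have ellC : N^-1 * \sum_j ell j <= beta * C.
  have : \sum_j ell j <= K%:R * C.
    have -> : K%:R * C = \sum_(j < K) C by rewrite sumr_const card_ord -[C *+ K]mulr_natl.
    by apply: ler_sum => j _; rewrite ge_min lexx.
  move=> /(ler_wpM2l (ltW (_ : 0 < N^-1))); rewrite invr_gt0 => /(_ N0) /le_trans; apply.
  rewrite le_eqVlt; apply/orP; left; apply/eqP; rewrite KN; field.
  by rewrite gt_eqF.
have [tr1|tr1] := leP (\sum_m v m + s0) ((1 + eps) * (K%:R * mu)); last first.
  have U1 : 1 <= U.
    have hs : (1 + eps) * mu < mean v + s0 / K%:R.
      rewrite -(ltr_pM2l k0); have -> : K%:R * (mean v + s0 / K%:R) = \sum_m v m + s0.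
        by rewrite /mean; field; rewrite gt_eqF.
      by rewrite mulrCA.
    have hs2 : s0 / K%:R <= eps * mu / 2 by rewrite ler_pdivrMr // mulrC.
    have vsplit : mean v = mean (fun j => Num.min (v j) B) + mean (fun j => Num.max 0 (v j - B)).
      rewrite /mean -mulrDr -big_split /=; congr (_ * _); apply: eq_bigr => j _.
      have [h|h] := leP (v j) B.
        by rewrite (max_idPl _) ?addr0 // subr_le0.
      by rewrite (max_idPr _) ?subr_ge0 ?(ltW h) // addrC subrK.
    set a := mean (fun j => Num.min (v j) B) in vsplit *.
    set b := mean (fun j => Num.max 0 (v j - B)) in vsplit mx0 *.
    have hab : eps * mu / 2 < (a - muB) + b by rewrite vsplit in hs; lra.
    have [hb|hb] := leP (eps * mu / 4) b.
      have : 1 <= b * (4 / (eps * mu)).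
        by rewrite mulrA ler_pdivlMr // mul1r; lra.
      have : 0 <= (a - muB) ^+ 2 * (16 / (eps * mu) ^+ 2).
        by rewrite mulr_ge0 ?sqr_ge0 // divr_ge0 // sqr_ge0.
      by rewrite /U -/a -/b; lra.
    have : 1 <= (a - muB) ^+ 2 * (16 / (eps * mu) ^+ 2).
      rewrite mulrA ler_pdivlMr ?exprn_gt0 // mul1r.
      have -> : (a - muB) ^+ 2 * 16 = ((a - muB) * 4) ^+ 2 by ring.
      by rewrite ler_pXn2r ?nnegrE ?(ltW em0) //; lra.
    have : 0 <= b * (4 / (eps * mu)) by rewrite mulr_ge0 // divr_ge0 // ltW.
    by rewrite /U -/a -/b; lra.
  apply: (@le_trans _ _ (0 + (n%:R * ((kappa + beta * C) * (Q / eta ^+ 2 + U) + Q / eta +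
      beta * ln (1 + eps)) + (1 + ln N))%:E)%E); last by rewrite leeD2r.
  rewrite add0e lee_fin; apply: (@le_trans _ _ (n%:R * (kappa + beta * C))).
    by rewrite ler_wpM2l // lerD2l.
  rewrite -[leLHS]addr0 lerD //; last by lra.
  rewrite ler_wpM2l //.
  have tri (a1 a2 a3 a4 : R) : a1 <= a2 -> 0 <= a3 -> 0 <= a4 -> a1 <= a2 + a3 + a4 by lra.
  apply: tri => //; last by rewrite mulr_ge0 // ltW.
  by rewrite ler_peMr //; lra.
have [Qlt|Qge] := ltP Q (eta ^+ 2); last first.
  have Q1 : 1 <= Q / eta ^+ 2 by rewrite ler_pdivlMr ?mul1r // exprn_gt0.
  apply: (@le_trans _ _ (0 + (n%:R * ((kappa + beta * C) * (Q / eta ^+ 2 + U) + Q / eta +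
      beta * ln (1 + eps)) + (1 + ln N))%:E)%E); last by rewrite leeD2r.
  rewrite add0e lee_fin; apply: (@le_trans _ _ (n%:R * (kappa + beta * C))).
    by rewrite ler_wpM2l // lerD2l.
  rewrite -[leLHS]addr0 lerD //; last by lra.
  rewrite ler_wpM2l //.
  have tri (a1 a2 a3 a4 : R) : a1 <= a2 -> 0 <= a3 -> 0 <= a4 -> a1 <= a2 + a3 + a4 by lra.
  apply: tri => //; last by rewrite mulr_ge0 // ltW.
  by rewrite ler_peMr //; lra.
have := YL _ (free_energy_channel_ge tr1 Qlt); set m := _ - beta * ln _ => h.
apply: (@le_trans _ _ ((n%:R * m - 1 - ln N)%:E + (n%:R * ((kappa + beta * C) *
   (Q / eta ^+ 2 + U) + Q / eta + beta * ln (1 + eps)) + (1 + ln N))%:E)%E);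
   last by rewrite leeD2r.
rewrite -EFinD lee_fin.
have hl : N^-1 * \sum_j ell j <= N^-1 * \sum_j ln (1 + A j * eta).
  rewrite ler_wpM2l ?invr_ge0 ?(ltW N0) //; apply: ler_sum => j _.
  by rewrite ge_min lexx orbT.
have hm : kappa + N^-1 * \sum_j ell j <= m + ((kappa + beta * C) *
   (Q / eta ^+ 2 + U) + Q / eta + beta * ln (1 + eps)).
  have : 0 <= (kappa + beta * C) * (Q / eta ^+ 2 + U) by rewrite mulr_ge0 // addr_ge0.
  have tri (a1 a2 a3 a4 a5 a6 : R) :
    a1 <= a2 -> 0 <= a3 -> a6 + a1 <= a6 - a4 + a2 - a5 + (a3 + a4 + a5) by lra.
  by move=> hz; exact: tri hl hz.
have hmn := ler_wpM2l (ler0n R n) hm; rewrite [leRHS]mulrDr in hmn.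
have tri (a1 a2 a3 a4 : R) : a1 <= a2 + a3 -> a1 <= a2 - 1 - a4 + (a3 + (1 + a4)) by lra.
exact: tri hmn.
Qed.

End channel.
End free_energy.

Lemma measurable_inv_gt0 {R : realType} d (T : measurableType d) (f : T -> R) :
  measurable_fun setT f -> (forall w, 0 < f w) ->
  measurable_fun setT (fun w => (f w)^-1).
Proof.
move=> mf f0; rewrite (_ : (fun w => _) = fun w => expR (- ln (f w))).
  apply: measurableT_comp => //; apply: measurable_funN.
  by apply: measurableT_comp => //; exact: measurable_ln.
by apply/funext => w; rewrite expRN lnK // posrE.
Qed.

(** * Bounds for a random channel *)

Section random_channel.
Context {R : realType}.
Variables (L n K : nat) (d : measure_display) (T : measurableType d).
Variables (P : probability T R) (dd : 'I_L -> 'I_L -> 'I_K -> T -> R).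
Variables (X Y : 'I_n.+1 -> 'I_K -> T -> R).
Hypothesis iXY : mutually_independent P (model_family dd X Y).
Hypothesis HX : forall a j B, measurable B ->
  P (X a j @^-1` B) = normal_prob 0 (Num.sqrt 2^-1) B.
Hypothesis HY : forall a j B, measurable B ->
  P (Y a j @^-1` B) = normal_prob 0 (Num.sqrt 2^-1) B.
Variables (k : 'I_L) (c v : ('I_L -> R) -> R) (s0 : R).
Hypothesis mc : measurable_family c.
Hypothesis mv : measurable_family v.
Hypothesis c0 : forall x, 0 <= c x.
Hypothesis v0 : forall x, 0 <= v x.
Hypothesis s00 : 0 < s0.
Hypothesis K0 : (0 < K)%N.

Local Notation N := (n.+1%:R : R).
Let row w j (l : 'I_L) := dd k l j w.
Let phi w j := c (row w j) / (\sum_m v (row w m) + s0).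
Let lnD w w' := ln (complex.Re (\det (gram id (index_enum 'I_K) (phi w)
   (fun i => model_family dd X Y (inr i) w')))).

Let tr0 w : 0 < \sum_m v (row w m) + s0.
Proof. by rewrite ltr_wpDl // sumr_ge0. Qed.
Let phi0 w j : 0 <= phi w j.
Proof. by rewrite divr_ge0 // ltW. Qed.
Let j0 : 'I_K := Ordinal K0.

Let GX : gaussian_family P (fun i => model_family dd X Y (inr i)).
Proof.
split; first by apply: (mutually_independent_inj (f := inr) _ iXY) => i j [].
by move=> [[a j] []] B mB; [exact: HY|exact: HX].
Qed.

Let mdd l j : measurable_fun setT (dd k l j).
Proof. exact: (iXY.1 (inl (k, l, j))). Qed.

Let mrow j (psi : ('I_L -> R) -> R) : measurable_family psi ->
  measurable_fun setT (fun w => psi (row w j)).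
Proof. by move=> mpsi; apply: (measurable_comp_family mpsi) => l; exact: mdd. Qed.

(** Attenuations are read at [w] and Gaussian entries at [w'], so the inner integral is a mean at
    fixed [phi]. *)
Definition split_rate : \bar R := (\int[P]_w \int[P]_w' (lnD w w')%:E)%E.

Let F (u : 'I_L * 'I_L * 'I_K + 'I_n.+1 * 'I_K * bool -> R) : R :=
  ln (complex.Re (\det (gram id (index_enum 'I_K)
    (fun j => c (fun l => u (inl (k, l, j))) /
       (\sum_m v (fun l => u (inl (k, l, m))) + s0)) (fun i => u (inr i))))).

Let F0 u : 0 <= F u.
Proof.
apply/ln_ge0/Re_det_gram_ge1 => j; rewrite divr_ge0 //.
by apply: addr_ge0; [exact: sumr_ge0|exact: ltW].
Qed.

Let mF : measurable_family F.
Proof.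
apply: measurableT_comp; first exact: measurable_ln.
apply: measurable_det_gram => [j|i]; last exact: measurable_tuple_fun.
have mrow' (psi : ('I_L -> R) -> R) m : measurable_family psi ->
    measurable_family (fun u => psi (fun l => u (inl (k, l, m)))).
  move=> mpsi; apply: (measurable_comp_family mpsi) => l; exact: measurable_tuple_fun.
apply: measurable_funM; first exact: mrow'.
apply: measurable_inv_gt0 => [|t]; last first.
  by apply: ltr_wpDl => //; exact: sumr_ge0.
by apply: measurable_funD => //; apply: measurable_sum => m; exact: mrow'.
Qed.

Let lnDE w w' : lnD w w' =
  F (fun i => if is_inl i then model_family dd X Y i w else model_family dd X Y i w').
Proof. by []. Qed.

Let mrate : measurable_fun setT (fun w => \int[P]_w' (lnD w w')%:E)%E.
Proof.
apply: (measurable_fun_fubini_tonelli_F (m2 := P) (fun z => (lnD z.1 z.2)%:E)) => //.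
- apply/measurable_EFinP.
  apply: (measurable_comp_family mF (Z := fun z i => if is_inl i then
    model_family dd X Y i z.1 else model_family dd X Y i z.2)) => i.
  by have mi := iXY.1 i; case: (is_inl i); exact: measurableT_comp.
- by move=> z; rewrite lnDE lee_fin.
Qed.

Let rate_ge0 w : (0 <= \int[P]_w' (lnD w w')%:E)%E.
Proof. by apply: integral_ge0 => w' _; rewrite lee_fin lnDE. Qed.

Lemma split_rate_ge0 : (0 <= split_rate)%E.
Proof. by apply: integral_ge0 => w _; exact: rate_ge0. Qed.

(** Expanding [M Phi M^H] over the columns of [M] gives [gram]; decoupling along [is_inl] separates
    attenuations from Gaussian entries. *)
Lemma expected_logdet (tp sigma2 zk : R) : s0 = zk * sigma2 ->
  c = (fun x => pilot_b tp sigma2 x k * x k ^+ 2) ->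
  v = (fun x => (1 - pilot_b tp sigma2 x k) * x k ^+ 2) ->
  ('E_P[fun w => logdet (chanM X Y w) (Phi_TD tp sigma2 (fun l m => dd k l m w) k zk)] =
   (ln 2)^-1%:E * split_rate)%E.
Proof.
move=> es ec ev; have l2 : 0 < ln (2 : R) by rewrite ln_gt0 // ltr1n.
rewrite unlock /expectation; under eq_integral => w _.
  have -> : logdet (chanM X Y w) (Phi_TD tp sigma2 (fun l m => dd k l m w) k zk) =
      (ln 2)^-1 * F (model_family dd X Y ^~ w).
    rewrite /logdet /log2 mulrC; congr (_ * ln (complex.Re (\det _))).
    rewrite /gram; congr (_ + _); apply/matrixP => a b.
    rewrite summxE !mxE; apply: eq_bigr => j _; rewrite !mxE.
    rewrite big_ord1 !mxE (bigD1 j) //= big1 ?addr0; last first.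
      by move=> m mj; rewrite !mxE (negbTE mj) mulr0n mulr0.
    rewrite !mxE eqxx mulr1n /= es ec ev mulrCA -mulrA mulrC -mulrA; congr (_ * _).
    by rewrite mulrC.
  over.
rewrite integralZ_nneg ?invr_ge0 ?(ltW l2) //; last first.
  by apply: (measurable_comp_family mF) => i; exact: iXY.1.
congr (_ * _)%E; rewrite (indep_decouple (F := fun u => (F u)%:E) is_inl iXY) //.
by apply/measurable_EFinP.
Qed.

Section rate_bounds.
Context d0 (T0 : measurableType d0) (P0 : probability T0 R).
Variables (e : 'I_L -> T0 -> R) (mu beta eta eps B muB : R).
Hypothesis ie : mutually_independent P0 e.
Hypothesis lawe : forall l j B, measurable B -> P (dd k l j @^-1` B) = P0 (e l @^-1` B).
Hypothesis mu0 : 0 < mu.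
Hypothesis beta0 : 0 < beta.
Hypothesis KN : K%:R = beta * n.+1%:R.
Hypothesis eta01 : 0 < eta <= 1.
Hypothesis eps0 : 0 < eps.
Hypothesis B0 : 0 <= B.
Hypothesis vB : (\int[P0]_w (Num.min (v (e ^~ w)) B)%:E = muB%:E)%E.

Let A x := c x / (beta * mu).
Let kappa := eta - 1 - ln eta.
Let eta0 : 0 < eta. Proof. by have /andP[] := eta01. Qed.
Let N0 : 0 < N. Proof. by rewrite ltr0n. Qed.
Let k0 : 0 < K%:R :> R. Proof. by rewrite ltr0n. Qed.
Let kappa0 : 0 <= kappa.
Proof. by have := ln_le_Bl eta0; rewrite /kappa; lra. Qed.
Let A0 x : 0 <= A x. Proof. by rewrite divr_ge0 // mulr_ge0 // ltW. Qed.
Let Ae0 x : 0 <= A x * eta. Proof. by rewrite mulr_ge0 // ltW. Qed.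
Let Ae1 x : 0 < 1 + A x * eta. Proof. by rewrite ltr_wpDr. Qed.
Let lnA0 x : 0 <= ln (1 + A x * eta). Proof. by rewrite ln_ge0 // lerDl. Qed.
Let mA1 : measurable_family (fun x => 1 + A x * eta).
Proof.
by apply: measurable_funD => //; apply: measurable_funM => //; exact: measurable_funM.
Qed.
Let mlnA : measurable_family (fun x => ln (1 + A x * eta)).
Proof. by apply: measurableT_comp => //; exact: measurable_ln. Qed.
Let mminv : measurable_family (fun x => Num.min (v x) B).
Proof. exact: measurable_minr. Qed.
Let ln1e0 : 0 <= ln (1 + eps). Proof. by rewrite ln_ge0 // lerDl ltW. Qed.
Let lnN0 : 0 <= ln N. Proof. by rewrite ln_ge0 // ler1n. Qed.

Let iX : mutually_independent P (fun lj : 'I_L * 'I_K => dd k lj.1 lj.2).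
Proof.
apply: (mutually_independent_inj (f := fun lj : 'I_L * 'I_K => inl (k, lj.1, lj.2)) _ iXY).
by move=> [l j] [l' j'] [-> ->].
Qed.

Let rowE (psi : ('I_L -> R) -> R) j : measurable_family psi -> (forall x, 0 <= psi x) ->
  (\int[P]_w (psi (row w j))%:E = \int[P0]_w (psi (e ^~ w))%:E)%E.
Proof.
move=> mpsi psi0; apply: (integral_row (psi := fun x => (psi x)%:E) iX ie lawe j).
  exact/measurable_EFinP.
by move=> x; rewrite lee_fin.
Qed.

Let rowV (psi : ('I_L -> R) -> R) (C m : R) : measurable_family psi ->
  (forall x, 0 <= psi x <= C) -> (\int[P0]_w (psi (e ^~ w))%:E = m%:E)%E ->
  (\int[P]_w ((K%:R^-1 * \sum_j psi (row w j) - m) ^+ 2)%:E <= (C ^+ 2 / K%:R)%:E)%E.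
Proof. exact: (integral_row_mean_sqr_le iX ie lawe). Qed.

Let rowsumE (psi : ('I_L -> R) -> R) : measurable_family psi -> (forall x, 0 <= psi x) ->
  (\int[P]_w (\sum_j psi (row w j))%:E = K%:R%:E * \int[P0]_w (psi (e ^~ w))%:E)%E.
Proof.
move=> mpsi psi0; rewrite integral_sum_nneg //; last by move=> j; exact: mrow.
under eq_bigr => j _ do rewrite rowE //.
have I0 : (0 <= \int[P0]_w (psi (e ^~ w))%:E)%E.
  by apply: integral_ge0 => w _; rewrite lee_fin.
have -> : K%:R = \sum_(j < K) 1 :> R by rewrite sumr_const card_ord.
rewrite -sumEFin ge0_sume_distrl; last by move=> j _; rewrite lee_fin.
by apply: eq_bigr => j _; rewrite mul1e.
Qed.

Let mmean (psi : ('I_L -> R) -> R) (m : R) : measurable_family psi ->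
  measurable_fun setT (fun w => (K%:R^-1 * \sum_j psi (row w j) - m) ^+ 2).
Proof.
move=> mpsi; apply: measurable_funX; apply: measurable_funB => //.
by apply: measurable_funM => //; apply: measurable_sum => j; exact: mrow.
Qed.

Lemma split_rate_le (delta : R) : 0 < delta -> mu / (1 + eps) + delta <= muB ->
  (split_rate <= K%:R%:E * \int[P0]_w (ln (1 + A (e ^~ w) * eta))%:E +
    (N * kappa + K%:R * ln (1 + eps) + ln (1 + K%:R * mu / s0) * (B ^+ 2 / delta ^+ 2) +
     (1 + ln N))%:E)%E.
Proof.
move=> d0' muBd.
set b := ln (1 + K%:R * mu / s0); set a := N * kappa + K%:R * ln (1 + eps) + (1 + ln N).
have b0 : 0 <= b by rewrite ln_ge0 // lerDl divr_ge0 ?mulr_ge0 // ltW.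
have a0 : 0 <= a by rewrite /a !addr_ge0 // mulr_ge0 // ltW.
have d2 : 0 < delta ^+ 2 by rewrite exprn_gt0.
pose g w := (K%:R^-1 * \sum_j Num.min (v (row w j)) B - muB) ^+ 2.
have bd0 : 0 <= K%:R * b / delta ^+ 2 by rewrite divr_ge0 ?mulr_ge0 // ltW.
apply: (@le_trans _ _ (\int[P]_w (\sum_j ln (1 + A (row w j) * eta) +
    (a + K%:R * b / delta ^+ 2 * g w))%:E)%E).
  apply: le_integral_ge0 => w; first exact: rate_ge0.
  apply: (le_trans (expected_ln_det_le GX (phi0 w) eta0)); rewrite lee_fin.
  have := log_sum_le K0 (fun j => c0 (row w j)) (fun j => v0 (row w j)) s00 mu0 beta0 KN
    eta01 eps0 B d0' muBd.
  rewrite -/b -/(g w) -/(phi w) -/kappa => h.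
  have -> : K%:R * b / delta ^+ 2 * g w = K%:R * (b * (g w / delta ^+ 2)).
    by field; rewrite gt_eqF.
  move: h; rewrite mulrDr => h.
  have tri (a1 a2 a3 a4 a5 a6 : R) : a1 <= a2 + (a3 + a4) ->
    a1 + a5 + a6 <= a2 + (a5 + a3 + a6 + a4) by lra.
  exact: tri h.
rewrite integralD_nneg; last 4 first.
- by apply: measurable_sum => j; exact: (mrow j mlnA).
- apply: measurable_funD => //; apply: measurable_funM => //; exact: (mmean _ mminv).
- by move=> w; exact: sumr_ge0.
- by move=> w; rewrite addr_ge0 // mulr_ge0 // sqr_ge0.
rewrite (rowsumE mlnA) // leeD2l // integralD_nneg //; last 2 first.
- by apply: measurable_funM => //; exact: (mmean _ mminv).
- by move=> w; rewrite mulr_ge0 // sqr_ge0.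
rewrite integral_prob_cst integralZ_nneg //; last 2 first.
- exact: (mmean _ mminv).
- by move=> w; exact: sqr_ge0.
have minB x : 0 <= Num.min (v x) B <= B by rewrite le_min v0 B0 ge_min lexx orbT.
have hb0 : (0 <= (K%:R * b / delta ^+ 2)%:E)%E by rewrite lee_fin.
apply: (le_trans (leeD2l a%:E (lee_wpmul2l hb0 (rowV mminv minB vB)))).
rewrite -EFinM -EFinD lee_fin le_eqVlt; apply/orP; left; apply/eqP; rewrite /a; field.
by rewrite !gt_eqF.
Qed.

(** Averages [channel_lower] over the attenuations. The hypothesis on [A eta / (1 + A eta)] is the
    fixed-point equation, which centres [Q]; the tail above [B] enters through its mean [tB]
    alone. *)
Lemma split_rate_ge (C tB : R) : 0 <= C -> muB <= mu -> s0 <= K%:R * (eps * mu / 2) ->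
  (\int[P0]_w (A (e ^~ w) * eta / (1 + A (e ^~ w) * eta))%:E = ((1 - eta) / beta)%:E)%E ->
  (\int[P0]_w (Num.max 0 (v (e ^~ w) - B))%:E = tB%:E)%E ->
  ((n%:R * kappa)%:E +
     (n%:R * beta)%:E * \int[P0]_w (Num.min C (ln (1 + A (e ^~ w) * eta)))%:E <=
   split_rate + (n%:R * ((kappa + beta * C) * (beta ^+ 2 / (K%:R * eta ^+ 2) +
       B ^+ 2 / K%:R * (16 / (eps * mu) ^+ 2) + tB * (4 / (eps * mu))) +
       beta ^+ 2 / (K%:R * eta) + beta * ln (1 + eps)) + (1 + ln N))%:E)%E.
Proof.
move=> C0 muBmu s0small EA EB.
have kb0 : 0 <= kappa + beta * C by rewrite addr_ge0 // mulr_ge0 // ltW.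
have em0 : 0 < eps * mu by rewrite mulr_gt0.
have n0 : 0 <= n%:R :> R by exact: ler0n.
pose pA x := A x * eta / (1 + A x * eta).
have mpA : measurable_family pA.
  apply: measurable_funM.
    by apply: measurable_funM => //; exact: measurable_funM.
  by apply: measurable_inv_gt0 => // t; exact: Ae1.
have pA01 x : 0 <= pA x <= 1.
  have := Ae0 x; have := Ae1 x => h1 h0.
  by rewrite /pA divr_ge0 ?(ltW h1) //= ler_pdivrMr // mul1r lerDr.
pose ell x := Num.min C (ln (1 + A x * eta)).
have mell : measurable_family ell by exact: measurable_minr.
have ell0 x : 0 <= ell x by rewrite le_min C0 lnA0.
pose mx x := Num.max 0 (v x - B).
have mmx : measurable_family mx.
  by apply: measurable_maxr => //; exact: measurable_funB.
have mx0 x : 0 <= mx x by rewrite le_max lexx.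
pose G1 w := (K%:R^-1 * \sum_j pA (row w j) - (1 - eta) / beta) ^+ 2.
pose G2 w := (K%:R^-1 * \sum_j Num.min (v (row w j)) B - muB) ^+ 2.
(* Coefficients of the deviation from the fixed point ([q1]), of the truncated interference ([q2]),
   of its tail ([q3]), and the deterministic rest ([q4]). *)
pose q1 := n%:R * ((kappa + beta * C) * (beta ^+ 2 / eta ^+ 2) + beta ^+ 2 / eta).
pose q2 := n%:R * (kappa + beta * C) * (16 / (eps * mu) ^+ 2).
pose q3 := n%:R * (kappa + beta * C) * (4 / (eps * mu)) / K%:R.
pose q4 := n%:R * (beta * ln (1 + eps)) + (1 + ln N).
have be0 : 0 <= beta ^+ 2 / eta ^+ 2 by rewrite divr_ge0 ?sqr_ge0.
have be1 : 0 <= beta ^+ 2 / eta by rewrite divr_ge0 ?sqr_ge0 ?(ltW eta0).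
have q10 : 0 <= q1 by apply: mulr_ge0 => //; apply: addr_ge0 => //; exact: mulr_ge0.
have nk0 : 0 <= n%:R * (kappa + beta * C) by exact: mulr_ge0.
have q20 : 0 <= q2 by apply: mulr_ge0 => //; rewrite divr_ge0 ?sqr_ge0.
have q30 : 0 <= q3.
  apply: divr_ge0; last exact: ltW.
  by apply: mulr_ge0 => //; rewrite divr_ge0 ?(ltW em0).
have q40 : 0 <= q4.
  by apply: addr_ge0; [apply: mulr_ge0 => //; rewrite mulr_ge0 ?(ltW beta0)|rewrite addr_ge0].
have G10 w : 0 <= G1 w by exact: sqr_ge0.
have G20 w : 0 <= G2 w by exact: sqr_ge0.
have mG1 : measurable_fun setT G1 by exact: (mmean _ mpA).
have mG2 : measurable_fun setT G2 by exact: (mmean _ mminv).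
pose S3 w := \sum_j mx (row w j).
have mS3 : measurable_fun setT S3 by apply: measurable_sum => j; exact: (mrow j mmx).
have S30 w : 0 <= S3 w by exact: sumr_ge0.
pose S4 w := \sum_j ell (row w j).
have mS4 : measurable_fun setT S4 by apply: measurable_sum => j; exact: (mrow j mell).
have S40 w : 0 <= S4 w by exact: sumr_ge0.
have nN0 : 0 <= n%:R / N by rewrite divr_ge0.
have ptwise w : ((n%:R * kappa + n%:R / N * S4 w)%:E <= \int[P]_w' (lnD w w')%:E +
    (q1 * G1 w + (q2 * G2 w + (q3 * S3 w + q4)))%:E)%E.
  have YL (m : R) : (forall x : R, 0 < x ->
      m <= x - 1 - ln x + N^-1 * \sum_j ln (1 + N * phi w j * x)) ->
    ((n%:R * m - 1 - ln N)%:E <= \int[P]_w' (lnD w w')%:E)%E.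
    exact: (expected_ln_det_ge GX (phi0 w) j0).
  have h := channel_lower K0 (fun j => c0 (row w j)) (fun j => v0 (row w j)) s00 mu0 beta0 KN
    eta01 eps0 B C0 muBmu s0small (rate_ge0 w) YL.
  have -> : n%:R * kappa + n%:R / N * S4 w = n%:R * (kappa + N^-1 * S4 w) by ring.
  apply: (le_trans h); rewrite leeD2l // lee_fin le_eqVlt; apply/orP; left; apply/eqP.
  rewrite /q1 /q2 /q3 /q4 /G1 /G2 /S3 /mx /pA /A -/kappa; field.
  by rewrite !gt_eqF // mulr_gt0.
have : (\int[P]_w (n%:R * kappa + n%:R / N * S4 w)%:E <=
    \int[P]_w (\int[P]_w' (lnD w w')%:E +
      (q1 * G1 w + (q2 * G2 w + (q3 * S3 w + q4)))%:E))%E.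
  apply: le_integral_ge0 => w //.
  by rewrite lee_fin addr_ge0 // mulr_ge0.
have mR3 : measurable_fun setT (fun w => q3 * S3 w + q4).
  by apply: measurable_funD => //; exact: measurable_funM.
have mR2 : measurable_fun setT (fun w => q2 * G2 w + (q3 * S3 w + q4)).
  by apply: measurable_funD => //; exact: measurable_funM.
have mR1 : measurable_fun setT (fun w => q1 * G1 w + (q2 * G2 w + (q3 * S3 w + q4))).
  by apply: measurable_funD => //; exact: measurable_funM.
have R30 w : 0 <= q3 * S3 w + q4 by apply: addr_ge0 => //; exact: mulr_ge0.
have R20 w : 0 <= q2 * G2 w + (q3 * S3 w + q4).
  by apply: addr_ge0 => //; exact: mulr_ge0.
have R10 w : 0 <= q1 * G1 w + (q2 * G2 w + (q3 * S3 w + q4)).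
  by apply: addr_ge0 => //; exact: mulr_ge0.
rewrite ge0_integralD //; last 2 first.
- by move=> w _; rewrite lee_fin.
- exact/measurable_EFinP.
rewrite (@integralD_nneg _ _ _ P (fun=> n%:R * kappa)) //; last 3 first.
- exact: measurable_funM.
- by move=> w; exact: mulr_ge0.
- by move=> w; exact: mulr_ge0.
rewrite integral_prob_cst (@integralZ_nneg _ _ _ P (n%:R / N)) // (rowsumE mell) //.
have -> : ((n%:R / N)%:E * (K%:R%:E * \int[P0]_w (ell (e ^~ w))%:E) =
    (n%:R * beta)%:E * \int[P0]_w (ell (e ^~ w))%:E)%E.
  by rewrite muleA -EFinM; congr (_%:E * _)%E; rewrite KN; field; rewrite gt_eqF.
move=> h; apply: (le_trans h); rewrite leeD2l //.
rewrite integralD_nneg //; last 2 first.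
- exact: measurable_funM.
- by move=> w; exact: mulr_ge0.
rewrite integralD_nneg //; last 2 first.
- exact: measurable_funM.
- by move=> w; exact: mulr_ge0.
rewrite integralD_nneg //; last 2 first.
- exact: measurable_funM.
- by move=> w; exact: mulr_ge0.
rewrite integral_prob_cst !integralZ_nneg // (rowsumE mmx) // EB.
have q1E : (0 <= q1%:E)%E by rewrite lee_fin.
have q2E : (0 <= q2%:E)%E by rewrite lee_fin.
have minB x : 0 <= Num.min (v x) B <= B by rewrite le_min v0 B0 ge_min lexx orbT.
apply: (le_trans (leeD (lee_wpmul2l q1E (rowV mpA pA01 EA))
  (leeD2r _ (lee_wpmul2l q2E (rowV mminv minB vB))))).
rewrite -!EFinM -!EFinD lee_fin le_eqVlt; apply/orP; left; apply/eqP.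
rewrite /q1 /q2 /q3 /q4; field.
by rewrite !gt_eqF // mulr_gt0.
Qed.

End rate_bounds.

End random_channel.

(** * The fixed point and the limit *)

Section fixed_point.
Context {R : realType} d (T : measurableType d) (P : probability T R).

(** Monotone convergence, phrased with strict lower bounds so that an infinite limit needs no
    separate treatment. *)
Lemma exists_lt_integral (g : nat -> T -> R) (f : T -> R) (t : R) :
  (forall n, measurable_fun setT (g n)) -> (forall n x, 0 <= g n x) ->
  (forall x, {homo g^~ x : n m / (n <= m)%N >-> n <= m}) ->
  (forall x, g^~ x @ \oo --> f x) ->
  (t%:E < \int[P]_x (f x)%:E -> exists n, t%:E < \int[P]_x (g n x)%:E)%E.
Proof.
move=> mg g0 ndg gf tf; apply: contrapT => /forallNP h.
move: tf; apply/negP; rewrite -leNgt.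
have cv : (\int[P]_x (g n x)%:E @[n --> \oo] --> \int[P]_x (limn (EFin \o g^~ x)))%E.
  apply: (@cvg_monotone_convergence _ _ _ P setT measurableT (fun n x => (g n x)%:E)).
  - by move=> n; exact/measurable_EFinP.
  - by move=> n x _; rewrite lee_fin.
  - by move=> x _ n m nm; rewrite lee_fin; exact: ndg.
have -> : (\int[P]_x (f x)%:E = \int[P]_x (limn (EFin \o g^~ x)))%E.
  apply: eq_integral => x _; apply/esym/cvg_lim => //.
  by apply: cvg_EFin => //; [exact: nearW|exact: gf].
apply: (cvge_le _ cv); apply: nearW => n; rewrite leNgt; exact/negP/h.
Qed.

Lemma exists_lt_truncated (f : T -> R) (t : R) : measurable_fun setT f ->
  (forall x, 0 <= f x) -> (t%:E < \int[P]_x (f x)%:E)%E ->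
  exists n : nat, (t%:E < \int[P]_x (Num.min (f x) n%:R)%:E)%E.
Proof.
move=> mf f0; apply: (exists_lt_integral (g := fun n x => Num.min (f x) n%:R)).
- by move=> n; exact: measurable_minr.
- by move=> n x; rewrite le_min f0 ler0n.
- by move=> x n m nm; rewrite le_min ge_min lexx /= ge_min ler_nat nm orbT.
- move=> x; apply: cvg_near_cst; exists (Num.truncn (f x)).+1 => // n /= xn.
  by apply/min_idPl; apply: ltW; apply: lt_le_trans (truncnS_gt _) _; rewrite ler_nat.
Qed.

Lemma integral_probability_gt0 (f : T -> R) : measurable_fun setT f ->
  (forall w, 0 < f w) -> (0 < \int[P]_w (f w)%:E)%E.
Proof.
move=> mf f0; rewrite lt_neqAle; apply/andP; split; last first.
  by apply: integral_ge0 => w _; rewrite lee_fin ltW.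
apply/eqP => h2; have mfE : measurable_fun setT (fun w => (f w)%:E) by exact/measurable_EFinP.
have /(ae_eq_integral_abs P measurableT mfE) : (\int[P]_w `|(f w)%:E| = 0)%E.
  by rewrite [RHS]h2; apply: eq_integral => w _; rewrite gee0_abs // lee_fin ltW.
move=> [Z [mZ Z0 ZP]]; have : (P setT <= P Z)%E.
  apply: le_measure; rewrite ?inE // => w _; apply: ZP => /= /(_ Logic.I) [] h3.
  by have := f0 w; rewrite h3 ltxx.
by rewrite Z0 probability_setT lee_fin ler10.
Qed.

Variables (A : T -> R) (beta : R).
Hypothesis mA : measurable_fun setT A.
Hypothesis A0 : forall w, 0 < A w.
Hypothesis beta0 : 0 < beta.

Let g x w := (1 + x * A w)^-1.
Let H x := (\int[P]_w (g x w)%:E)%E.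
Let xA1 (x : R) w : 0 <= x -> 0 < 1 + x * A w.
Proof. by move=> x0; rewrite ltr_wpDr // mulr_ge0 // ltW. Qed.
Let g01 (x : R) w : 0 <= x -> 0 <= g x w <= 1.
Proof.
move=> x0; rewrite /g invr_ge0 (ltW (xA1 w x0)) /= invf_le1 ?xA1 //.
by rewrite lerDl mulr_ge0 // ltW.
Qed.
Let mg (x : R) : 0 <= x -> measurable_fun setT (g x).
Proof.
move=> x0; apply: measurable_inv_gt0 => [|w]; last exact: xA1.
by apply: measurable_funD => //; exact: measurable_funM.
Qed.
Let H01 (x : R) : 0 <= x -> (0 <= H x <= 1)%E.
Proof.
move=> x0; apply/andP; split.
  by apply: integral_ge0 => w _; rewrite lee_fin; have /andP[] := g01 w x0.
rewrite -[leRHS](integral_prob_cst P); apply: le_integral_ge0 => w; rewrite lee_fin;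
  by have /andP[] := g01 w x0.
Qed.
Let Hfin (x : R) : 0 <= x -> H x \is a fin_num.
Proof.
move=> x0; have /andP[h0 h1] := H01 x0; rewrite ge0_fin_numE //.
exact: le_lt_trans h1 (ltry _).
Qed.
Let H_anti (x y : R) : 0 <= x -> x <= y -> (H y <= H x)%E.
Proof.
move=> x0 xy; have y0 := le_trans x0 xy; apply: le_integral_ge0 => w; rewrite lee_fin.
  by have /andP[] := g01 w y0.
by rewrite /g lef_pV2 ?posrE ?xA1 // lerD2l ler_wpM2r // ltW.
Qed.
(** A Lipschitz bound away from zero; the constant [1 / a] does not involve the mean of [A], which
    may be infinite. *)
Let H_lip (a x y : R) : 0 < a -> a <= x -> x <= y -> (H x <= H y + ((y - x) / a)%:E)%E.
Proof.
move=> a0 ax xy; have x0 := lt_le_trans a0 ax; have y0 := lt_le_trans x0 xy.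
have d0 : 0 <= (y - x) / a by rewrite divr_ge0 ?subr_ge0 // ltW.
have gy0 w : 0 <= g y w by have /andP[] := g01 w (ltW y0).
rewrite -(integral_prob_cst P ((y - x) / a)) -integralD_nneg //; last exact: mg (ltW y0).
apply: le_integral_ge0 => w; rewrite lee_fin; first by have /andP[] := g01 w (ltW x0).
rewrite -lerBlDl.
have hx := xA1 w (ltW x0); have hy := xA1 w (ltW y0).
have -> : g x w - g y w = ((y - x) / x) * ((1 - g x w) * g y w).
  by rewrite /g; field; rewrite !gt_eqF.
apply: (@le_trans _ _ ((y - x) / x)).
  have x1 : 0 <= (y - x) / x by rewrite divr_ge0 ?subr_ge0 // ltW.
  rewrite ler_piMr //; have /andP[h1 h2] := g01 w (ltW x0).
  have /andP[h3 h4] := g01 w (ltW y0); rewrite mulr_ile1 ?subr_ge0 //.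
  by rewrite lerBlDl lerDr.
by rewrite ler_wpM2l ?subr_ge0 // lef_pV2.
Qed.

(** Intermediate values of [beta (1 - H x) - (1 - x)]: it is nonnegative at [1], and at a small [a]
    it is nonpositive because [H] tends to [1] at zero. *)
Let eta_exists : exists2 eta, 0 < eta <= 1 & beta * (1 - fine (H eta)) = 1 - eta.
Proof.
have i0 n : 0 <= n.+1%:R^-1 :> R by rewrite invr_ge0.
have [n Hn] : exists n, ((1 - (2 * beta)^-1)%:E < H (n.+1%:R^-1))%E.
  apply: (exists_lt_integral (g := fun n => g n.+1%:R^-1) (f := fun=> 1)).
  - by move=> n; exact: mg.
  - by move=> n w; have /andP[] := g01 w (i0 n).
  - move=> w m n mn; rewrite /g lef_pV2 ?posrE ?xA1 // lerD2l ler_wpM2r ?(ltW (A0 w)) //.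
    by rewrite lef_pV2 ?posrE // ler_nat.
  - move=> w; rewrite -[X in _ --> X](_ : (1 + 0 * A w)^-1 = 1); last first.
      by rewrite mul0r addr0 invr1.
    apply: cvgV; first by rewrite mul0r addr0 oner_neq0.
    by apply: cvgD; [exact: cvg_cst|apply: cvgMl; exact: cvg_harmonic].
  - by rewrite integral_prob_cst lte_fin gtrBl invr_gt0 mulr_gt0.
(* The shift to [n + 2] ensures [a <= 1/2], hence [1 - a >= 1/2], while the choice of [n] gives
   [beta (1 - H a) < 1/2]. *)
pose a : R := n.+2%:R^-1.
have a0 : 0 < a by rewrite invr_gt0.
have a2 : a <= 2^-1 by rewrite lef_pV2 ?posrE // ler_nat.
have Ha : ((1 - (2 * beta)^-1)%:E < H a)%E.
  by apply: (lt_le_trans Hn); apply: H_anti (ltW a0) _; rewrite lef_pV2 ?posrE // ler_nat.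
(* Clipping the argument at [a] makes [h] Lipschitz on the whole line without changing it on
   [[a, 1]]. *)
pose h x := fine (H (Num.max a x)).
have hlip x y : x <= y -> `|h x - h y| <= a^-1 * (y - x).
  move=> xy; have ax : a <= Num.max a x by rewrite le_max lexx.
  have ay : a <= Num.max a y by rewrite le_max lexx.
  have mxy : Num.max a x <= Num.max a y by rewrite ge_max ay le_max xy orbT.
  have fx := Hfin (le_trans (ltW a0) ax); have fy := Hfin (le_trans (ltW a0) ay).
  have := H_lip a0 ax mxy; have := H_anti (le_trans (ltW a0) ax) mxy.
  rewrite -(fineK fx) -(fineK fy) -EFinD !lee_fin -/(h x) -/(h y) => h1 h2.
  rewrite ger0_norm ?subr_ge0 //; rewrite -lerBlDl in h2; apply: (le_trans h2).
  rewrite mulrC ler_wpM2l ?invr_ge0 ?(ltW a0) //.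
  have [h3|h3] := leP a x.
    by rewrite (max_idPr (le_trans h3 xy)).
  have [h4|h4] := leP a y; lra.
have ch : continuous h.
  move=> x; apply/cvgrPdist_le => e e0; near=> y.
  have yx : `|x - y| <= a * e.
    by near: y; apply: cvgr_dist_le; [exact: cvg_id|exact: mulr_gt0].
  have ie : a^-1 * (a * e) = e by rewrite mulKf // gt_eqF.
  rewrite -ie; have [xy|/ltW yx'] := leP x y.
    apply: (le_trans (hlip _ _ xy)); rewrite ler_wpM2l ?invr_ge0 ?(ltW a0) //.
    by rewrite -[y - x]ger0_norm ?subr_ge0 // distrC.
  rewrite distrC; apply: (le_trans (hlip _ _ yx')); rewrite ler_wpM2l ?invr_ge0 ?(ltW a0) //.
  by rewrite -[x - y]ger0_norm ?subr_ge0.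
pose f x := beta * (1 - h x) - (1 - x).
have cf : continuous f.
  move=> x; apply: cvgB; last by apply: cvgB; [exact: cvg_cst|exact: cvg_id].
  by apply: cvgMr; apply: cvgB; [exact: cvg_cst|exact: ch].
have a1 : a <= 1 by apply: le_trans a2 _; rewrite invf_le1 // ler1n.
have hE x : a <= x -> h x = fine (H x) by move=> ax; rewrite /h (max_idPr ax).
have fa : f a <= 0.
  rewrite /f hE // subr_le0; rewrite -(fineK (Hfin (ltW a0))) lte_fin in Ha.
  apply: (@le_trans _ _ (beta * (2 * beta)^-1)).
    by rewrite ler_wpM2l ?(ltW beta0) //; lra.
  have -> : beta * (2 * beta)^-1 = 2^-1 by field; rewrite gt_eqF.
  by rewrite lerBrDl -lerBrDr; apply: (le_trans a2); lra.
have f1 : 0 <= f 1.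
  have /andP[_] := H01 (ler01 : 0 <= 1 :> R); rewrite -(fineK (Hfin ler01)) lee_fin => h1.
  by rewrite /f hE // subrr subr0 mulr_ge0 ?(ltW beta0) // subr_ge0.
have [|x] := IVT (v := 0) a1 (continuous_subspaceT cf).
  by rewrite ge_min fa /= le_max f1 orbT.
rewrite in_itv /= => /andP[ax x1] fx; exists x; first by rewrite (lt_le_trans a0).
by move/eqP: fx; rewrite /f subr_eq0 hE // => /eqP.
Unshelve. all: by end_near. Qed.

(** Existence makes [xget] return a genuine solution instead of its default [1]. Positivity of [A]
    keeps the denominator away from zero at the root, so the product form found there yields the
    quotient form. *)
Lemma eta_solP : let eta := eta_sol P A beta in 0 < eta <= 1 /\
  (\int[P]_w (A w * eta / (1 + A w * eta))%:E = ((1 - eta) / beta)%:E)%E.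
Proof.
set eta := eta_sol _ _ _.
have HE (x : R) : fine 'E_P[fun w => (1 + x * A w)^-1] = fine (H x) by rewrite unlock.
have H1 (x : R) : 0 <= x -> (\int[P]_w (1 - g x w)%:E = (1 - fine (H x))%:E)%E.
  move=> x0; have e1 : (1%:E = \int[P]_w (1 - g x w)%:E + H x)%E.
    rewrite -(integral_prob_cst P) -integralD_nneg.
    - by apply: eq_integral => w _; rewrite subrK.
    - by apply: measurable_funB => //; exact: mg.
    - exact: mg.
    - by move=> w; rewrite subr_ge0; have /andP[] := g01 w x0.
    - by move=> w; have /andP[] := g01 w x0.
  by rewrite EFinB fineK ?Hfin // [X in (X - _)%E]e1 addeK ?Hfin.
have : [set eta : R | 0 < eta <= 1 /\
     beta = (1 - eta) / (1 - fine 'E_P[fun w => (1 + eta * A w)^-1])] eta.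
  have [x x01 Hx] := eta_exists; apply: (xgetPex 1); exists x; split=> //.
  rewrite HE -Hx; have x0 : 0 < x by have /andP[] := x01.
  suff h1 : 1 - fine (H x) != 0 by rewrite mulfK.
  apply/eqP => h1; have := H1 x (ltW x0); rewrite h1 => h2.
  have mf : measurable_fun setT (fun w => 1 - g x w).
    by apply: measurable_funB => //; exact: mg (ltW x0).
  suff /(integral_probability_gt0 mf) : forall w, 0 < 1 - g x w by rewrite h2 ltxx.
  move=> w; rewrite subr_gt0 /g invf_lt1 ?xA1 ?(ltW x0) //.
  by rewrite ltrDl mulr_gt0.
move=> [e01 be]; split=> //; have e0 : 0 < eta by have /andP[] := e01.
rewrite HE in be.
transitivity (\int[P]_w (1 - g eta w)%:E)%E.
  apply: eq_integral => w _; congr EFin; rewrite /g mulrC; field.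
  by rewrite gt_eqF // xA1 // ltW.
rewrite H1 ?(ltW e0) //; congr EFin.
(* A zero denominator would make the quotient, and with it [beta], equal to zero. *)
have h0 : 1 - fine (H eta) != 0.
  by apply/eqP => h0; have := beta0; rewrite be h0 invr0 mulr0 ltxx.
have h1 : beta * (1 - fine (H eta)) = 1 - eta by rewrite [in LHS]be mulfVK.
by rewrite -h1 mulrAC mulfV ?mul1r // gt_eqF.
Qed.

End fixed_point.

(** * Convergence of the normalised rate *)

Section limits.
Context {R : realType}.

Lemma cvge_bounds (u : nat -> \bar R) (l : \bar R) : l != -oo%E ->
  (forall t : R, (t%:E < l)%E -> \forall n \near \oo, (t%:E <= u n)%E) ->
  (forall t : R, (l < t%:E)%E -> \forall n \near \oo, (u n <= t%:E)%E) ->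
  u @ \oo --> l.
Proof.
case: l => [l| |] // _ lo up; last first.
  by apply/cvgeyPge => t; apply: lo; rewrite ltry.
have bd (e : R) : 0 < e -> \forall n \near \oo, ((l - e)%:E <= u n <= (l + e)%:E)%E.
  move=> e0; near=> n; apply/andP; split.
    by near: n; apply: lo; rewrite lte_fin gtrBl.
  by near: n; apply: up; rewrite lte_fin ltrDl.
apply/fine_cvgP; split.
  near=> n; have /andP[h1 h2] : ((l - 1)%:E <= u n <= (l + 1)%:E)%E by near: n; exact: bd.
  by apply: fin_real; rewrite (lt_le_trans _ h1) ?ltNyr // (le_lt_trans h2) ?ltry.
apply/cvgrPdist_le => e e0; near=> n.
have : ((l - e)%:E <= u n <= (l + e)%:E)%E by near: n; exact: bd.
rewrite /comp; case: (u n) => [y| |]; rewrite ?leeNy_eq ?leye_eq ?andbF //.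
by rewrite !lee_fin distrC ler_distl.
Unshelve. all: by end_near. Qed.

(** The tangent bound [ln N <= q N - 1 - ln q] with slope [q = c / (2 (a + 1))] uses half of [c N];
    the other half absorbs the constants. *)
Lemma ln_nat_le (a b c : R) : 0 <= a -> 0 < c ->
  exists m : nat, forall N : nat, (m <= N)%N -> (0 < N)%N -> a * ln N%:R + b <= c * N%:R.
Proof.
move=> a0 c0; pose q := c / (2 * (a + 1)).
have a1 : 0 < a + 1 by lra.
have q0 : 0 < q by rewrite divr_gt0 // mulr_gt0.
pose z := (a + 1) * (-1 - ln q) + b.
exists (Num.truncn (`|z| * 2 / c)).+1 => N mN N0.
have n0 : 0 < N%:R :> R by rewrite ltr0n.
have lN0 : 0 <= ln N%:R :> R by rewrite ln_ge0 // ler1n.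
have h1 : ln N%:R <= q * N%:R - 1 - ln q.
  have := ln_le_Bl (mulr_gt0 q0 n0); rewrite lnM ?posrE //; lra.
have h2 : z * 2 / c < N%:R.
  apply: (@le_lt_trans _ _ (`|z| * 2 / c)).
    by rewrite ler_pM2r ?invr_gt0 // ler_pM2r // ler_norm.
  by apply: lt_le_trans (truncnS_gt _) _; rewrite ler_nat.
rewrite ltr_pdivrMr // in h2.
have h3 := ler_wpM2l (ltW a1) h1.
have h4 : (a + 1) * (q * N%:R - 1 - ln q) = c * N%:R / 2 + (z - b).
  by rewrite /z /q; field; rewrite gt_eqF.
rewrite h4 mulrDl mul1r in h3; lra.
Qed.

Section normalized_rate.
Context d (T : measurableType d) (P : probability T R).
Variables (a v : T -> R) (mu beta eta s : R) (r : nat -> \bar R) (N K : nat -> nat).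
Hypothesis ma : measurable_fun setT a.
Hypothesis mv : measurable_fun setT v.
Hypothesis a0 : forall w, 0 <= a w.
Hypothesis v0 : forall w, 0 <= v w.
Hypothesis mu0 : 0 < mu.
Hypothesis beta0 : 0 < beta.
Hypothesis s0 : 0 < s.
Hypothesis eta01 : 0 < eta <= 1.
Hypothesis Ev : (\int[P]_w (v w)%:E = mu%:E)%E.
Hypothesis N0 : forall n, (0 < N n)%N.
Hypothesis KN : forall n, (K n)%:R = beta * (N n)%:R.
Hypothesis Noo : forall m, exists n0, forall n, (n0 <= n)%N -> (m <= N n)%N.

Let kappa := eta - 1 - ln eta.
Let J := (\int[P]_w (ln (1 + a w * eta))%:E)%E.

Hypothesis rle : forall n eps B muB delta, 0 < eps -> 0 <= B ->
    (\int[P]_w (Num.min (v w) B)%:E = muB%:E)%E ->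
    0 < delta -> mu / (1 + eps) + delta <= muB ->
    (r n <= (K n)%:R%:E * J + ((N n)%:R * kappa + (K n)%:R * ln (1 + eps) +
      ln (1 + (K n)%:R * mu / s) * (B ^+ 2 / delta ^+ 2) + (1 + ln (N n)%:R))%:E)%E.
Hypothesis rge : forall n eps B muB C tB, 0 < eps -> 0 <= B ->
    (\int[P]_w (Num.min (v w) B)%:E = muB%:E)%E ->
    0 <= C -> muB <= mu -> s <= (K n)%:R * (eps * mu / 2) ->
    (\int[P]_w (Num.max 0 (v w - B))%:E = tB%:E)%E ->
    (((N n).-1%:R * kappa)%:E +
       ((N n).-1%:R * beta)%:E * \int[P]_w (Num.min C (ln (1 + a w * eta)))%:E <=
     r n + ((N n).-1%:R * ((kappa + beta * C) * (beta ^+ 2 / ((K n)%:R * eta ^+ 2) +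
         B ^+ 2 / (K n)%:R * (16 / (eps * mu) ^+ 2) + tB * (4 / (eps * mu))) +
         beta ^+ 2 / ((K n)%:R * eta) + beta * ln (1 + eps)) + (1 + ln (N n)%:R))%:E)%E.

Let eta0 : 0 < eta. Proof. by have /andP[] := eta01. Qed.
Let f w := ln (1 + a w * eta).
Let mf : measurable_fun setT f.
Proof.
apply: measurableT_comp; first exact: measurable_ln.
by apply: measurable_funD => //; exact: measurable_funM.
Qed.
Let f0 w : 0 <= f w.
Proof. by rewrite ln_ge0 // lerDl mulr_ge0 // ltW. Qed.
Let J0 : (0 <= J)%E.
Proof. by apply: integral_ge0 => w _; rewrite lee_fin; exact: f0. Qed.
Let kappa0 : 0 <= kappa. Proof. by have := ln_le_Bl eta0; rewrite /kappa; lra. Qed.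

Let near_large (Q : nat -> Prop) m :
  (forall n, (m <= N n)%N -> Q n) -> \forall n \near \oo, Q n.
Proof.
by move=> mQ; have [n0 h] := Noo m; exists n0 => // n /= n0n; apply/mQ/h.
Qed.

(** Cutting [v] at level [B] makes the tail mean exactly the deficit [mu - muB]. *)
Let min_bounds (B : nat) : exists2 muB, (\int[P]_w (Num.min (v w) B%:R)%:E = muB%:E)%E &
  muB <= mu /\ (\int[P]_w (Num.max 0 (v w - B%:R))%:E = (mu - muB)%:E)%E.
Proof.
have mmin : measurable_fun setT (fun w => Num.min (v w) B%:R) by exact: measurable_minr.
have mmax : measurable_fun setT (fun w => Num.max 0 (v w - B%:R)).
  by apply: measurable_maxr => //; exact: measurable_funB.
have min0 w : 0 <= Num.min (v w) B%:R by rewrite le_min v0 ler0n.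
have max0 w : 0 <= Num.max 0 (v w - B%:R) by rewrite le_max lexx.
have : (\int[P]_w (Num.min (v w) B%:R)%:E + \int[P]_w (Num.max 0 (v w - B%:R))%:E = mu%:E)%E.
  rewrite -integralD_nneg // -Ev; apply: eq_integral => w _; congr EFin.
  have [h|h] := leP (v w) B%:R.
    by rewrite (max_idPl _) ?addr0 // subr_le0.
  by rewrite (max_idPr _) ?subr_ge0 ?(ltW h) // addrC subrK.
have : (0 <= \int[P]_w (Num.min (v w) B%:R)%:E)%E.
  by apply: integral_ge0 => w _; rewrite lee_fin.
have : (0 <= \int[P]_w (Num.max 0 (v w - B%:R))%:E)%E.
  by apply: integral_ge0 => w _; rewrite lee_fin.
case: (\int[P]_w (Num.max _ _)%:E)%E => [y| |] //; case: (integral _ _ _) => [x| |] //.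
rewrite !lee_fin => y0 x0 [xy]; exists x => //; split; first by lra.
by congr EFin; lra.
Qed.

Let min_close (e : R) : 0 < e -> exists B : nat, forall muB,
  (\int[P]_w (Num.min (v w) B%:R)%:E = muB%:E)%E -> mu - e < muB.
Proof.
move=> e0; have [|B h] := @exists_lt_truncated _ _ _ P v (mu - e) mv v0.
  by rewrite Ev lte_fin gtrBl.
by exists B => muB E; rewrite E lte_fin in h.
Qed.

(** The margin [g] is split: [eps] is chosen so that [beta ln (1 + eps) = g / 4], and [3 g / 4]
    remains for constants and multiples of [ln N] divided by [N]. When [J] is infinite no [t]
    qualifies. *)
Let rate_upper t : (kappa%:E + beta%:E * J < t%:E)%E ->
  \forall n \near \oo, ((N n)%:R^-1%:E * r n <= t%:E)%E.
Proof.
have := @rle; case: J J0 => [j| |] // j0 rle'; last first.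
  by rewrite gt0_muley ?lte_fin.
rewrite -EFinM -EFinD lte_fin => kt; rewrite lee_fin in j0.
pose g := t - (kappa + beta * j); have g0 : 0 < g by rewrite subr_gt0.
pose eps := expR (g / (4 * beta)) - 1.
have eps0 : 0 < eps by rewrite subr_gt0 expR_gt1 divr_gt0 // mulr_gt0.
have epsE : ln (1 + eps) = g / (4 * beta) by rewrite /eps addrC subrK expRK.
(* Half of the gap between [mu] and [mu / (1 + eps)]; the other half allows for the deficit
   [mu - muB]. *)
pose delta := (mu - mu / (1 + eps)) / 2.
have d0 : 0 < delta.
  rewrite divr_gt0 // subr_gt0 ltr_pdivrMr; last by lra.
  by rewrite mulrDr mulr1 ltrDl mulr_gt0.
have [B hB] := min_close d0; have [muB EB [muBmu _]] := min_bounds B.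
pose W := B%:R ^+ 2 / delta ^+ 2; have W0 : 0 <= W by rewrite divr_ge0 ?sqr_ge0.
pose bs := beta * mu / s; have bs0 : 0 <= bs by rewrite divr_ge0 ?mulr_ge0 // ltW.
have W1 : 0 <= W + 1 by rewrite addr_ge0.
have g4 : 0 < 3 * g / 4 by lra.
have [m hm] := ln_nat_le (W * ln (1 + bs) + 1) W1 g4.
apply: (near_large (m := m)) => n mn.
have n0 : 0 < (N n)%:R :> R by rewrite ltr0n.
have n1 : 1 <= (N n)%:R :> R by rewrite ler1n.
have lN0 : 0 <= ln (N n)%:R :> R by rewrite ln_ge0.
rewrite lee_pdivrMl //.
have hd : mu / (1 + eps) + delta <= muB.
  by apply: ltW; apply: le_lt_trans (hB _ EB); rewrite /delta; lra.
apply: (le_trans (rle' n eps B%:R muB delta eps0 (ler0n _ _) EB d0 hd)).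
rewrite -EFinM -EFinD lee_fin KN epsE -/W.
have h1 : ln (1 + beta * (N n)%:R * mu / s) <= ln (1 + bs) + ln (N n)%:R.
  have b1 : 0 < 1 + bs by lra.
  rewrite -lnM ?posrE // ler_ln ?posrE ?mulr_gt0 //; last first.
    by rewrite ltr_wpDr // divr_ge0 ?mulr_ge0 // ltW.
  have -> : beta * (N n)%:R * mu / s = bs * (N n)%:R by rewrite /bs; ring.
  by rewrite mulrDl mul1r lerD2r.
have h2 := ler_wpM2r W0 h1.
have h3 := hm _ mn (N0 n).
have e1 : beta * (N n)%:R * (g / (4 * beta)) = (N n)%:R * g / 4 by field; rewrite gt_eqF.
have e2 : (N n)%:R * t = (N n)%:R * (kappa + beta * j) + (N n)%:R * g by rewrite /g; ring.
rewrite e1 e2.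
have tri (A1 A2 A3 A4 A5 A6 : R) : A1 <= (A2 + A3) * A4 ->
    (A4 + 1) * A3 + (A4 * A2 + 1) <= 3 * g / 4 * A5 ->
    beta * A5 * j + (A5 * kappa + A5 * g / 4 + A1 + (1 + A3)) <=
    A5 * (kappa + beta * j) + A5 * g by lra.
exact: tri h2 h3.
Qed.

(** Some finite cap [C] already exceeds the level required. The margin [g] is then shared: [g / 8]
    for [eps], [g / 8] for the tail above [B], and [3 g / 4] for what vanishes with [N]. The order
    [C], [eps], [B], [N] matters, each error constant depending on the earlier choices. *)
Let rate_lower t : (t%:E < kappa%:E + beta%:E * J)%E ->
  \forall n \near \oo, (t%:E <= (N n)%:R^-1%:E * r n)%E.
Proof.
move=> tJ; pose u := (t - kappa) / beta.
have uJ : (u%:E < J)%E.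
  rewrite ltNge; apply/negP => Ju; move: tJ; apply/negP; rewrite -leNgt.
  apply: (@le_trans _ _ (kappa%:E + beta%:E * u%:E)%E).
    by rewrite leeD2l // lee_wpmul2l // lee_fin ltW.
  by rewrite -EFinM -EFinD lee_fin /u mulrC mulfVK ?gt_eqF // addrC subrK.
have [C uC] := exists_lt_truncated mf f0 uJ.
have {}uC : (u%:E < \int[P]_w (Num.min C%:R (ln (1 + a w * eta)))%:E)%E.
  by under eq_integral => w _ do rewrite minC.
have : (0 <= \int[P]_w (Num.min C%:R (ln (1 + a w * eta)))%:E)%E.
  by apply: integral_ge0 => w _; rewrite lee_fin le_min ler0n; exact: f0.
have : (\int[P]_w (Num.min C%:R (ln (1 + a w * eta)))%:E <= C%:R%:E)%E.
  rewrite -(integral_prob_cst P C%:R); apply: le_integral_ge0 => w; rewrite lee_fin.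
    by rewrite le_min ler0n; exact: f0.
  by rewrite ge_min lexx.
move Ej : (\int[P]_w (Num.min C%:R (ln (1 + a w * eta)))%:E)%E uC => [j| |] //.
rewrite !lee_fin lte_fin => uj jC j0.
pose g := kappa + beta * j - t; have g0 : 0 < g.
  by rewrite /u ltr_pdivrMr // in uj; rewrite /g; lra.
pose eps := expR (g / (8 * beta)) - 1.
have eps0 : 0 < eps by rewrite subr_gt0 expR_gt1 divr_gt0 // mulr_gt0.
have epsE : ln (1 + eps) = g / (8 * beta) by rewrite /eps addrC subrK expRK.
have em0 : 0 < eps * mu by rewrite mulr_gt0.
pose kC := kappa + beta * C%:R; have kC0 : 0 <= kC by rewrite addr_ge0 // mulr_ge0 // ltW.
have kC1 : 0 < kC + 1 by lra.
(* Chosen so that [kC * tau * 4 / (eps mu)] is at most [g / 8]; the [+ 1] covers [kC = 0]. *)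
pose tau := g * (eps * mu) / (32 * (kC + 1)).
have tau0 : 0 < tau by rewrite divr_gt0 ?mulr_gt0.
have [B hB] := min_close tau0; have [muB EB [muBmu EtB]] := min_bounds B.
have {}hB := hB _ EB.
(* The errors of order [1 / K], which become this constant when multiplied by [N]. *)
pose D := kC * (beta / eta ^+ 2 + B%:R ^+ 2 / beta * (16 / (eps * mu) ^+ 2)) + beta / eta.
have D0 : 0 <= D.
  apply: addr_ge0; last by rewrite divr_ge0 // ltW.
  apply: mulr_ge0 => //; apply: addr_ge0; first by rewrite divr_ge0 ?sqr_ge0 // ltW.
  by rewrite mulr_ge0 // divr_ge0 ?sqr_ge0 // ltW.
have g4 : 0 < 3 * g / 4 by lra.
have [m1 hm1] := ln_nat_le (t + g + D + 1) (ler01 : 0 <= 1 :> R) g4.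
pose z := s * 2 / (beta * (eps * mu)).
apply: (near_large (m := maxn m1 (Num.truncn z).+1)) => n.
rewrite geq_max => /andP[mn1 mn2].
have n0 : 0 < (N n)%:R :> R by rewrite ltr0n.
have nE : (N n).-1%:R = (N n)%:R - 1 :> R by rewrite -[in RHS](prednK (N0 n)) -natr1 addrK.
have n1 : 1 <= (N n)%:R :> R by rewrite ler1n.
have sK : s <= (K n)%:R * (eps * mu / 2).
  have : z < (N n)%:R by apply: lt_le_trans (truncnS_gt _) _; rewrite ler_nat.
  rewrite /z ltr_pdivrMr ?mulr_gt0 // KN => h.
  have -> : beta * (N n)%:R * (eps * mu / 2) = (N n)%:R * (beta * (eps * mu)) / 2 by ring.
  lra.
rewrite lee_pdivlMl //.
have := @rge n eps B%:R muB C%:R (mu - muB) eps0 (ler0n _ _) EB (ler0n _ _) muBmu sK EtB.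
rewrite Ej -leeBlDr // -EFinM -EFinD => /(le_trans _); apply.
rewrite -EFinM lee_fin KN epsE nE -/kC.
have h3 := hm1 _ mn1 (N0 n).
have h4 : kC * ((mu - muB) * (4 / (eps * mu))) <= g / 8.
  have h5 : (mu - muB) * (4 / (eps * mu)) <= g / (8 * (kC + 1)).
    have -> : g / (8 * (kC + 1)) = tau * (4 / (eps * mu)).
      by rewrite /tau; field; rewrite !gt_eqF.
    by rewrite ler_wpM2r ?divr_ge0 ?(ltW em0) //; lra.
  apply: (le_trans (ler_wpM2l kC0 h5)).
  have -> : kC * (g / (8 * (kC + 1))) = g / 8 * (kC / (kC + 1)).
    by field; rewrite gt_eqF.
  by rewrite ler_piMr ?ler_pdivrMr ?mul1r ?lerDl //; lra.
set w1 := kC * ((mu - muB) * (4 / (eps * mu))) in h4.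
have -> : kC * (beta ^+ 2 / (beta * (N n)%:R * eta ^+ 2) + B%:R ^+ 2 / (beta * (N n)%:R) *
      (16 / (eps * mu) ^+ 2) + (mu - muB) * (4 / (eps * mu))) +
      beta ^+ 2 / (beta * (N n)%:R * eta) + beta * (g / (8 * beta)) =
    D / (N n)%:R + w1 + g / 8.
  by rewrite /D /w1; field; rewrite !gt_eqF // mulr_gt0.
have h5 : ((N n)%:R - 1) * (D / (N n)%:R) <= D.
  have -> : ((N n)%:R - 1) * (D / (N n)%:R) = D - D / (N n)%:R by field; rewrite gt_eqF.
  by rewrite gerBl divr_ge0 // ltW.
have h6 : ((N n)%:R - 1) * w1 <= ((N n)%:R - 1) * (g / 8).
  by rewrite ler_wpM2l // subr_ge0.
have e2 : ((N n)%:R - 1) * kappa + ((N n)%:R - 1) * beta * j =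
    (N n)%:R * t + (N n)%:R * g - (t + g) by rewrite /g; ring.
rewrite e2.
have tri (A1 A2 A3 A4 A5 : R) : 1 * A3 + (t + g + A1 + 1) <= 3 * g / 4 * A2 ->
    (A2 - 1) * A4 <= A1 -> (A2 - 1) * A5 <= (A2 - 1) * (g / 8) ->
    A2 * t <= A2 * t + A2 * g - (t + g) - ((A2 - 1) * (A4 + A5 + g / 8) + (1 + A3)).
  by move: g0 => {}g0; lra.
exact: tri h3 h5 h6.
Qed.

Lemma normalized_rate_cvg :
  ((N n)%:R^-1%:E * r n)%E @[n --> \oo] --> (kappa%:E + beta%:E * J)%E.
Proof.
apply: cvge_bounds; [|exact: rate_lower|exact: rate_upper].
rewrite gt_eqF //; apply: lt_le_trans ltNy0 _; rewrite adde_ge0 ?lee_fin ?kappa0 //.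
by apply: mule_ge0; [rewrite lee_fin ltW|exact: J0].
Qed.

End normalized_rate.

End limits.

(** * The pilot coefficients *)

Section pilot_estimate.
Context {R : realType} (L : nat) (tp sigma2 : R) (k : 'I_L).
Hypothesis tp0 : 0 < tp.
Hypothesis sigma20 : 0 < sigma2.
Implicit Type x : 'I_L -> R.

Let power x : 0 < sigma2 + tp * \sum_(l < L) x l ^+ 2.
Proof. by rewrite ltr_pwDl // mulr_ge0 ?(ltW tp0) // sumr_ge0 // => l _; exact: sqr_ge0. Qed.

Lemma pilot_b_ge0 x : 0 <= pilot_b tp sigma2 x k.
Proof. by apply: divr_ge0; [rewrite mulr_ge0 ?sqr_ge0 // ltW|exact/ltW/power]. Qed.

Lemma pilot_b_gt0 x : 0 < x k -> 0 < pilot_b tp sigma2 x k.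
Proof. by move=> xk; apply: divr_gt0; [exact/mulr_gt0/exprn_gt0|exact: power]. Qed.

(** The numerator is one summand of the denominator, and the noise variance makes the inequality
    strict; this is what gives a positive mean interference. *)
Lemma pilot_b_lt1 x : pilot_b tp sigma2 x k < 1.
Proof.
rewrite ltr_pdivrMr ?power // mul1r.
apply: (@le_lt_trans _ _ (tp * \sum_(l < L) x l ^+ 2)); last by rewrite ltrDr.
rewrite ler_wpM2l ?(ltW tp0) // (bigD1 k) //= lerDl sumr_ge0 // => l _; exact: sqr_ge0.
Qed.

Lemma measurable_pilot_b : measurable_family (fun x => pilot_b tp sigma2 x k).
Proof.
have mX l : measurable_family (fun x => x l ^+ 2).
  by apply: measurable_funX; exact: measurable_tuple_fun.
apply: measurable_funM; first by apply: measurable_funM => //; exact: mX.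
apply: measurable_inv_gt0 => [|t]; last exact: power.
by apply: measurable_funD => //; apply: measurable_funM => //; apply: measurable_sum => l; exact: mX.
Qed.

End pilot_estimate.

(** * The limit for one cell *)

Section cell_rate.
Context {R : realType}.
Variables (L : nat) (sigma2 : R) (tau_p : nat) (zk beta : R) (Nseq Kseq : nat -> nat).
Hypothesis sigma20 : 0 < sigma2.
Hypothesis tau_p0 : (0 < tau_p)%N.
Hypothesis zk0 : 0 < zk.
Hypothesis beta0 : 0 < beta.
Hypothesis K0 : forall n, (0 < Kseq n)%N.
Hypothesis KN : forall n, (Kseq n)%:R = beta * (Nseq n)%:R.
Hypothesis Noo : forall B : nat, exists n0, forall n, (n0 <= n)%N -> (B <= Nseq n)%N.
Variables (dsp : measure_display) (T : nat -> measurableType dsp).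
Variables (P : forall n, probability (T n) R).
Variables (dd : forall n, 'I_L -> 'I_L -> 'I_(Kseq n) -> T n -> R).
Variables (X Y : forall n, 'I_(Nseq n) -> 'I_(Kseq n) -> T n -> R).
Hypothesis iXY : forall n,
  mutually_independent (P n) (model_family (@dd n) (@X n) (@Y n)).
Hypothesis HX : forall n a j B, measurable B ->
  P n (@X n a j @^-1` B) = normal_prob 0 (Num.sqrt (2^-1)) B.
Hypothesis HY : forall n a j B, measurable B ->
  P n (@Y n a j @^-1` B) = normal_prob 0 (Num.sqrt (2^-1)) B.
Variables (dsp0 : measure_display) (T0 : measurableType dsp0) (P0 : probability T0 R).
Variables (e : 'I_L -> 'I_L -> T0 -> R) (k : 'I_L).
Hypothesis e0 : forall l w, 0 < e k l w.
Hypothesis ie : mutually_independent P0 (fun kl : 'I_L * 'I_L => e kl.1 kl.2).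
Hypothesis lawe : forall n l m B, measurable B ->
  P n (@dd n k l m @^-1` B) = P0 (e k l @^-1` B).
Hypothesis mufin : (interf_mean tau_p sigma2 P0 e k < +oo)%E.

Let tp0 : 0 < tau_p%:R :> R. Proof. by rewrite ltr0n. Qed.
Let c (x : 'I_L -> R) := pilot_b tau_p%:R sigma2 x k * x k ^+ 2.
Let v (x : 'I_L -> R) := (1 - pilot_b tau_p%:R sigma2 x k) * x k ^+ 2.
Let mu := fine (interf_mean tau_p sigma2 P0 e k).
Let eta := eta_sol P0 (A_TD tau_p sigma2 beta P0 e k) beta.
Let s := zk * sigma2.

Let s0 : 0 < s. Proof. exact: mulr_gt0. Qed.
Let mxk : measurable_family (fun x : 'I_L -> R => x k ^+ 2).
Proof. by apply: measurable_funX; exact: measurable_tuple_fun. Qed.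
Let mc : measurable_family c.
Proof. by apply: measurable_funM => //; exact: measurable_pilot_b. Qed.
Let mv : measurable_family v.
Proof.
by apply: measurable_funM => //; apply: measurable_funB => //; exact: measurable_pilot_b.
Qed.
Let c0 x : 0 <= c x.
Proof. by rewrite mulr_ge0 ?sqr_ge0 // pilot_b_ge0. Qed.
Let v0 x : 0 <= v x.
Proof. by rewrite mulr_ge0 ?sqr_ge0 // subr_ge0 ltW // pilot_b_lt1. Qed.
Let iek : mutually_independent P0 (e k).
Proof. by apply: (mutually_independent_inj (f := fun l => (k, l)) _ ie) => l l' []. Qed.
Let mce : measurable_fun setT (fun w => c ((e k)^~ w)).
Proof. by apply: (measurable_comp_family mc) => l; exact: iek.1. Qed.
Let mve : measurable_fun setT (fun w => v ((e k)^~ w)).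
Proof. by apply: (measurable_comp_family mv) => l; exact: iek.1. Qed.

Let Ev : (\int[P0]_w (v ((e k)^~ w))%:E = mu%:E)%E.
Proof.
rewrite /mu fineK.
  by rewrite /interf_mean unlock.
rewrite ge0_fin_numE //; rewrite /interf_mean unlock.
by apply: integral_ge0 => w _; rewrite lee_fin; exact: v0.
Qed.
Let mu0 : 0 < mu.
Proof.
rewrite -lte_fin -Ev; apply: integral_probability_gt0 => // w.
by apply: mulr_gt0; [rewrite subr_gt0 pilot_b_lt1|rewrite exprn_gt0].
Qed.
Let A w := c ((e k)^~ w) / (beta * mu).
Let mA : measurable_fun setT A. Proof. exact: measurable_funM. Qed.
Let A0 w : 0 < A w.
Proof.
apply: divr_gt0; last exact: mulr_gt0.
by apply: mulr_gt0; [exact: pilot_b_gt0|rewrite exprn_gt0].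
Qed.
Let etaP : 0 < eta <= 1 /\
  (\int[P0]_w (A w * eta / (1 + A w * eta))%:E = ((1 - eta) / beta)%:E)%E.
Proof. exact: (eta_solP P0 mA A0 beta0). Qed.
Let eta0 : 0 < eta. Proof. by have /andP[] := etaP.1. Qed.
Let N0 n : (0 < Nseq n)%N.
Proof.
by have := K0 n; rewrite -(ltr0n R) KN pmulr_rgt0 // ltr0n.
Qed.
Let rate n : \bar R := ('E_(P n)[fun w => logdet (chanM (@X n) (@Y n) w)
  (Phi_TD tau_p%:R sigma2 (fun l m => @dd n k l m w) k zk)])%E.

Let ln2 : 0 < ln (2 : R). Proof. by rewrite ln_gt0 // ltr1n. Qed.

Lemma cell_rate_ge0 n : (0 <= rate n)%E.
Proof.
rewrite /rate; move: (N0 n) (@X n) (@Y n) (@iXY n).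
case: (Nseq n) => [//|N] _ X' Y' i'.
rewrite (expected_logdet i' mc mv c0 v0 s0 erefl erefl erefl).
apply: mule_ge0; first by rewrite lee_fin invr_ge0 ltW.
exact: split_rate_ge0 c0 v0 s0.
Qed.

Lemma cell_rate_cvg :
  ((Nseq n)%:R^-1%:E * rate n)%E @[n --> \oo] -->
  Psi P0 (A_TD tau_p sigma2 beta P0 e k) beta.
Proof.
have h : ((Nseq n)%:R^-1%:E * ((ln 2)%:E * rate n))%E @[n --> \oo] -->
    ((eta - 1 - ln eta)%:E + beta%:E * \int[P0]_w (ln (1 + A w * eta))%:E)%E.
  apply: (normalized_rate_cvg (s := s) (v := fun w => v ((e k)^~ w)) (mu := mu) (K := Kseq)) => //.
  - by move=> w; exact: ltW.
  - exact: etaP.1.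
  - move=> n eps B muB delta eps0 B0 EB d0 hd; rewrite /rate.
    move: (N0 n) (KN n) (@X n) (@Y n) (@iXY n) (@HX n) (@HY n).
    (* The channel bounds are stated for a successor number of antennas. *)
    case: (Nseq n) => [//|N] _ KN' X' Y' i' HX' HY'.
    rewrite (expected_logdet i' mc mv c0 v0 s0 erefl erefl erefl) muleA -EFinM.
    rewrite mulfV ?gt_eqF // mul1e.
    exact: (split_rate_le i' HX' HY' mc mv c0 v0 s0 (K0 n) iek (@lawe n) mu0 beta0 KN'
      etaP.1 eps0 B0 EB d0 hd).
  - move=> n eps B muB C tB eps0 B0 EB C0 muBmu sK EtB; rewrite /rate.
    move: (N0 n) (KN n) (@X n) (@Y n) (@iXY n) (@HX n) (@HY n).
    case: (Nseq n) => [//|N] _ KN' X' Y' i' HX' HY'.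
    rewrite (expected_logdet i' mc mv c0 v0 s0 erefl erefl erefl) muleA -EFinM.
    rewrite mulfV ?gt_eqF // mul1e.
    exact: (split_rate_ge i' HX' HY' mc mv c0 v0 s0 (K0 n) iek (@lawe n) mu0 beta0 KN'
      etaP.1 eps0 B0 EB C0 muBmu sK etaP.2 EtB).
have {h} := cvgeZl (y := (ln 2)^-1%:E) isT h.
rewrite (_ : (fun n => _) = fun n => ((Nseq n)%:R^-1%:E * rate n)%E); last first.
  apply/funext => n; rewrite muleCA; congr (_ * _)%E.
  by rewrite muleA -EFinM mulVf ?mul1e // gt_eqF.
have lnA0 w : 0 <= ln (1 + A w * eta) by rewrite ln_ge0 // lerDl mulr_ge0 // ltW.
have mlnA : measurable_fun setT (fun w => ln (1 + A w * eta)).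
  apply: measurableT_comp; first exact: measurable_ln.
  by apply: measurable_funD => //; exact: measurable_funM.
suff -> : Psi P0 (A_TD tau_p sigma2 beta P0 e k) beta = ((ln 2)^-1%:E *
    ((eta - 1 - ln eta)%:E + beta%:E * \int[P0]_w (ln (1 + A w * eta))%:E))%E by [].
apply/esym; rewrite /Psi unlock; cbv zeta; rewrite -/eta muleDr; last 2 first.
- by [].
- by rewrite fin_num_adde_defr.
rewrite addeC; congr (_ + _)%E; last first.
  by rewrite -EFinM /log2 expRK; congr EFin; field; rewrite gt_eqF.
rewrite muleCA; congr (_ * _)%E; rewrite -integralZ_nneg ?invr_ge0 ?(ltW ln2) //.
by apply: eq_integral => w _; rewrite /log2 mulrC [A w * _]mulrC.
Qed.

End cell_rate.

Theorem theorem4 (R : realType)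
  (* cells, noise variance, pilot/coherence lengths (tau_d = tau_c - tau_p) *)
  (L : nat) (HL : (0 < L)%N) (sigma2 : R) (Hsigma2 : 0 < sigma2)
  (tau_c tau_p : nat) (Htau_p : (0 < tau_p)%N) (Htau : (tau_p <= tau_c)%N)
  (* time-division fractions *)
  (zeta : 'I_L -> R) (Hzeta : forall k, 0 < zeta k)
  (Hzeta1 : \sum_(k < L) zeta k = 1)
  (* asymptotic regime: N_n -> oo, K_n = beta N_n *)
  (beta : R) (Hbeta : 0 < beta) (Nseq Kseq : nat -> nat)
  (HK : forall n, (0 < Kseq n)%N)
  (Hratio : forall n, (Kseq n)%:R = beta * (Nseq n)%:R)
  (HN : forall B : nat, exists n0, forall n, (n0 <= n)%N -> (B <= Nseq n)%N)
  (* the n-th model: attenuations d and M = X + i Y on a probability space *)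
  (dsp : measure_display) (T : nat -> measurableType dsp)
  (P : forall n, probability (T n) R)
  (dd : forall n, 'I_L -> 'I_L -> 'I_(Kseq n) -> T n -> R)
  (X Y : forall n, 'I_(Nseq n) -> 'I_(Kseq n) -> T n -> R)
  (Hdpos : forall n k l m w, 0 < dd n k l m w)
  (Hindep : forall n,
     mutually_independent (P n) (model_family (dd n) (X n) (Y n)))
  (HXlaw : forall n a j B, measurable B ->
     P n (X n a j @^-1` B) = normal_prob 0 (Num.sqrt (2^-1)) B)
  (HYlaw : forall n a j B, measurable B ->
     P n (Y n a j @^-1` B) = normal_prob 0 (Num.sqrt (2^-1)) B)
  (* a reference copy e_{k,l} of the attenuations, whose laws are those of
     every d_{k,l,m} (independent of N and m) *)
  (dsp0 : measure_display) (T0 : measurableType dsp0) (P0 : probability T0 R)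
  (e : 'I_L -> 'I_L -> T0 -> R)
  (Hepos : forall k l w, 0 < e k l w)
  (Heindep : mutually_independent P0 (fun kl : 'I_L * 'I_L => e kl.1 kl.2))
  (Hlaw : forall n k l m B, measurable B ->
     P n (dd n k l m @^-1` B) = P0 (e k l @^-1` B))
  (* E{(1 - b_{k,k,1}) d_{k,k,1}^2} is finite, so A^TD_k is well defined *)
  (Hfin : forall k, (interf_mean tau_p sigma2 P0 e k < +oo)%E) :
  (fun n => rTD tau_c tau_p sigma2 zeta (P n) (dd n) (X n) (Y n)) @ \oo -->
  ((((tau_c%:R - tau_p%:R) / tau_c%:R) / (L%:R * beta))%:E *
   \sum_(k < L) ((zeta k)%:E * Psi P0 (A_TD tau_p sigma2 beta P0 e k) beta))%E.
Proof.
have l0 : 0 < L%:R :> R by rewrite ltr0n.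
pose kap : R := ((tau_c%:R - tau_p%:R) / tau_c%:R) / (L%:R * beta).
pose rate n k : \bar R := ('E_(P n)[fun w => logdet (chanM (X n) (Y n) w)
  (Phi_TD tau_p%:R sigma2 (fun l m => dd n k l m w) k (zeta k))])%E.
have N0 n : (0 < Nseq n)%N.
  by have := HK n; rewrite -(ltr0n R) Hratio pmulr_rgt0 // ltr0n.
have cell k : ((Nseq n)%:R^-1%:E * rate n k)%E @[n --> \oo] -->
    Psi P0 (A_TD tau_p sigma2 beta P0 e k) beta.
  exact: (cell_rate_cvg Hsigma2 Htau_p (Hzeta k) Hbeta HK Hratio HN Hindep HXlaw HYlaw
    (Hepos k) Heindep (fun n => Hlaw n k) (Hfin k)).
have rate0 n k : (0 <= rate n k)%E.
  exact: (cell_rate_ge0 Hsigma2 Htau_p (Hzeta k) Hbeta HK Hratio Hindep).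
have : (kap%:E * \sum_(k < L) ((zeta k)%:E * ((Nseq n)%:R^-1%:E * rate n k)))%E
    @[n --> \oo] -->
    (kap%:E * \sum_(k < L) ((zeta k)%:E * Psi P0 (A_TD tau_p sigma2 beta P0 e k) beta))%E.
  (* Some cells may have limit [+oo]; nonnegativity of all terms lets the limits be added. *)
  apply: cvgeZl => //; apply: cvg_nnesum => k _; last by apply: cvgeZl => //; exact: cell.
  by apply: nearW => n; rewrite !mule_ge0 ?lee_fin ?invr_ge0 // ltW.
rewrite (_ : (fun n => (kap%:E * _)%E) =
  fun n => rTD tau_c tau_p sigma2 zeta (P n) (dd n) (X n) (Y n)) //.
apply/funext => n; rewrite /rTD.
have n0 : 0 < (Nseq n)%:R :> R by rewrite ltr0n.
(* Since [K = beta N], the prefactor [1 / (L K)] leaves exactly one [1 / N] to normalise each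
   cell. *)
have -> : ((tau_c%:R - tau_p%:R) / tau_c%:R) / (L * Kseq n)%:R = kap * (Nseq n)%:R^-1.
  by rewrite /kap natrM Hratio [L%:R * _]mulrA [in LHS]invfM mulrA.
rewrite [(kap * (Nseq n)%:R^-1)%:E]EFinM -muleA; congr (_ * _)%E; rewrite ge0_sume_distrr; last first.
  by move=> k _; rewrite mule_ge0 ?lee_fin ?(ltW (Hzeta k)) //; exact: rate0.
by apply: eq_bigr => k _; rewrite muleCA.
Qed.
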